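(* Let $\mathbf{u}\in C^2([0,T];X)$ be the solution of $$\rho\,\ddot{\mathbf{u}}(t,\mathbf{x})+\mathcal{L}^\epsilon[\mathbf{u}](t,\mathbf{x})=\mathbf{b}(t,\mathbf{x}),\qquad \mathbf{u}(0)=\mathbf{u}_0,\quad \dot{\mathbf{u}}(0)=\mathbf{v}_0,$$ with $\mathbf{u}_0,\mathbf{v}_0\in X$ and $\mathbf{b}\in C([0,T];X)$, where $\gamma$ is either of the degradation factors (a), (b) of the context. Then $$\max_{0<t<T}\left\{\mathcal{K}(t)+\mathcal{E}^\epsilon(t)+\mathcal{D}^\epsilon(t)\right\}<C,$$ where the constant $C$ depends only on the initial conditions and the load history (in particular, $C$ does not depend on $\epsilon$ when the initial conditions and the load do not).
   Context: Let $d\in\{2,3\}$, $\Omega\subset\mathbb{R}^d$ a bounded domain, $T>0$, $\epsilon>0$ and $\rho>0$ constants. Let $\omega_d$ be the volume of the unit ball of $\mathbb{R}^d$ and $V_d^\epsilon=\omega_d\epsilon^d$. The initial conditions are $\mathbf{u}_0,\mathbf{v}_0$ and the load history is $\mathbf{b}$. Function space: $\mathcal{U}=\{\mathbf{w}:\mathbf{w}(\mathbf{x})=\mathbb{Q}\mathbf{x}+\mathbf{c},\ \mathbb{Q}\in\mathbb{R}^{d\times d},\ \mathbb{Q}^T=-\mathbb{Q},\ \mathbf{c}\in\mathbb{R}^d\}$, and $X=\{\mathbf{u}\in L^\infty(\Omega;\mathbb{R}^d):\int_\Omega\mathbf{u}\cdot\mathbf{w}\,d\mathbf{x}=0\ \text{for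 all }\mathbf{w}\in\mathcal{U}\}$ with the $L^\infty$ norm. Kernel: $\rho^\epsilon(\mathbf{y},\mathbf{x})=\chi_\Omega(\mathbf{y})J(|\mathbf{y}-\mathbf{x}|/\epsilon)/(\epsilon V_d^\epsilon)$, where $\chi_\Omega$ is the characteristic function of $\Omega$ and $J:[0,\infty)\to[0,\infty)$ is decreasing, positive on $[0,1)$, with $J(0)=M<\infty$ and $J=0$ on $[1,\infty)$. Strain: $\mathbf{e}=(\mathbf{y}-\mathbf{x})/|\mathbf{y}-\mathbf{x}|$, $S(\mathbf{y},\mathbf{x},\mathbf{u}(t))=\frac{\mathbf{u}(t,\mathbf{y})-\mathbf{u}(t,\mathbf{x})}{|\mathbf{y}-\mathbf{x}|}\cdot\mathbf{e}$, and $r(t,\mathbf{u})=\sqrt{|\mathbf{y}-\mathbf{x}|}\,S(\mathbf{y},\mathbf{x},\mathbf{u}(t))$. Potential: there are constants $r^-<r^e<0<r^c<r^+$; $g:\mathbb{R}\to\mathbb{R}$ is $C^2$, with $g',g''$ bounded, $g=C^-$ for $r\le r^-$, $g=C^+$ for $r\ge r^+$; $g$ is convex on $[r^e,r^c]$ and concave on $[r^-,r^e]$ and on $[r^c,r^+]$; $g(0)=g'(0)=0$ (so $g\ge0$). Degradation factor, one of the following: (a) $\gamma(\mathbf{u})(\mathbf{y},\mathbf{x},t)=h\big(\int_0^t(r(\tau,\mathbf{u})-r^+)^+\,d\tau\big)$, where $(\cdot)^+$ is the positive part and $h\ge 0$ is smooth, equal to $1$ for negative arguments, decreasing to zero on $[0,x^D)$,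 and zero on $[x^D,\infty)$, for some $x^D>0$; (b) $\gamma(\mathbf{u})(\mathbf{y},\mathbf{x},t)=h\big(\sqrt{|\mathbf{y}-\mathbf{x}|}\,S^*(t,\mathbf{y},\mathbf{x},\mathbf{u})\big)$, where $S^*(t,\mathbf{y},\mathbf{x},\mathbf{u})=\max_{0\le\tau\le t}S(\mathbf{y},\mathbf{x},\mathbf{u}(\tau))$ and $h\ge0$ is smooth, equal to $1$ on $(-\infty,r^+]$, decreasing to zero on $[r^+,r^D]$, and zero on $[r^D,\infty)$, for some $r^D>r^+$. (In case (b), for the solution $\mathbf u$, $\gamma(\mathbf u)(\mathbf y,\mathbf x,\cdot)$ is Lipschitz in time and $\partial_t\gamma$ is its a.e. derivative.) Force density: $\mathcal{L}^\epsilon[\mathbf{u}](t,\mathbf{x})=-\int_\Omega\frac{2\rho^\epsilon(\mathbf{y},\mathbf{x})}{\sqrt{|\mathbf{y}-\mathbf{x}|}}\,\gamma(\mathbf{u})(\mathbf{y},\mathbf{x},t)\,g'(r(t,\mathbf{u}))\,\mathbf{e}\,d\mathbf{y}$. Energies: kinetic $\mathcal{K}(t)=\int_\Omega\rho\frac{|\dot{\mathbf{u}}(t)|^2}{2}d\mathbf{x}$; elastic $\mathcal{E}^\epsilon(t)=\int_\Omega\int_\Omega\rho^\epsilon(\mathbf{y},\mathbf{x})\gamma(\mathbf{u})(\mathbf{y},\mathbf{x},t)g(r(t,\mathbf{u}))\,d\mathbf{y}\,d\mathbf{x}$; damage $\mathcal{D}^\epsilon(t)=-\int_0^t\int_\O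mega\int_\Omega\rho^\epsilon(\mathbf{y},\mathbf{x})\,\partial_t\gamma(\mathbf{u})(\mathbf{y},\mathbf{x},\tau)\,g(r(\tau,\mathbf{u}))\,d\mathbf{y}\,d\mathbf{x}\,d\tau$.
   Formalization: The constant depends on the initial conditions through the initial energy K(0)+E^ε(0), monotonically, so it is independent of ε when these energies are bounded uniformly in ε; for general initial data in X they may blow up as ε→0 and the literal claim fails. *)

(* Defs.v *)
From HB Require Import structures.
From mathcomp Require Import all_boot all_order all_algebra.
From mathcomp Require Import all_classical all_reals all_analysis.

Set Implicit Arguments.
Unset Strict Implicit.
Unset Printing Implicit Defensive.

Import Order.TTheory GRing.Theory Num.Theory.
Import numFieldNormedType.Exports.

Local Open Scope classical_set_scope.
Local Open Scope ring_scope.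

Definition measure_rV_display : measure_display -> measure_display.
Proof. exact. Qed.

Section measurable_rV.
Context {d : measure_display} {T : sigmaRingType d}.
Variable n : nat.

Definition rV_coord (i : 'I_n) (x : 'rV[T]_n) : T := x ord0 i.

Let rV_set0 : g_sigma_preimage rV_coord set0.
Proof. exact: sigma_algebra0. Qed.

Let rV_setC A : g_sigma_preimage rV_coord A -> g_sigma_preimage rV_coord (~` A).
Proof. exact: sigma_algebraC. Qed.

Let rV_bigcup (F : (set 'rV[T]_n)^nat) :
  (forall i, g_sigma_preimage rV_coord (F i)) ->
  g_sigma_preimage rV_coord (\bigcup_i F i).
Proof. exact: sigma_algebra_bigcup. Qed.

HB.instance Definition _ := @isMeasurable.Build (measure_rV_display d)
  'rV[T]_n (g_sigma_preimage rV_coord) rV_set0 rV_setC rV_bigcup.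

End measurable_rV.

Section measurable_fun_rV.
Context d d' (S : measurableType d) (T : measurableType d').

Lemma measurable_rV_coord n (i : 'I_n) :
  measurable_fun [set: 'rV[T]_n] (rV_coord i).
Proof.
move=> _ Y mY; rewrite setTI; apply: sub_sigma_algebra => /=.
rewrite -bigcup_seq/=; exists i => /=; first by rewrite mem_index_enum.
by exists Y => //; rewrite setTI.
Qed.

Lemma measurable_fun_rV n (f : S -> 'rV[T]_n) :
  (forall i, measurable_fun [set: S] (rV_coord i \o f)) ->
  measurable_fun [set: S] f.
Proof.
move=> mf.
have sub : g_sigma_preimage (fun i => rV_coord i \o f) `<=` measurable.
  apply: smallest_sub; first exact: sigma_algebra_measurable.
  case: n f mf => [|n] f mf; first by rewrite big_ord0.
  rewrite -bigcup_mkord_ord; apply: bigcup_sub => i Ii.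
  by move=> A [B mB <-]; exact: mf.
rewrite g_sigma_preimage_comp in sub.
by move=> _ A mA; apply: sub; exists A.
Qed.

End measurable_fun_rV.

Lemma sigma_finite_prod d1 d2 (T1 : measurableType d1) (T2 : measurableType d2)
    (R : realType) (m1 : {sigma_finite_measure set T1 -> \bar R})
    (m2 : {sigma_finite_measure set T2 -> \bar R}) :
  sigma_finite setT (m1 \x m2)%E.
Proof.
have /sigma_finiteP[F [TF ndF Foo]] := sigma_finiteT m1.
have /sigma_finiteP[G [TG ndG Goo]] := sigma_finiteT m2.
exists (fun n => F n `*` G n).
  rewrite -setXTT TF TG predeqE => -[x y]; split.
    move=> [/= [n _ Fnx] [k _ Gky]]; exists (maxn n k) => //; split.
    - by move: x Fnx; exact/subsetPset/ndF/leq_maxl.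
    - by move: y Gky; exact/subsetPset/ndG/leq_maxr.
  by move=> [n _ []/= ? ?]; split; exists n.
move=> k; have [? ?] := Foo k; have [? ?] := Goo k.
split; first exact: measurableX.
by rewrite product_measure1E// lte_mul_pinfty// ge0_fin_numE.
Qed.

Section lebesgue_rV.
Context {R : realType}.

Definition rV_cons n (p : measurableTypeR R * 'rV[R]_n) : 'rV[R]_n.+1 :=
  \row_i (if unlift ord0 i is Some j then p.2 ord0 j else p.1).

Definition rV_uncons n (x : 'rV[R]_n.+1) : measurableTypeR R * 'rV[R]_n :=
  (x ord0 ord0, \row_j x ord0 (lift ord0 j)).

Lemma rV_consK n : cancel (@rV_cons n) (@rV_uncons n).
Proof.
move=> [a y]; rewrite /rV_uncons /rV_cons/= mxE unlift_none; congr pair.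
by apply/rowP => j; rewrite !mxE liftK.
Qed.

Lemma rV_unconsK n : cancel (@rV_uncons n) (@rV_cons n).
Proof.
by move=> x; apply/rowP => i; rewrite !mxE; case: unliftP => [j|] ->; rewrite ?mxE.
Qed.

Lemma measurable_rV_cons n : measurable_fun setT (@rV_cons n).
Proof.
apply: measurable_fun_rV => i.
case: (unliftP ord0 i) => [j|] ->.
- rewrite (_ : _ \o _ = rV_coord j \o snd).
    by apply: measurableT_comp => //; exact: measurable_rV_coord.
  by apply/funext => p /=; rewrite /rV_coord mxE liftK.
- rewrite (_ : _ \o _ = fst); first exact: measurable_fst.
  by apply/funext => p /=; rewrite /rV_coord mxE unlift_none.
Qed.

Lemma measurable_rV_uncons n : measurable_fun setT (@rV_uncons n).
Proof.
apply/measurable_fun_pairP; split; first exact: (@measurable_rV_coord _ R).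
apply: measurable_fun_rV => i.
rewrite (_ : _ \o _ = rV_coord (lift ord0 i)); first exact: measurable_rV_coord.
by apply/funext => x /=; rewrite /rV_coord mxE.
Qed.

Section lebesgue_rV_step.
Variables (n : nat) (mu : {sigma_finite_measure set 'rV[R]_n -> \bar R}).

Definition lebesgue_rV_step : set 'rV[R]_n.+1 -> \bar R :=
  pushforward (@lebesgue_measure R \x mu)%E (@rV_cons n).

Let step0 : lebesgue_rV_step set0 = 0%E.
Proof. by rewrite /lebesgue_rV_step /pushforward preimage_set0 measure0. Qed.

Let step_ge0 A : (0 <= lebesgue_rV_step A)%E.
Proof. by rewrite /lebesgue_rV_step /pushforward measure_ge0. Qed.

Let step_sigma_additive : semi_sigma_additive lebesgue_rV_step.
Proof.
have mc A : measurable A -> measurable (@rV_cons n @^-1` A).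
  by move=> mA; rewrite -[X in measurable X]setTI; exact: measurable_rV_cons.
move=> F mF tF mUF; rewrite /lebesgue_rV_step /pushforward preimage_bigcup.
apply: measure_semi_sigma_additive.
- by move=> k; exact: mc.
- apply/trivIsetP => /= i j _ _ ij; rewrite -preimage_setI.
  by move/trivIsetP : tF => /(_ _ _ _ _ ij) ->//; rewrite preimage_set0.
- by rewrite -preimage_bigcup; exact: mc.
Qed.

HB.instance Definition _ := isMeasure.Build _ _ _ lebesgue_rV_step
  step0 step_ge0 step_sigma_additive.

Let step_sigma_finite : sigma_finite setT lebesgue_rV_step.
Proof.
have [F FT Foo] : sigma_finite setT (@lebesgue_measure R \x mu)%E.
  exact: sigma_finite_prod.
exists (fun k => @rV_uncons n @^-1` F k).
  by rewrite -preimage_bigcup -FT preimage_setT.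
move=> k; have [mFk Fkoo] := Foo k; split.
  by rewrite -[X in measurable X]setTI; exact: measurable_rV_uncons.
rewrite /lebesgue_rV_step /pushforward -comp_preimage.
by rewrite (_ : _ \o _ = id) ?preimage_id//; apply/funext => p; exact: rV_consK.
Qed.

HB.instance Definition _ := Measure_isSigmaFinite.Build _ _ _ lebesgue_rV_step
  step_sigma_finite.

End lebesgue_rV_step.

Fixpoint lebesgue_rV n : {sigma_finite_measure set 'rV[R]_n -> \bar R} :=
  if n is n'.+1 then lebesgue_rV_step (lebesgue_rV n') else \d_(0 : 'rV[R]_0).

(* Together with sigma-finiteness, this characterizes [lebesgue_rV n]. *)
Lemma lebesgue_rV_box n (A : 'I_n -> set R) :
  (forall i, measurable (A i)) ->
  lebesgue_rV n [set x | forall i, A i (x ord0 i)] =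
  (\prod_(i < n) lebesgue_measure (A i))%E.
Proof.
elim: n A => [|n IH] A mA.
  by rewrite big_ord0 /= diracE mem_set//= => -[].
rewrite big_ord_recl -(IH (fun i => A (lift ord0 i))) /=; last by move=> i.
rewrite -product_measure1E//; last 2 first.
- exact: mA.
- rewrite (_ : (fun x => _) = \bigcap_(i in [set: 'I_n])
    (rV_coord i @^-1` A (lift ord0 i))).
    apply: fin_bigcap_measurable => // i _; rewrite -[X in measurable X]setTI.
    by apply: (@measurable_rV_coord _ R) => //; exact: mA.
  by apply/seteqP; split => [x Ax i _|x Ax i]; exact: Ax.
rewrite /lebesgue_rV_step /pushforward; congr (product_measure1 _ _ _).
apply/seteqP; split => -[a y] /=.
- move=> H; split; first by have := H ord0; rewrite mxE unlift_none.
  by move=> i; have := H (lift ord0 i); rewrite mxE liftK.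
- move=> [Aa Ay] i; rewrite mxE; case: unliftP => [j|] -> //.
Qed.

End lebesgue_rV.

Section definitions.
Context {R : realType} {d : nat}.
Local Notation E := 'rV[R]_d.
Local Notation vol := (@lebesgue_rV R d).
Implicit Types (Omega : set E) (x y : E) (w : E -> E) (u : R -> E -> E).

(* The library norm on ['rV[R]_d] is the sup norm. *)
Definition dotp x y : R := \sum_(i < d) x ord0 i * y ord0 i.
Definition enorm x : R := Num.sqrt (dotp x x).

Definition bounded_domain Omega : Prop :=
  [/\ Omega !=set0, open Omega, connected Omega & bounded_set Omega].

(* Vectors are rows: [x *m Q^T] is the product [Q x]. *)
Definition rigid_motion : set (E -> E) :=
  [set w | exists (Q : 'M[R]_d) (c : E),
    Q^T = - Q /\ w = fun x => x *m Q^T + c].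

Definition Linfty_norm Omega w : \bar R :=
  Lnorm vol +oo%E (fun x => (\1_Omega x * enorm (w x))%:E).

(* Elements of [L^infty(Omega; R^d)] are given by representatives defined on
   the whole of ['rV[R]_d]; only their values on [Omega] are used. *)
Definition spaceX Omega : set (E -> E) :=
  [set w | [/\ measurable_fun Omega w, (Linfty_norm Omega w < +oo)%E &
    forall v, rigid_motion v ->
      (\int[vol]_(x in Omega) dotp (w x) (v x))%R = 0]].

Definition C0_curve Omega (T : R) u : Prop :=
  (forall t, t \in `[0, T] -> spaceX Omega (u t)) /\
  (forall t, t \in `[0, T] ->
    Linfty_norm Omega (fun x => u s x - u t x)
      @[s --> within `[0, T] (nbhs t)] --> (0 : \bar R)).

Definition Linfty_derivative Omega (T : R) u (u' : R -> E -> E) : Prop :=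
  forall t, t \in `[0, T] ->
    Linfty_norm Omega (fun x => (s - t)^-1 *: (u s x - u t x) - u' t x)
      @[s --> within `[0, T] t^'] --> (0 : \bar R).

(* [u'] and [u''] are the time derivatives of [u]. A curve of classes in
   [X] that is continuous in time has representatives for which
   [t |-> u t x] is continuous for every [x]: the last clause says that [u]
   is such a representative, so that maxima and integrals over time of
   [u t x] make sense for fixed [x]. *)
Definition C2_curve Omega (T : R) u (u' u'' : R -> E -> E) : Prop :=
  [/\ C0_curve Omega T u, C0_curve Omega T u', C0_curve Omega T u'',
      Linfty_derivative Omega T u u' /\ Linfty_derivative Omega T u' u'' &
      forall x, Omega x -> {within `[0, T], continuous (fun t => u t x)}].

Definition ball_volume (eps : R) : R :=
  fine (vol [set x | enorm x < 1]) * eps ^+ d.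

Definition influence_function (J : R -> R) : Prop :=
  [/\ forall s, 0 <= s -> 0 <= J s,
      forall s s', 0 <= s -> s <= s' -> J s' <= J s,
      forall s, 0 <= s < 1 -> 0 < J s &
      forall s, 1 <= s -> J s = 0].

Definition peridynamic_kernel Omega (J : R -> R) (eps : R) y x : R :=
  \1_Omega y * J (enorm (y - x) / eps) / (eps * ball_volume eps).

Definition direction y x : E := (enorm (y - x))^-1 *: (y - x).

Definition strain y x w : R :=
  dotp ((enorm (y - x))^-1 *: (w y - w x)) (direction y x).

Definition scaled_strain y x w : R := Num.sqrt (enorm (y - x)) * strain y x w.

Record potential (g : R -> R) (rm re rc rp Cm Cp : R) : Prop := {
  potential_order : [/\ rm < re, re < 0, 0 < rc & rc < rp] ;
  potential_derivable : forall r, derivable g r 1 ;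
  potential_derivable2 : forall r, derivable (derive1 g) r 1 ;
  potential_continuous2 : continuous (derive1n 2 g) ;
  potential_bounded : exists K, forall r,
    `|derive1 g r| <= K /\ `|derive1n 2 g r| <= K ;
  potential_left : forall r, r <= rm -> g r = Cm ;
  potential_right : forall r, rp <= r -> g r = Cp ;
  potential_convex : @convex_function R R^o `[re, rc] g ;
  potential_concave_left : @convex_function R R^o `[rm, re] (fun r => - g r) ;
  potential_concave_right : @convex_function R R^o `[rc, rp] (fun r => - g r) ;
  potential_at0 : g 0 = 0 ;
  potential_derive_at0 : derive1 g 0 = 0 }.

Definition smooth (h : R -> R) : Prop :=
  forall n r, derivable (derive1n n h) r 1.

(* Degradation factors take arguments in the order [u, y, x, t]. *)
Definition degradation_integral (h : R -> R) (rp : R) u y x (t : R) : R :=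
  h (\int[lebesgue_measure]_(tau in `[0, t])
       Num.max (scaled_strain y x (u tau) - rp) 0)%R.

Definition max_strain u y x (t : R) : R :=
  sup [set strain y x (u tau) | tau in `[0, t]].

Definition degradation_max (h : R -> R) u y x (t : R) : R :=
  h (Num.sqrt (enorm (y - x)) * max_strain u y x t).

Definition degradation_profile (h : R -> R) (a b : R) : Prop :=
  [/\ smooth h, forall s, 0 <= h s,
      forall s s', a <= s -> s <= s' -> s' <= b -> h s' <= h s &
      forall s, b <= s -> h s = 0].

Definition degradation_factor (rp : R)
    (gam : (R -> E -> E) -> E -> E -> R -> R) : Prop :=
  (exists (h : R -> R) (xD : R),
    [/\ 0 < xD, degradation_profile h 0 xD, forall s, s < 0 -> h s = 1 &
        gam = degradation_integral h rp]) \/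
  (exists (h : R -> R) (rD : R),
    [/\ rp < rD, degradation_profile h rp rD, forall s, s <= rp -> h s = 1 &
        gam = degradation_max h]).

(* [derive1 f t] is unspecified where [f] is not derivable. *)
Definition ae_derive (f : R -> R) (t : R) : R :=
  if `[< derivable f t 1 >] then derive1 f t else 0.

Section model.
Variables (Omega : set E) (J g : R -> R) (eps : R).
Variable gam : (R -> E -> E) -> E -> E -> R -> R.

Definition force u (t : R) x : E :=
  \row_i (- \int[vol]_(y in Omega)
    (2 * peridynamic_kernel Omega J eps y x / Num.sqrt (enorm (y - x)) * gam u y x t
       * derive1 g (scaled_strain y x (u t)) * direction y x ord0 i))%R.

(* The equation and the initial conditions are equalities in [X], i.e. hold
   at almost every [x] in [Omega]. *)
Record solution (T rho : R) (b : R -> E -> E) (u0 v0 : E -> E)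
    (u u' u'' : R -> E -> E) : Prop := {
  solution_C2 : C2_curve Omega T u u' u'' ;
  solution_eq : forall t, t \in `[0, T] ->
    {ae vol, forall x, Omega x ->
      rho *: u'' t x + force u t x = b t x} ;
  solution_u0 : {ae vol, forall x, Omega x -> u 0 x = u0 x} ;
  solution_v0 : {ae vol, forall x, Omega x -> u' 0 x = v0 x} }.

Definition kinetic_energy (rho : R) (v : E -> E) : \bar R :=
  (\int[vol]_(x in Omega) (rho * (enorm (v x) ^+ 2 / 2))%R%:E)%E.

Definition elastic_energy u (t : R) : \bar R :=
  (\int[vol]_(x in Omega) \int[vol]_(y in Omega)
    (peridynamic_kernel Omega J eps y x * gam u y x t
       * g (scaled_strain y x (u t)))%R%:E)%E.

Definition damage_energy u (t : R) : \bar R :=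
  (- \int[lebesgue_measure]_(tau in `[0%R, t]) \int[vol]_(x in Omega)
      \int[vol]_(y in Omega)
        (peridynamic_kernel Omega J eps y x * ae_derive (gam u y x) tau
           * g (scaled_strain y x (u tau)))%R%:E)%E.

(* The kinetic plus elastic energy at time [0], as a function of the initial
   conditions; [gam u] at time [0] only depends on [u 0]. For a fixed [u0] in
   [L^infty] it may be unbounded as [eps] tends to [0]. *)
Definition initial_energy (rho : R) (u0 v0 : E -> E) : \bar R :=
  (kinetic_energy rho v0 + elastic_energy (fun=> u0) 0)%E.

End model.
End definitions.

(* Main.v *)
(* Testing the equation of motion with the velocity gives d/dt (K + E + D) =
   (b, u'): by the antisymmetry of the force in [x] and [y], its power is the
   derivative of [E] at frozen [gam], and the part of the derivative of [E]
   due to the decrease of [gam] is compensated by [D]. Only an upper bound for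
   the increment of [D] is needed; it follows from Fatou's lemma applied to
   the difference quotients of [gam], so [gam] need not be absolutely
   continuous in time. The singular factor |y - x|^(-1/2) is integrable, which
   allows one to differentiate under the integral. Finally (b, u') is at most
   [K] plus a bound depending on [b] and [rho] only, and Gronwall's inequality
   gives K + E + D <= (K(0) + E(0) + const) e^T, where the constant does not
   involve [eps], the kernel or the potential. *)
Require Import Defs.
From mathcomp Require Import all_boot all_order all_algebra.
From mathcomp Require Import all_classical all_reals all_analysis.
From mathcomp Require Import measurable_realfun ess_sup_inf.
From mathcomp Require Import ring lra.
Set Implicit Arguments.
Unset Strict Implicit.
Unset Printing Implicit Defensive.
Import Order.TTheory GRing.Theory Num.Theory.
Import numFieldNormedType.Exports.
Local Open Scope classical_set_scope.
Local Open Scope ring_scope.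

(** * A one-sided Gronwall inequality *)

(** The damage density is not shown to be measurable in time. The damage is handled only through
    monotonicity and subadditivity of integrals of nonnegative functions; this bounds its increments
    from above but gives no differentiability of the energy, hence the one-sided form of Gronwall's
    inequality. On [t, s] the factor g(r) under the damage integral is replaced by a majorant W
    constant in time: g(r(s)) plus a Lipschitz error of order (s - t)|y - x|^(-1/2). The main term
    cancels the loss of elastic energy exactly. The error is multiplied by the decrease of [gam]
    over [t, s], which tends to zero, so it is of smaller order than s - t. Identities in L^infty
    hold off null sets that depend on time. Limits are taken along sequences of times, for which the
    union of these sets is still null. Curves are extended to all times and all points, so that
    continuity and measurability hold globally. *)

Section real_analysis.
Context {R : realType}.
Implicit Types (a b e t s : R) (m F : R -> R).

(** Real induction. The supremum c of the times up to which the bound holds is attained, because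
    m(c) is at most the lower limit of m(s) as s increases to c; the right-hand condition then
    carries the bound beyond c unless c = b. *)
Lemma right_increment_le m a b e : 0 <= e ->
  (forall t, a <= t < b -> \forall s \near t^'+, m s <= m t + e * (s - t)) ->
  (forall t eta, a < t <= b -> 0 < eta -> \forall s \near t^'-, m t <= m s + eta) ->
  forall t, a <= t <= b -> m t <= m a + e * (t - a).
Proof.
move=> e0 mr ml.
pose P tau := m tau <= m a + e * (tau - a).
pose S := [set t | a <= t <= b /\ forall tau, a <= tau <= t -> P tau].
suff Sb : a <= b -> S b.
  by move=> t /andP[at_ tb]; apply: (Sb (le_trans at_ tb)).2; rewrite at_.
move=> ab.
have Sa : S a.
  split; first by rewrite lexx.
  move=> tau /le_anti <-; rewrite /P; lra.
have Sub : has_ubound S by exists b => t [/andP[]].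
have supS : has_sup S by split => //; exists a.
set c := sup S.
have ac : a <= c by exact: ub_le_sup.
have cb : c <= b by apply: ge_sup; [exists a|move=> t [/andP[]]].
have Pc_ tau : a <= tau -> tau < c -> P tau.
  move=> atau tc; have [t [tab Pt] taut] := sup_gt supS.1 tc.
  by apply: Pt; rewrite atau ltW.
have Pc : P c.
  have [ac'|] := ltP a c; last first.
    move=> ca; have -> : c = a by apply/eqP; rewrite eq_le ca ac.
    by apply: Sa.2; rewrite lexx.
  apply/ler_addgt0Pr => eta eta0.
  have near_s : \forall s \near c^'-, m c <= m s + eta by apply: ml; rewrite ?ac'.
  have : \forall s \near c^'-, m c <= m a + e * (c - a) + eta.
    near=> s.
    have sc : s < c by near: s; exact: nbhs_left_lt.
    have as_ : a <= s by near: s; exact: nbhs_left_ge.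
    have := Pc_ _ as_ sc; rewrite /P => Ps.
    have ms : m c <= m s + eta by near: s.
    have : e * (s - a) <= e * (c - a) by apply: ler_wpM2l => //; lra.
    lra.
  by move=> /filter_ex[].
have Sc : S c.
  split; first by rewrite ac.
  move=> tau /andP[atau]; rewrite le_eqVlt => /predU1P[->//|tauc].
  exact: Pc_.
have [cb'|bc] := ltP c b; last first.
  by have <- : c = b by apply/eqP; rewrite eq_le cb bc.
have [|d /= d0 md] := mr c; first by rewrite ac cb'.
pose c1 := Num.min b (c + d / 2).
have cc1 : c < c1 by rewrite lt_min cb' /=; lra.
have : S c1.
  split; first by rewrite ge_min lexx andbT; lra.
  move=> tau /andP[atau tauc1].
  have [tc|ct] := leP tau c; first by apply: Sc.2; rewrite atau tc.
  have : m tau <= m c + e * (tau - c).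
    apply: md => //=; rewrite ltr0_norm; last lra.
    by move: tauc1; rewrite le_min => /andP[_]; lra.
  move: Pc; rewrite /P; lra.
by move=> /(ub_le_sup Sub); rewrite -/c leNgt cc1.
Unshelve. all: by end_near. Qed.

(* Gronwall's inequality for a function that may jump upwards from the left
   but not downwards: [exp (- t) * (f t + beta)] has nonpositive upper right
   Dini derivatives. *)
Lemma gronwall_right (f : R -> R) (b beta : R) :
  (forall t, 0 <= t <= b -> 0 <= f t + beta) ->
  (forall t eta, 0 <= t < b -> 0 < eta ->
     \forall s \near t^'+, f s <= f t + (s - t) * (f t + beta + eta)) ->
  (forall t eta, 0 < t <= b -> 0 < eta -> \forall s \near t^'-, f t <= f s + eta) ->
  forall t, 0 <= t <= b -> f t + beta <= (f 0 + beta) * expR t.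
Proof.
move=> f0 fr fl t /[dup] t0b /andP[t0 tb].
pose m t := (f t + beta) * expR (- t).
suff : m t <= m 0.
  by rewrite /m oppr0 expR0 mulr1 expRN ler_pdivrMr ?expR_gt0.
apply/ler_addgt0Pr => eta eta0.
(* The slack [e] costs at most [eta] over [0, t]; adding 1 keeps the denominator positive at t =
   0. *)
pose e := eta / (t + 1).
have e0 : 0 < e by rewrite divr_gt0//; lra.
apply: (@le_trans _ _ (m 0 + e * (t - 0))); last first.
  rewrite lerD2l subr0 /e -mulrA ler_piMr ?(ltW eta0)//.
  by rewrite ler_pdivrMl; lra.
apply: (@right_increment_le m 0 b); [exact: ltW| | |by []].
- move=> s /andP[s0 sb]; near=> r.
  have sr : s < r by near: r; exact: nbhs_right_gt.
  have fsr : f r <= f s + (r - s) * (f s + beta + e).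
    by near: r; apply: fr => //; rewrite s0.
  have fs0 : 0 <= f s + beta by apply: f0; rewrite s0 ltW.
  have er : expR (- s) = expR (- r) * expR (r - s).
    by rewrite -expRD; congr expR; ring.
  (* Since f(s) + beta >= 0, this absorbs the growth factor 1 + (r - s) and leaves only the
     slack. *)
  have e1 : 1 + (r - s) <= expR (r - s) by exact: expR_ge1Dx.
  have e2 : expR (- r) <= 1 by rewrite -expR0 ler_expR; lra.
  have e3 : 0 < expR (- r) by exact: expR_gt0.
  rewrite /m er.
  have h1 : (f r + beta) * expR (- r) <=
      ((f s + beta) * (1 + (r - s)) + e * (r - s)) * expR (- r).
    by rewrite ler_wpM2r ?(ltW e3)//; lra.
  apply: (le_trans h1); rewrite mulrDl lerD//.
    by rewrite -mulrA ler_wpM2l// mulrC ler_wpM2l// ltW.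
  by rewrite ler_piMr// mulr_ge0//; lra.
- move=> s eta' /andP[s0 sb] eta'0.
  have cE : (fun r => (f s + beta) * expR (- r)) @ s^'- --> (f s + beta) * expR (- s).
    apply: cvg_at_left_filter; apply: cvgM; first exact: cvg_cst.
    by apply: continuous_comp; [exact: opp_continuous|exact: continuous_expR].
  move/cvgrPdist_le : cE => /(_ (eta' / 2)).
  rewrite divr_gt0// => /(_ isT) cE.
  near=> r.
  have rs : r < s by near: r; exact: nbhs_left_lt.
  have r0 : 0 <= r by near: r; exact: nbhs_left_ge.
  have h1 : `|(f s + beta) * expR (- s) - (f s + beta) * expR (- r)| <= eta' / 2.
    by near: r.
  have h2 : f s <= f r + eta' / 2 by near: r; apply: fl; [rewrite s0|lra].
  have e2 : expR (- r) <= 1 by rewrite -expR0 ler_expR; lra.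
  have e3 : 0 < expR (- r) by exact: expR_gt0.
  rewrite /m; move: h1; rewrite ler_norml => /andP[_ h1].
  have : (f s + beta) * expR (- r) <= (f r + beta + eta' / 2) * expR (- r).
    by rewrite ler_wpM2r ?(ltW e3)//; lra.
  have : eta' / 2 * expR (- r) <= eta' / 2 by rewrite ler_piMr//; lra.
  lra.
Unshelve. all: by end_near. Qed.

(** Serves to apply almost-everywhere arguments, which tolerate only countably many times. [P]
    records an a priori bound valid near [t], so that it may be assumed of every term of the
    sequence. *)
Lemma cvg_within_seqP (A : set R) (f : R -> R) (t l : R) (P : R -> Prop) :
  (\forall s \near within A t^', P s) ->
  (forall s_ : nat -> R, (forall n, [/\ A (s_ n), s_ n != t & P (s_ n)]) ->
     s_ n @[n --> \oo] --> t -> f (s_ n) @[n --> \oo] --> l) ->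
  f s @[s --> within A t^'] --> l.
Proof.
move=> nP fl; apply/cvgrPdist_lt => e e0; apply: contrapT => nf.
have H (n : nat) : exists s, [/\ A s, s != t, P s, `|t - s| < n.+1%:R^-1 &
    ~ (`|l - f s| < e)].
  apply: contrapT => /forallNP Hn; apply: nf.
  have near_ball : \forall s \near within A t^', `|t - s| < n.+1%:R^-1.
    apply: cvg_within; apply: nbhs_dnbhs.
    by exists n.+1%:R^-1 => //=; rewrite invr_gt0.
  have nA : \forall s \near within A t^', A s by exact: withinT.
  have nt : \forall s \near within A t^', s != t.
    by apply: cvg_within; apply: withinT.
  near=> s; apply: contrapT => ns; apply: (Hn s); split => //.
  - by near: s.
  - by near: s.
  - by near: s.
  - by near: s.
have [s_ Hs] := choice H.
have /cvgrPdist_lt/(_ e e0) : f (s_ n) @[n --> \oo] --> l.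
  apply: fl => [n|]; first by have [] := Hs n.
  apply/cvgrPdist_lt => d d0; near=> n.
  have [_ _ _ /lt_trans + _] := Hs n; apply.
  by near: n; exact: near_infty_natSinv_lt (PosNum d0).
by move=> [n _ /(_ n (leqnn n))]; have [] := Hs n.
Unshelve. all: by end_near. Qed.

End real_analysis.

Section ge0_integral_le.
Local Open Scope ereal_scope.
Context d (T : measurableType d) (R : realType).
Variable mu : {measure set T -> \bar R}.

(* No measurability is needed: the integral of a nonnegative function is a
   supremum over the simple functions below it. *)
Lemma ge0_integral_le (D : set T) (f g : T -> \bar R) :
  (forall x, D x -> 0 <= f x) -> (forall x, D x -> f x <= g x) ->
  \int[mu]_(x in D) f x <= \int[mu]_(x in D) g x.
Proof.
move=> f0 fg; rewrite ge0_integralE// ge0_integralE; last first.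
  by move=> x Dx; exact: le_trans (f0 _ Dx) (fg _ Dx).
apply: ge_ereal_sup => _ [h hf <-]; apply: ereal_sup_ubound; exists h => //.
move=> x; apply: (le_trans (hf x)); rewrite !patchE.
by case: ifPn => // xD; apply: fg; exact: set_mem.
Qed.

End ge0_integral_le.

(** * Convexity and the potential *)

Section potential_facts.
Context {R : realType}.
Implicit Types (f g : R -> R).

(** The difference quotient extended continuously to [x]: no case distinction is needed when the
    argument meets the base point. *)
Lemma derive1_caratheodory f x : derivable f x 1 ->
  exists q : R -> R, [/\ forall z, f z - f x = q z * (z - x),
    {for x, continuous q} & q x = (derive1 f) x].
Proof.
move=> df; apply/is_derive1_caratheodory.
by rewrite derive1E; exact: derivableP.
Qed.

Lemma convex_function_le f a b l x y : @convex_function R R^o `[a, b] f ->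
  0 <= l <= 1 -> a <= x <= b -> a <= y <= b ->
  f (l * x + (1 - l) * y) <= l * f x + (1 - l) * f y.
Proof.
move=> cf /andP[l0 l1] xab yab.
by have := cf (Itv01 l0 l1) x y; rewrite !inE/= !in_itv/=; exact.
Qed.

(** By convexity the quotient of [f] along the segment from [c] to [x] is at most f(x) - f(c), and
    it tends to f'(c)(x - c) = 0. Only this segment is used, so [c] may be an endpoint of [a, b], as
    it is for [rm] and [rp]. *)
Lemma convex_critical_le f a b c x :
  @convex_function R R^o `[a, b] f -> a <= c <= b ->
  derivable f c 1 -> (derive1 f) c = 0 -> a <= x <= b -> f c <= f x.
Proof.
move=> cf cab dfc f'c0 xab.
have [q [qE cq qc]] := derive1_caratheodory dfc.
pose z (n : nat) := n.+1%:R^-1 * x + (1 - n.+1%:R^-1) * c.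
have zc : z n @[n --> \oo] --> c.
  have -> : c = 0 * x + (1 - 0) * c by ring.
  apply: cvgD; apply: cvgMr_tmp => //; last apply: cvgB; try exact: cvg_cst.
  - exact: cvg_harmonic.
  - exact: cvg_harmonic.
have qz : q (z n) * (x - c) @[n --> \oo] --> q c * (x - c).
  by apply: cvgMr_tmp; apply: (cvg_comp _ _ zc); exact: cq.
rewrite -subr_ge0 -[leLHS](mul0r (x - c)) -[X in X * _]f'c0 -qc.
apply: (cvgr_to_le qz); apply: nearW => n /=.
have l0 : 0 < n.+1%:R^-1 :> R by rewrite invr_gt0.
have l1 : n.+1%:R^-1 <= 1 :> R by rewrite invf_le1// ler1n.
have zx : f (z n) <= n.+1%:R^-1 * f x + (1 - n.+1%:R^-1) * f c.
  by apply: (convex_function_le cf) => //; rewrite (ltW l0).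
have zE : z n - c = n.+1%:R^-1 * (x - c) by rewrite /z; ring.
rewrite -(ler_pM2l l0).
have -> : n.+1%:R^-1 * (q (z n) * (x - c)) = f (z n) - f c.
  by rewrite qE zE; ring.
have -> : n.+1%:R^-1 * (f x - f c) = (n.+1%:R^-1 * f x + (1 - n.+1%:R^-1) * f c) - f c.
  by ring.
by rewrite lerD2r.
Qed.

Lemma derive1_right_cst f c : derivable f c 1 ->
  (forall x, c <= x -> f x = f c) -> (derive1 f) c = 0.
Proof.
move=> dfc fc; have [q [qE cq <-]] := derive1_caratheodory dfc.
have : q x @[x --> c^'+] --> q c by apply: cvg_at_right_filter; exact: cq.
move=> /cvg_lim <-//; apply: lim_near_cst => //; near=> x.
have cx : c < x by near: x; exact: nbhs_right_gt.
have : q x * (x - c) = 0 by rewrite -qE fc ?subrr// ltW.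
by move/eqP; rewrite mulf_eq0 subr_eq0 (gt_eqF cx) orbF => /eqP.
Unshelve. all: by end_near. Qed.

Lemma derive1_left_cst f c : derivable f c 1 ->
  (forall x, x <= c -> f x = f c) -> (derive1 f) c = 0.
Proof.
move=> dfc fc; have [q [qE cq <-]] := derive1_caratheodory dfc.
have : q x @[x --> c^'-] --> q c by apply: cvg_at_left_filter; exact: cq.
move=> /cvg_lim <-//; apply: lim_near_cst => //; near=> x.
have cx : x < c by near: x; exact: nbhs_left_lt.
have : q x * (x - c) = 0 by rewrite -qE fc ?subrr// ltW.
by move/eqP; rewrite mulf_eq0 subr_eq0 (lt_eqF cx) orbF => /eqP.
Unshelve. all: by end_near. Qed.

Lemma concave_chord_ge0 f a b x : @convex_function R R^o `[a, b] (fun r => - f r) ->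
  a < b -> 0 <= f a -> 0 <= f b -> a <= x <= b -> 0 <= f x.
Proof.
move=> cf ab fa fb /andP[ax xb].
pose l := (b - x) / (b - a).
have l0 : 0 <= l by rewrite divr_ge0//; lra.
have l1 : l <= 1 by rewrite ler_pdivrMr; lra.
have xE : l * a + (1 - l) * b = x by rewrite /l; field; lra.
have := @convex_function_le _ a b l a b cf.
rewrite l0 l1 !lexx (ltW ab) xE => /(_ isT isT isT).
have : 0 <= l * f a by exact: mulr_ge0.
have : 0 <= (1 - l) * f b by apply: mulr_ge0 => //; lra.
lra.
Qed.

(** On [re, rc] the critical point 0 is a minimum of value 0. At [rp] the derivative vanishes, g
    being constant beyond; so g(rp) is the maximum of the right concave branch, hence at least g(rc)
    >= 0, and the branch lies above a nonnegative chord. The left branch is symmetric. *)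
Lemma potential_ge0 g rm re rc rp Cm Cp r :
  potential g rm re rc rp Cm Cp -> 0 <= g r.
Proof.
move=> pg; have [rmre re0 rc0 rcrp] := potential_order pg.
have dg := potential_derivable pg.
have dNg x : derivable (fun r => - g r) x 1 by apply: derivableN.
have gin x : re <= x <= rc -> 0 <= g x.
  move=> xin; rewrite -(potential_at0 pg).
  apply: (convex_critical_le (potential_convex pg)) => //; first lra.
  exact: potential_derive_at0 pg.
have grp : 0 <= g rp.
  apply: (@le_trans _ _ (g rc)); first by apply: gin; lra.
  rewrite -lerN2.
  apply: (convex_critical_le (f := fun r => - g r) (potential_concave_right pg)) => //; try lra.
  apply: derive1_right_cst => // x rpx.
  by rewrite (potential_right pg rpx) (potential_right pg (lexx _)).
have grm : 0 <= g rm.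
  apply: (@le_trans _ _ (g re)); first by apply: gin; lra.
  rewrite -lerN2.
  apply: (convex_critical_le (f := fun r => - g r) (potential_concave_left pg)) => //; try lra.
  apply: derive1_left_cst => // x xrm.
  by rewrite (potential_left pg xrm) (potential_left pg (lexx _)).
have [rrm|rmr] := leP r rm.
  by rewrite (potential_left pg rrm) -(potential_left pg (lexx _)).
have [rre|rer] := leP r re.
  apply: (concave_chord_ge0 (potential_concave_left pg)) => //; last lra.
  by apply: gin; lra.
have [rrc|rcr] := leP r rc; first by apply: gin; lra.
have [rrp|rpr] := leP r rp.
  apply: (concave_chord_ge0 (potential_concave_right pg)) => //; last lra.
  by apply: gin; lra.
by rewrite (potential_right pg (ltW rpr)) -(potential_right pg (lexx _)).
Qed.

Lemma potential_continuous g rm re rc rp Cm Cp :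
  potential g rm re rc rp Cm Cp -> continuous g.
Proof.
move=> pg x; apply: differentiable_continuous; apply/derivable1_diffP.
exact: potential_derivable pg _.
Qed.

Lemma potential_derive_continuous g rm re rc rp Cm Cp :
  potential g rm re rc rp Cm Cp -> continuous (derive1 g).
Proof.
move=> pg x; apply: differentiable_continuous; apply/derivable1_diffP.
exact: potential_derivable2 pg _.
Qed.

Lemma potential_ubound g rm re rc rp Cm Cp :
  potential g rm re rc rp Cm Cp -> exists G, forall r, g r <= G.
Proof.
move=> pg; have [rmre re0 rc0 rcrp] := potential_order pg.
have rmrp : rm <= rp by lra.
have cg : {within `[rm, rp], continuous g}.
  exact/continuous_subspaceT/(potential_continuous pg).
have [c _ gc] := EVT_max rmrp cg; exists (g c) => r.
have [rrm|rmr] := leP r rm.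
  rewrite (potential_left pg rrm) -(potential_left pg (lexx _)).
  by apply: gc; rewrite in_itv/= lexx.
have [rrp|rpr] := leP r rp; first by apply: gc; rewrite in_itv/= rrp ltW.
rewrite (potential_right pg (ltW rpr)) -(potential_right pg (lexx _)).
by apply: gc; rewrite in_itv/= lexx rmrp.
Qed.

Lemma potential_lipschitz g rm re rc rp Cm Cp :
  potential g rm re rc rp Cm Cp ->
  exists K, [/\ 0 <= K, forall r, `|(derive1 g) r| <= K &
    forall r s, `|g r - g s| <= K * `|r - s|].
Proof.
move=> pg; have [K gK] := potential_bounded pg.
have K0 : 0 <= K by apply: le_trans (gK 0).1.
exists K; split => // [r|]; first exact: (gK r).1.
have lip r s : r <= s -> `|g s - g r| <= K * `|s - r|.
  move=> rs; have [] := @MVT_segment _ g (derive1 g) _ _ rs.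
  - by move=> x _; rewrite derive1E; apply/derivableP/(potential_derivable pg).
  - exact/continuous_subspaceT/(potential_continuous pg).
  by move=> x _ ->; rewrite normrM ler_wpM2r//; exact: (gK x).1.
move=> r s; have [rs|/ltW sr] := leP r s; last exact: lip.
by rewrite distrC (distrC r); exact: lip.
Qed.

(** The chain rule along a sequence; the Caratheodory quotient keeps it valid at indices where
    [x_ n] equals [a]. *)
Lemma cvg_comp_quotient g (a l : R) (x_ dt_ : nat -> R) : derivable g a 1 ->
  x_ n @[n --> \oo] --> a -> (x_ n - a) / dt_ n @[n --> \oo] --> l ->
  (g (x_ n) - g a) / dt_ n @[n --> \oo] --> (derive1 g) a * l.
Proof.
move=> dg xa xl; have [q [qE cq <-]] := derive1_caratheodory dg.
under eq_cvg do rewrite qE -mulrA.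
by apply: cvgM => //; apply: (cvg_comp _ _ xa); exact: cq.
Qed.

End potential_facts.

(** * Fatou and dominated convergence for quotients *)

Section liminf_quotient.
Context {R : realType}.
Implicit Types (F : R -> R).

Lemma le_limn_einf (u v : (\bar R)^nat) : (forall n, u n <= v n)%E ->
  (limn_einf u <= limn_einf v)%E.
Proof.
move=> uv; rewrite !limn_einf_lim; apply: lee_lim; try exact: is_cvg_einfs.
apply: nearW => n; apply: le_ereal_inf_tmp => _ [p /= np <-].
by apply: le_trans (uv p); apply: ereal_inf_lbound; exists p.
Qed.

Lemma limn_einf_ge0 (u : (\bar R)^nat) : (forall n, 0 <= u n)%E ->
  (0 <= limn_einf u)%E.
Proof.
move=> u0; have <- : limn_einf (cst (0%E : \bar R)) = 0%E.
  by apply: (cvg_limn_einf_sup _).1; exact: cvg_cst.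
exact: le_limn_einf.
Qed.

Let mu := @lebesgue_measure R.

Lemma continuous_antiderivative F a b : a < b -> continuous F ->
  exists P : R -> R, forall x, a < x < b -> derivable P x 1 /\ derive1 P x = F x.
Proof.
move=> ab cF; exists (fun x => (\int[mu]_(t in `[a, x]) F t)%R) => x /andP[ax xb].
apply: (@continuous_FTC1_closed _ F a x b) => //; last exact: cF.
apply: continuous_compact_integrable; first exact: segment_compact.
exact: continuous_subspaceT.
Qed.

Let harmonic_gt0 n : 0 < n.+1%:R^-1 :> R. Proof. by rewrite invr_gt0. Qed.

(** The integral is the mean of F over [t, t + h] minus its mean over [s, s + h]. By monotonicity
    the first is at most F(t) and the second at least F(s + h). *)
Lemma integral_quotient_le F t s h : t < s -> 0 < h <= 1 ->
  continuous F -> {homo F : x y /~ x <= y} ->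
  (\int[mu]_(tau in `[t, s]) (h^-1 * (F tau - F (tau + h)))%:E
    <= (F t - F (s + h))%:E)%E.
Proof.
move=> ts /andP[h0 h1] cF ndF.
(* Room on both sides: arguments reach s + h <= s + 1, and two-sided derivatives are wanted at the
   ends. *)
have [|P PF] := @continuous_antiderivative F (t - 1) (s + 2) _ cF; first lra.
have dP x : t - 1 < x < s + 2 -> is_derive x 1 P (F x).
  by move=> /PF[dPx <-]; rewrite derive1E; exact: derivableP.
pose G tau := h^-1 * (P tau - P (tau + h)).
have dG x : t - 1 < x < s + 1 -> is_derive x 1 G (h^-1 * (F x - F (x + h))).
  move=> xts; rewrite /G.
  have dPx : is_derive x 1 P (F x) by apply: dP; lra.
  have dPxh : is_derive (x + h) 1 P (F (x + h)) by apply: dP; lra.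
  have dsh : is_derive x 1 (fun y => y + h) (1 : R).
    by rewrite -[X in is_derive _ _ _ X]addr0; apply: is_deriveD.
  have dPh : is_derive x 1 (fun y => P (y + h)) (F (x + h)).
    rewrite -[X in is_derive _ _ _ X]mulr1.
    exact: (@is_derive1_comp _ P (fun y => y + h)).
  by apply: is_deriveZ; apply: is_deriveB.
rewrite (@continuous_FTC2 _ _ G t s ts).
- have [|||c cin Pc] := @MVT_segment _ P F t (t + h).
  + by lra.
  + by move=> x; rewrite in_itv/= => xin; apply: dP; lra.
  + apply: derivable_within_continuous => x; rewrite in_itv/= => xin.
    by apply: (PF x _).1; lra.
  have [|||c' c'in Pc'] := @MVT_segment _ P F s (s + h).
  + by lra.
  + by move=> x; rewrite in_itv/= => xin; apply: dP; lra.
  + apply: derivable_within_continuous => x; rewrite in_itv/= => xin.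
    by apply: (PF x _).1; lra.
  rewrite -EFinB lee_fin /G.
  have -> : h^-1 * (P s - P (s + h)) - h^-1 * (P t - P (t + h)) =
     h^-1 * (F c * (t + h - t)) - h^-1 * (F c' * (s + h - s)).
    by rewrite -Pc -Pc'; ring.
  have -> : h^-1 * (F c * (t + h - t)) - h^-1 * (F c' * (s + h - s)) = F c - F c'.
    by field; rewrite gt_eqF.
  move: cin c'in; rewrite !in_itv/= => /andP[tc _] /andP[_ cs].
  by rewrite lerB// ndF.
- apply: continuous_subspaceT => x.
  apply: cvgMl_tmp; apply: cvgB; first exact: cF.
  apply: (continuous_comp (f := fun y => y + h)); last exact: cF.
  by apply: cvgD => //; exact: cvg_cst.
- split => [x||].
  + by rewrite in_itv/= => xin; apply: (@ex_derive _ _ _ _ _ _ _ (dG x _)); lra.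
  + apply: cvg_at_right_filter; apply: differentiable_continuous.
    by apply/derivable1_diffP; apply: (@ex_derive _ _ _ _ _ _ _ (dG _ _)); lra.
  + apply: cvg_at_left_filter; apply: differentiable_continuous.
    by apply/derivable1_diffP; apply: (@ex_derive _ _ _ _ _ _ _ (dG _ _)); lra.
- move=> x; rewrite in_itv/= => xin; rewrite derive1E.
  by apply: (@derive_val _ _ _ _ _ _ _ (dG x _)); lra.
Qed.

(** Fatou's lemma in time gives one half of Lebesgue's theorem on monotone functions: the rate of
    decrease integrates to at most the decrease. Equality would require absolute continuity. *)
Lemma integral_limn_einf_quotient_le F t s : t <= s ->
  continuous F -> {homo F : x y /~ x <= y} ->
  (\int[mu]_(tau in `[t, s])
     limn_einf (fun n => (n.+1%:R * (F tau - F (tau + n.+1%:R^-1)))%:E)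
    <= (F t - F s)%:E)%E.
Proof.
move=> + cF ndF; rewrite le_eqVlt => /predU1P[->|ts].
  by rewrite set_itv1 integral_set1 subrr.
apply: le_trans (fatou _ _ _ _) _ => //.
- move=> n; apply/measurable_EFinP; apply: measurable_funTS.
  apply: continuous_measurable_fun => x.
  apply: cvgMl_tmp; apply: cvgB; first exact: cF.
  apply: (@cvg_comp _ _ _ (fun y => y + n.+1%:R^-1) F _ (nbhs (x + n.+1%:R^-1))); last exact: cF.
  by apply: cvgD => //; exact: cvg_cst.
- move=> n x _; rewrite lee_fin mulr_ge0// subr_ge0 ndF// lerDl ltW//.
apply: (@le_trans _ _ (limn_einf (fun n => (F t - F (s + n.+1%:R^-1))%:E))).
  apply: le_limn_einf => n.
  have := @integral_quotient_le F t s n.+1%:R^-1 ts _ cF ndF.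
  by rewrite invrK; apply; rewrite harmonic_gt0 invf_le1// ler1n.
rewrite (_ : limn_einf _ = (F t - F s)%:E)//.
apply: (cvg_limn_einf_sup _).1; apply: cvg_EFin; first exact: nearW.
apply: cvgB; first exact: cvg_cst.
have sh : s + n.+1%:R^-1 @[n --> \oo] --> s.
  rewrite -[X in _ --> X]addr0; apply: cvgD; first exact: cvg_cst.
  exact: cvg_harmonic.
by apply: (cvg_comp _ _ sh); exact: cF.
Qed.

End liminf_quotient.

Section dominated_Rintegral.
Context d (T : measurableType d) (R : realType).
Variable mu : {measure set T -> \bar R}.

Lemma dominated_cvg_Rintegral (D : set T) (f_ : nat -> T -> R) (f G : T -> R) :
  measurable D -> (forall n, measurable_fun D (f_ n)) -> measurable_fun D f ->
  {ae mu, forall x, D x -> f_ n x @[n --> \oo] --> f x} ->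
  mu.-integrable D (EFin \o G) ->
  {ae mu, forall x, D x -> forall n, `|f_ n x| <= G x} ->
  (\int[mu]_(x in D) f_ n x)%R @[n --> \oo] --> (\int[mu]_(x in D) f x)%R.
Proof.
move=> mD mf_ mf f_f iG f_G.
have [|||||if_ _ cf] := @dominated_convergence _ T R mu D mD
  (fun n x => (f_ n x)%:E) (EFin \o f) (EFin \o G).
- by move=> n; exact/measurable_EFinP.
- exact/measurable_EFinP.
- by apply: filterS f_f => x f_f Dx; apply: cvg_EFin; [exact: nearW|exact: f_f].
- by [].
- by apply: filterS f_G => x f_G n Dx; rewrite lee_fin; exact: f_G.
apply: fine_cvg; rewrite fineK//; exact: integrable_fin_num.
Qed.

(** The domination holds only almost everywhere; integrability is read off from dominated
    convergence for the constant sequence [f]. *)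
Lemma ae_le_integrable (D : set T) (f G : T -> R) : measurable D ->
  measurable_fun D f -> mu.-integrable D (EFin \o G) ->
  {ae mu, forall x, D x -> `|f x| <= G x} -> mu.-integrable D (EFin \o f).
Proof.
move=> mD mf iG fG; have [] := @dominated_convergence _ T R mu D mD
  (fun n x => (f x)%:E) (EFin \o f) (EFin \o G) => //.
- by move=> n; exact/measurable_EFinP.
- exact/measurable_EFinP.
- by apply: aeW => x Dx; exact: cvg_cst.
- by apply: filterS fG => x fG n Dx; rewrite lee_fin; exact: fG.
Qed.

End dominated_Rintegral.

(** * Euclidean vectors *)

Section euclidean.
Context {R : realType} {d : nat}.
Local Notation E := 'rV[R]_d.
Implicit Types (x y z : E) (w : E -> E).

Lemma dotp_ge0 x : 0 <= dotp x x.
Proof. by apply: sumr_ge0 => i _; rewrite -expr2 sqr_ge0. Qed.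

Lemma enorm_ge0 x : 0 <= enorm x. Proof. exact: sqrtr_ge0. Qed.

Lemma enorm_sqr x : enorm x ^+ 2 = dotp x x.
Proof. by rewrite sqr_sqrtr// dotp_ge0. Qed.

Lemma le_coord_enorm x i : `|x ord0 i| <= enorm x.
Proof.
rewrite -sqrtr_sqr ler_wsqrtr// /dotp (bigD1 i)//= -expr2 lerDl.
by apply: sumr_ge0 => j _; rewrite -expr2 sqr_ge0.
Qed.

Lemma enorm_le_sum x : enorm x <= \sum_(i < d) `|x ord0 i|.
Proof.
have s0 : 0 <= \sum_(i < d) `|x ord0 i| by exact: sumr_ge0.
rewrite -(@ler_pXn2r _ 2)// ?nnegrE ?enorm_ge0// enorm_sqr expr2 mulr_suml.
apply: ler_sum => i _; apply: (@le_trans _ _ (`|x ord0 i| * `|x ord0 i|)).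
  by rewrite -normrM ler_norm.
by rewrite ler_wpM2l// (bigD1 i)//= lerDl sumr_ge0.
Qed.

(** A coordinatewise bound in place of the Cauchy-Schwarz inequality. The factor d enters only
    dominating functions and Lipschitz constants, not the final bound. *)
Lemma normr_dotp_le x y : `|dotp x y| <= d%:R * (enorm x * enorm y).
Proof.
apply: (le_trans (ler_norm_sum _ _ _)).
have -> : d%:R * (enorm x * enorm y) = \sum_(i < d) (enorm x * enorm y).
  by rewrite sumr_const card_ord mulr_natl.
by apply: ler_sum => i _; rewrite normrM ler_pM// le_coord_enorm.
Qed.

Lemma dotpC x y : dotp x y = dotp y x.
Proof. by apply: eq_bigr => i _; rewrite mulrC. Qed.

Lemma dotpDl x y z : dotp (x + y) z = dotp x z + dotp y z.
Proof. by rewrite -big_split; apply: eq_bigr => i _; rewrite mxE mulrDl. Qed.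

Lemma dotpZl (a : R) x y : dotp (a *: x) y = a * dotp x y.
Proof. by rewrite mulr_sumr; apply: eq_bigr => i _; rewrite mxE mulrA. Qed.

Lemma dotpNl x y : dotp (- x) y = - dotp x y.
Proof. by rewrite -scaleN1r dotpZl mulN1r. Qed.

Lemma dotpBl x y z : dotp (x - y) z = dotp x z - dotp y z.
Proof. by rewrite dotpDl dotpNl. Qed.

Lemma dotpZr (a : R) x y : dotp x (a *: y) = a * dotp x y.
Proof. by rewrite dotpC dotpZl dotpC. Qed.

Lemma dotpNr x y : dotp x (- y) = - dotp x y.
Proof. by rewrite dotpC dotpNl dotpC. Qed.

Lemma enormZ (a : R) x : enorm (a *: x) = `|a| * enorm x.
Proof.
by rewrite /enorm dotpZl dotpZr mulrA -expr2 sqrtrM ?sqr_ge0// sqrtr_sqr.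
Qed.

Lemma enormN x : enorm (- x) = enorm x.
Proof. by rewrite -scaleN1r enormZ normrN1 mul1r. Qed.

Lemma enormB x y : enorm (x - y) = enorm (y - x).
Proof. by rewrite -enormN opprB. Qed.

(** Young's inequality. With [a] equal to [rho] the last term is exactly the kinetic energy
    density. *)
Lemma dotp_le_half (a : R) x y : 0 < a ->
  dotp x y <= a^-1 / 2 * enorm x ^+ 2 + a / 2 * enorm y ^+ 2.
Proof.
move=> a0; rewrite !enorm_sqr /dotp !mulr_sumr -big_split/=; apply: ler_sum => i _.
have := mulr_ge0 (ltW a0) (sqr_ge0 (a^-1 * x ord0 i - y ord0 i)).
rewrite expr2; set u := x ord0 i; set v := y ord0 i.
have -> : a * ((a^-1 * u - v) * (a^-1 * u - v)) =
    a^-1 * (u * u) + a * (v * v) - 2 * (u * v) by field; rewrite gt_eqF.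
lra.
Qed.

(* The singularity of the kernel of the force; it is [0] for [x = y]. *)
Definition isqrt_dist y x : R := (Num.sqrt (enorm (y - x)))^-1.

Lemma isqrt_dist_ge0 y x : 0 <= isqrt_dist y x.
Proof. by rewrite invr_ge0 sqrtr_ge0. Qed.

Lemma isqrt_distC y x : isqrt_dist y x = isqrt_dist x y.
Proof. by rewrite /isqrt_dist enormB. Qed.

Lemma direction_opp y x : direction y x = - direction x y.
Proof. by rewrite /direction enormB -scalerN opprB. Qed.

Lemma enorm_direction_le y x : enorm (direction y x) <= 1.
Proof.
rewrite enormZ ger0_norm ?invr_ge0 ?enorm_ge0//.
have [->|n0] := eqVneq (enorm (y - x)) 0; first by rewrite mulr0.
by rewrite mulVf.
Qed.

Lemma scaled_strainE y x w : scaled_strain y x w =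
  isqrt_dist y x * (dotp (w y) (direction y x) - dotp (w x) (direction y x)).
Proof.
rewrite /scaled_strain /strain dotpZl dotpBl mulrA; congr (_ * _).
rewrite /isqrt_dist; set n := enorm _.
have n0 : 0 <= n by exact: enorm_ge0.
(* For y = x both sides vanish, the inverse of 0 being 0. *)
have [->|nn0] := eqVneq n 0; first by rewrite invr0 mulr0 sqrtr0 invr0.
rewrite -{2}(sqr_sqrtr n0) expr2 invfM mulrA divff ?mul1r//.
by rewrite sqrtr_eq0 -ltNge lt_neqAle eq_sym nn0.
Qed.

Lemma scaled_strainC y x w : scaled_strain y x w = scaled_strain x y w.
Proof.
by rewrite !scaled_strainE isqrt_distC direction_opp !dotpNr; congr (_ * _); ring.
Qed.

Lemma strainC y x w : strain y x w = strain x y w.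
Proof.
rewrite /strain enormB direction_opp !dotpZl dotpNr -dotpNl.
by rewrite opprB.
Qed.

Lemma scaled_strainB y x w w' :
  scaled_strain y x w - scaled_strain y x w' = scaled_strain y x (fun z => w z - w' z).
Proof. by rewrite !scaled_strainE !dotpBl; ring. Qed.

Lemma scaled_strainZ (a : R) y x w :
  scaled_strain y x (fun z => a *: w z) = a * scaled_strain y x w.
Proof. by rewrite !scaled_strainE !dotpZl; ring. Qed.

Lemma normr_scaled_strain_le y x w :
  `|scaled_strain y x w| <= d%:R * (enorm (w y) + enorm (w x)) * isqrt_dist y x.
Proof.
rewrite scaled_strainE normrM ger0_norm ?isqrt_dist_ge0//.
rewrite mulrC ler_wpM2r ?isqrt_dist_ge0//.
apply: (le_trans (ler_normB _ _)); rewrite mulrDr.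
have dir v : `|dotp v (direction y x)| <= d%:R * enorm v.
  apply: (le_trans (normr_dotp_le _ _)); rewrite ler_wpM2l//.
  by rewrite ler_piMr ?enorm_ge0 ?enorm_direction_le.
by rewrite lerD.
Qed.

Lemma eq_scaled_strain y x w w' : w y = w' y -> w x = w' x ->
  scaled_strain y x w = scaled_strain y x w'.
Proof. by move=> wy wx; rewrite !scaled_strainE wy wx. Qed.

Lemma eq_strain y x w w' : w y = w' y -> w x = w' x -> strain y x w = strain y x w'.
Proof. by move=> wy wx; rewrite /strain wy wx. Qed.

End euclidean.

(** * Measurability of Euclidean expressions and of open sets *)

Section measurable_euclidean.
Context {R : realType} {d : nat}.
Local Notation E := 'rV[R]_d.

(** The approximating continuous functions x / (x^2 + 1/(n + 1)) vanish at 0, so their limit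
    reproduces the convention that the inverse of 0 is 0. *)
Lemma measurable_inv : measurable_fun [set: R] (fun x : R => x^-1).
Proof.
pose f (n : nat) (x : R) := x / (x ^+ 2 + n.+1%:R^-1).
apply: (@measurable_fun_cvg _ _ R setT f) => [n|x _].
  apply: measurable_funTS; apply: continuous_measurable_fun => x.
  apply: cvgM; first exact: cvg_id.
  apply: cvgV; last by apply: cvgD; [exact: exprn_continuous|exact: cvg_cst].
  by rewrite gt_eqF// ltr_wpDl ?sqr_ge0 ?invr_gt0.
rewrite /f; have [->|x0] := eqVneq x 0.
  by rewrite invr0; under eq_cvg do rewrite mul0r; exact: cvg_cst.
have -> : x^-1 = x / (x ^+ 2 + 0) by field.
apply: cvgMl_tmp; apply: cvgV; first by rewrite addr0 expf_eq0.
by apply: cvgD; [exact: cvg_cst|exact: cvg_harmonic].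
Qed.

Lemma measurable_coord (i : 'I_d) :
  measurable_fun [set: E] (fun x : E => x ord0 i : R).
Proof. exact: (@measurable_rV_coord _ R). Qed.

Section dotp.
Context d' (S : measurableType d').
Implicit Types (D : set S) (f g : S -> E).

(** Measurability is kept in this form because it passes through differences and scalar multiples by
    facts on real functions alone. *)
Definition coord_measurable D f :=
  forall i, measurable_fun D (fun z => f z ord0 i : R).

Lemma measurable_fun_coord D f : measurable_fun D f -> coord_measurable D f.
Proof. by move=> mf i; apply: (measurableT_comp (measurable_coord i) mf). Qed.

Lemma coord_measurableB D f g : coord_measurable D f -> coord_measurable D g ->
  coord_measurable D (fun z => f z - g z).
Proof.
move=> mf mg i; under eq_fun do rewrite !mxE.
exact: measurable_funB.
Qed.

Lemma coord_measurableZ D (a : S -> R) f : measurable_fun D a ->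
  coord_measurable D f -> coord_measurable D (fun z => a z *: f z).
Proof.
by move=> ma mf i; under eq_fun do rewrite !mxE; exact: measurable_funM.
Qed.

Lemma measurable_dotp D f g : coord_measurable D f -> coord_measurable D g ->
  measurable_fun D (fun z => dotp (f z) (g z)).
Proof. by move=> mf mg; apply: measurable_sum => i; exact: measurable_funM. Qed.

Lemma measurable_enorm D f : coord_measurable D f ->
  measurable_fun D (fun z => enorm (f z)).
Proof.
move=> mf; apply: (measurableT_comp (f := @Num.sqrt R)); last exact: measurable_dotp.
by apply: continuous_measurable_fun; exact: sqrt_continuous.
Qed.

End dotp.

(** The sigma-algebra is generated by the coordinates, not by the topology. An open set is the union
    of the countably many boxes with rational centre and radius 1/(n + 1) that it contains. *)
Lemma open_rV_measurable (A : set E) : open A -> measurable A.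
Proof.
move=> oA.
pose box (p : nat * 'rV[rat]_d) :=
  [set y : E | forall i, `|ratr (p.2 ord0 i) - y ord0 i| < p.1.+1%:R^-1].
have mbox p : measurable (box p).
  rewrite (_ : box p = \bigcap_(i in [set: 'I_d])
     ((fun y : E => y ord0 i) @^-1` (ball (ratr (p.2 ord0 i) : R) (p.1.+1%:R^-1 : R)))).
    apply: fin_bigcap_measurable => // i _; rewrite -[X in measurable X]setTI.
    by apply: measurable_coord => //; apply: open_measurable; exact: ball_open.
  apply/seteqP; split => [x bx i _|x bx i]; first exact: bx.
  exact: (bx i Logic.I).
rewrite (_ : A = \bigcup_p (if `[< box p `<=` A >] then box p else set0)).
  apply: countable_bigcupT_measurable; first exact: countableP.
  by move=> p; case: ifPn.
apply/seteqP; split => [x Ax|x [p _]]; last by case: asboolP => // pA /pA.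
have := oA; rewrite openE => /(_ _ Ax); rewrite /interior => /nbhs_ballP[e /= e0 xeA].
(* A radius below e / 2: the rational centre is that close to x, so the whole box stays within e of
   x. *)
have [n _ /(_ n (leqnn n)) /= ne] :=
  near_infty_natSinv_lt (PosNum (divr_gt0 e0 (ltr0n R 2))).
have n0 : 0 < n.+1%:R^-1 :> R by rewrite invr_gt0.
have H i : exists q : rat, `|ratr q - x ord0 i| < n.+1%:R^-1.
  have [|r [xr [q _ qr]]] := @dense_rat R (ball (x ord0 i) n.+1%:R^-1) _ (ball_open _ _).
    by exists (x ord0 i); exact: ballxx.
  by exists q; rewrite qr distrC; exact: xr.
have [q Hq] := choice H.
exists (n, \row_i q i) => //.
rewrite asboolT; first by move=> i; rewrite mxE; exact: Hq.
move=> y yb; apply: xeA; split => // i j.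
have -> : i = ord0 by exact: ord1.
rewrite /ball/=.
have := yb j; rewrite mxE => yq; rewrite (le_lt_trans (ler_distD (ratr (q j)) _ _))//.
rewrite distrC.
have {}ne : n.+1%:R^-1 < e / 2 by exact: ne.
by rewrite (splitr e); apply: ltrD; apply: lt_trans ne; [exact: Hq|exact: yq].
Qed.

End measurable_euclidean.

(** * Integrals over products and over balls *)

Lemma Rintegral_sum d (T : measurableType d) (R : realType)
    (mu : {measure set T -> \bar R}) (D : set T) (I : Type) (s : seq I) (f : I -> T -> R) :
  measurable D -> (forall i, mu.-integrable D (EFin \o f i)) ->
  (\int[mu]_(x in D) \sum_(i <- s) f i x = \sum_(i <- s) \int[mu]_(x in D) f i x)%R.
Proof.
move=> mD fi; elim: s => [|i s IH].
  by rewrite big_nil; under eq_Rintegral do rewrite big_nil; rewrite /Rintegral integral0.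
rewrite big_cons -IH -RintegralD//.
  by apply: eq_Rintegral => x _; rewrite big_cons.
have := @integrable_sum _ _ _ mu D mD _ s xpredT _ (fun i _ => fi i).
apply: eq_integrable => // x _ /=.
by rewrite sumEFin.
Qed.

Section iterated_integral.
Context d1 d2 (T1 : measurableType d1) (T2 : measurableType d2) (R : realType).
Variable m1 : {sigma_finite_measure set T1 -> \bar R}.
Variable m2 : {sigma_finite_measure set T2 -> \bar R}.
Variables (A : set T1) (B : set T2).
Hypotheses (mA : measurable A) (mB : measurable B).
Local Notation m12 := (m1 \x m2)%E.

(** Restricting to a rectangle is extending by a default value in each variable in turn, which
    carries Fubini's theorem from the whole product to rectangles. *)
Lemma patch_setX (f : T1 * T2 -> \bar R) x y : (f \_ (A `*` B)) (x, y) =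
  ((fun x => ((fun y => f (x, y)) \_ B) y) \_ A) x.
Proof.
have ABE : ((x, y) \in A `*` B) = (x \in A) && (y \in B).
  apply/idP/andP => [|[/set_mem Ax /set_mem By]]; last exact/mem_set.
  by rewrite inE => -[Ax By]; rewrite !inE.
by rewrite !patchE ABE; case: (x \in A) => //=; rewrite patchE.
Qed.

Let mAB : measurable (A `*` B). Proof. exact: measurableX. Qed.

Lemma iterated_integral_patch (f : T1 * T2 -> \bar R) :
  (\int[m1]_(x in A) \int[m2]_(y in B) f (x, y) =
   \int[m1]_x \int[m2]_y (f \_ (A `*` B)) (x, y))%E.
Proof.
rewrite integral_mkcond; apply: eq_integral => x _; rewrite patchE.
have [xA|xA] := boolP (x \in A).
  rewrite integral_mkcond; apply: eq_integral => y _.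
  by rewrite patch_setX [RHS]patchE xA.
by rewrite integral0_eq// => y _; rewrite patch_setX patchE (negbTE xA).
Qed.

Lemma ge0_iterated_integral (f : T1 * T2 -> \bar R) :
  measurable_fun (A `*` B) f -> (forall z, (A `*` B) z -> 0 <= f z)%E ->
  (\int[m1]_(x in A) \int[m2]_(y in B) f (x, y) =
   \int[m12]_(z in A `*` B) f z)%E.
Proof.
move=> mf f0; rewrite iterated_integral_patch [RHS]integral_mkcond fubini_tonelli1//.
  exact/(measurable_restrictT _ _).1.
by move=> z; exact: erestrict_ge0.
Qed.

Lemma integrable_setX (f : T1 * T2 -> R) : measurable_fun (A `*` B) f ->
  (\int[m1]_(x in A) \int[m2]_(y in B) `|f (x, y)|%:E < +oo)%E ->
  m12.-integrable (A `*` B) (EFin \o f).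
Proof.
move=> mf foo; apply/integrableP; split; first exact/measurable_EFinP.
rewrite -(ge0_iterated_integral (f := fun z => `|f z|%:E))//.
by apply/measurable_EFinP; exact: measurableT_comp.
Qed.

(** The inner integral is made real by [fine], which is faithful where the section is integrable;
    this is asked at every point of [A]. *)
Lemma iterated_Rintegral (f : T1 * T2 -> R) :
  m12.-integrable (A `*` B) (EFin \o f) ->
  (forall x, A x -> m2.-integrable B (fun y => (f (x, y))%:E)) ->
  (\int[m1]_(x in A) (\int[m2]_(y in B) f (x, y)) =
   \int[m12]_(z in A `*` B) f z)%R.
Proof.
move=> iF ix; rewrite /Rintegral; congr fine.
transitivity (\int[m1]_(x in A) \int[m2]_(y in B) (f (x, y))%:E)%E.
  apply: eq_integral => x /set_mem Ax; rewrite fineK//.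
  exact: (integrable_fin_num mB (ix x Ax)).
rewrite (iterated_integral_patch (EFin \o f)) [RHS]integral_mkcond.
by apply: integral12_prod_meas1; exact/(integrable_mkcond _ _).1.
Qed.

Lemma measurable_iterated_Rintegral (f : T1 * T2 -> R) :
  m12.-integrable (A `*` B) (EFin \o f) ->
  (forall x, A x -> m2.-integrable B (fun y => (f (x, y))%:E)) ->
  measurable_fun A (fun x => \int[m2]_(y in B) f (x, y))%R.
Proof.
move=> iF ix; apply/measurable_EFinP.
apply: (eq_measurable_fun (fubini_F m2 ((EFin \o f) \_ (A `*` B)))).
  move=> x /set_mem Ax; rewrite /fubini_F /= fineK; last first.
    exact: (integrable_fin_num mB (ix x Ax)).
  rewrite [RHS]integral_mkcond; apply: eq_integral => y _.
  by rewrite patch_setX patchE mem_set.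
apply: measurable_funTS; apply: (@measurable_fubini_F _ _ _ _ _ m1).
exact: (integrable_mkcond _ mAB).1.
Qed.

Lemma ae_setX_fst (P : T1 -> Prop) : {ae m1, forall x, A x -> P x} ->
  {ae m12, forall z, (A `*` B) z -> P z.1}.
Proof.
move=> [N [mN N0 PN]]; exists (N `*` setT); split.
- exact: measurableX.
- by rewrite product_measure1E// [X in (X * _)%E]N0 mul0e.
- move=> [x y] /= /not_implyP[[Ax _] nP]; split => //; apply: PN => /=.
  by apply/not_implyP.
Qed.

Lemma ae_setX_snd (P : T2 -> Prop) : {ae m2, forall y, B y -> P y} ->
  {ae m12, forall z, (A `*` B) z -> P z.2}.
Proof.
move=> [N [mN N0 PN]]; exists (setT `*` N); split.
- exact: measurableX.
- by rewrite product_measure1E// [X in (_ * X)%E]N0 mule0.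
- move=> [x y] /= /not_implyP[[_ By] nP]; split => //; apply: PN => /=.
  by apply/not_implyP.
Qed.

End iterated_integral.

Section swap_integral.
Context d (T : measurableType d) (R : realType).
Variable m : {sigma_finite_measure set T -> \bar R}.
Variable A : set T.
Hypothesis mA : measurable A.

(** An iterated integral of the swapped function is, up to the names of the variables, the iterated
    integral of [f] in the other order. *)
Lemma Rintegral_swap (f : T * T -> R) :
  (m \x m)%E.-integrable (A `*` A) (EFin \o f) ->
  (m \x m)%E.-integrable (A `*` A) (EFin \o (fun z => f (z.2, z.1))) /\
  (\int[(m \x m)%E]_(z in A `*` A) f (z.2, z.1) = \int[(m \x m)%E]_(z in A `*` A) f z)%R.
Proof.
have mAA : measurable (A `*` A) by exact: measurableX.
move=> /(integrable_mkcond _ mAA).1; set F := _ \_ _ => iF.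
pose G z := F (z.2, z.1).
have GE : G = (EFin \o (fun z => f (z.2, z.1))) \_ (A `*` A).
  apply/funext => -[x y]; rewrite /G/= /F !patchE.
  have -> // : ((y, x) \in A `*` A) = ((x, y) \in A `*` A).
  by apply/idP/idP; rewrite !inE => -[].
have mF : measurable_fun setT F by exact: measurable_int iF.
have mG : measurable_fun setT G.
  by apply: (measurableT_comp mF); exact: measurable_swap.
have iG : (m \x m)%E.-integrable setT G.
  by apply/integrable21ltyP => //; rewrite /G/=; exact/integrable12ltyP.
split; first by apply/(integrable_mkcond _ mAA); rewrite -GE.
rewrite /Rintegral; congr fine.
transitivity (\int[(m \x m)%E]_z G z)%E; first by rewrite GE [LHS]integral_mkcond.
rewrite -(integral21_prod_meas1 iG) /fubini_G/= [RHS]integral_mkcond.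
by rewrite -(integral12_prod_meas1 iF).
Qed.

End swap_integral.

(** * Volumes of boxes and integrability of the singular factor *)

Section volume.
Context {R : realType}.

Lemma bounded_rV_box d (A : set 'rV[R]_d) : bounded_set A ->
  exists2 L : R, 0 <= L & A `<=` [set x | forall i, `[- L, L]%classic (x ord0 i)].
Proof.
move=> [M [_ AM]]; exists (`|M| + 1); first by rewrite addr_ge0.
move=> x Ax i /=; rewrite in_itv/= -ler_norml.
have /(_ _ Ax) : forall x, A x -> `|x| <= `|M| + 1.
  by apply: AM; rewrite ltr_pwDr// ler_norm.
apply: le_trans; rewrite [leRHS]mx_normrE.
exact: (le_bigmax _ (fun ij : 'I_1 * 'I_d => `|x ij.1 ij.2|) (ord0, i)).
Qed.

Lemma measurable_rV_box d (A : 'I_d -> set R) : (forall i, measurable (A i)) ->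
  measurable [set x : 'rV[R]_d | forall i, A i (x ord0 i)].
Proof.
move=> mA; rewrite (_ : (fun x => _) = \bigcap_(i in [set: 'I_d])
    ((fun x : 'rV[R]_d => x ord0 i) @^-1` A i)).
  apply: fin_bigcap_measurable => // i _; rewrite -[X in measurable X]setTI.
  by apply: measurable_coord => //; exact: mA.
by apply/seteqP; split => [x Ax i _|x Ax i]; exact: Ax.
Qed.

Lemma lebesgue_measure_sym_itv (L : R) : 0 <= L ->
  lebesgue_measure `[- L, L]%classic = (2 * L)%:E.
Proof.
move=> L0; rewrite lebesgue_measure_itv/= lte_fin; case: ifPn => [_|].
  by rewrite -EFinB; congr (_%:E); ring.
by rewrite -leNgt => LL; congr (_%:E); lra.
Qed.

Lemma lebesgue_rV_cube d (L : R) : 0 <= L ->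
  lebesgue_rV d [set x : 'rV[R]_d | forall i, `[- L, L]%classic (x ord0 i)] =
  ((2 * L) ^+ d)%:E.
Proof.
move=> L0; rewrite (@lebesgue_rV_box R d (fun=> `[- L, L]%classic))//.
rewrite (eq_bigr (fun=> (2 * L)%:E)) => [|i _]; last first.
  exact: lebesgue_measure_sym_itv.
by rewrite prodEFin big_const card_ord iter_mulr_1.
Qed.

Lemma bounded_rV_lty d (A : set 'rV[R]_d) : measurable A -> bounded_set A ->
  (lebesgue_rV d A < +oo)%E.
Proof.
move=> mA /bounded_rV_box[L L0 AL].
apply: (@le_lt_trans _ _ (lebesgue_rV d [set x | forall i, `[- L, L]%classic (x ord0 i)])).
  apply: le_measure => //; rewrite inE//.
  exact: (@measurable_rV_box _ (fun=> `[- L, L]%classic)).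
by rewrite lebesgue_rV_cube// ltry.
Qed.

Section singular_kernel.
Variables (d : nat) (L : R).
Hypothesis L0 : 0 <= L.
Local Notation E := 'rV[R]_d.+1.
Local Notation vol := (lebesgue_rV d.+1).

(** Near x only the first coordinate is localized: |y - x| is at least the distance of the first
    coordinates, and the exponent -1/2 is integrable already in dimension one. *)
Let slab (x : E) (k : nat) : set E := [set y | forall i,
  (if i == ord0 then ball (x ord0 ord0) (4^-1 ^+ k : R) else `[- L, L]%classic) (y ord0 i)].

Let measurable_slab x k : measurable (slab x k).
Proof.
apply: (@measurable_rV_box _ (fun i =>
  if i == ord0 then ball (x ord0 ord0) (4^-1 ^+ k : R) else `[- L, L]%classic)) => i.
by case: ifPn => // _; exact: measurable_ball.
Qed.

Let vol_slab x k : vol (slab x k) = (4^-1 ^+ k * 2 * (2 * L) ^+ d)%:E.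
Proof.
rewrite (@lebesgue_rV_box R d.+1 (fun i =>
  if i == ord0 then ball (x ord0 ord0) (4^-1 ^+ k : R) else `[- L, L]%classic)).
  rewrite big_ord_recl eqxx lebesgue_measure_ball ?exprn_ge0//.
  rewrite (eq_bigr (fun=> (2 * L)%:E)) => [|i _]; last first.
    exact: lebesgue_measure_sym_itv.
  rewrite prodEFin big_const card_ord iter_mulr_1 -EFinM mulr_natr.
  by [].
by move=> i; case: ifPn => // _; exact: measurable_ball.
Qed.

Let cube : set E := [set y | forall i, `[- L, L]%classic (y ord0 i)].

(* Dyadic layers: [4^-n <= |y - x| < 4^-(n-1)] puts [y] in the slab [n - 1],
   and there [|y - x|^(-1/2) <= 2^n]. *)
Let isqrt_dist_le_slabs (x y : E) : cube y ->
  ((isqrt_dist y x)%:E <= 1 + \sum_(k <oo) (2 ^+ k.+1 * \1_(slab x k) y : R)%:E)%E.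
Proof.
move=> cy; have s0 : (0 <= \sum_(k <oo) (2 ^+ k.+1 * \1_(slab x k) y : R)%:E)%E.
  by apply: nneseries_ge0 => k _ _; rewrite lee_fin mulr_ge0// ?exprn_ge0// indicE ler0n.
set r := enorm (y - x).
have r0 : 0 <= r by exact: enorm_ge0.
have [r1|r1] := leP 1 r.
  apply: (@le_trans _ _ 1%E); last by rewrite leeDl.
  rewrite lee_fin /isqrt_dist invf_le1; first by rewrite -sqrtr1 ler_wsqrtr.
  by rewrite sqrtr_gt0 (lt_le_trans ltr01).
have [rE|rn0] := eqVneq r 0.
  rewrite /isqrt_dist -/r rE sqrtr0 invr0; apply: adde_ge0 => //.
have rp : 0 < r by rewrite lt_neqAle eq_sym rn0.
have ex : exists n, 4^-1 ^+ n <= r.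
  have : (4^-1 : R) ^+ n @[n --> \oo] --> 0.
    by apply: cvg_expr; rewrite ger0_norm ?invr_ge0// invf_lt1// ltr1n.
  move=> /cvgr_le/(_ r rp)[n _ /(_ n (leqnn n)) rn].
  by exists n.
(* The least such n locates the layer of y; n = 0 is excluded by r < 1. *)
have [n rn nmin] := ex_minnP ex.
case: n rn nmin => [|n] rn nmin; first by move: r1; rewrite ltNge rn.
have rn' : r < 4^-1 ^+ n by rewrite ltNge; apply/negP => /nmin; rewrite ltnn.
have yslab : slab x n y.
  move=> i; case: ifPn => [/eqP ->|_]; last exact: cy.
  rewrite /ball/= distrC (le_lt_trans _ rn')//.
  by have := le_coord_enorm (y - x) ord0; rewrite !mxE.
apply: (@le_trans _ _ (\sum_(k <oo) (2 ^+ k.+1 * \1_(slab x k) y : R)%:E)%E); last first.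
  by rewrite leeDr.
apply: (@le_trans _ _ (\sum_(0 <= k < n.+1) (2 ^+ k.+1 * \1_(slab x k) y : R)%:E)%E); last first.
  by apply: nneseries_lim_ge => k _ _; rewrite lee_fin mulr_ge0// exprn_ge0.
rewrite big_nat_recr//=; apply: (@le_trans _ _ (2 ^+ n.+1 * \1_(slab x n) y)%:E); last first.
  by rewrite leeDr// sume_ge0// => k _; rewrite lee_fin mulr_ge0// exprn_ge0.
rewrite indicE mem_set// mulr1 lee_fin /isqrt_dist -/r.
have sr : 0 < Num.sqrt r by rewrite sqrtr_gt0.
rewrite invf_ple ?posrE ?exprn_gt0//.
have -> : (2 ^+ n.+1 : R)^-1 = Num.sqrt (4^-1 ^+ n.+1).
  rewrite -[LHS]ger0_norm ?invr_ge0 ?exprn_ge0// -sqrtr_sqr; congr Num.sqrt.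
  by rewrite -exprVn -exprM mulnC exprM; congr (_ ^+ _); field.
exact: ler_wsqrtr.
Qed.

(** The k-th slab has volume 2 (2L)^d / 4^k and weight 2^(k + 1), so it contributes 4 (2L)^d / 2^k;
    the geometric sum gives 8 (2L)^d, uniformly in [x]. *)
Lemma integral_isqrt_dist_le (x : E) :
  (\int[vol]_(y in cube) (isqrt_dist y x)%:E
    <= ((2 * L) ^+ d.+1 + 8 * (2 * L) ^+ d)%:E)%E.
Proof.
have mcube : measurable cube by exact: (@measurable_rV_box _ (fun=> `[- L, L]%classic)).
have m1 k : measurable_fun cube (fun y => (2 ^+ k.+1 * \1_(slab x k) y : R)%:E).
  by apply/measurable_EFinP; apply: measurable_funM => //; exact: measurable_indic.
have p0 k y : (0 <= (2 ^+ k.+1 * \1_(slab x k) y : R)%:E)%E.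
  by rewrite lee_fin mulr_ge0// exprn_ge0.
apply: le_trans (ge0_integral_le _ _ (@isqrt_dist_le_slabs x)) _.
  by move=> y _; rewrite lee_fin isqrt_dist_ge0.
rewrite ge0_integralD//; last 2 first.
- by move=> y _; apply: nneseries_ge0.
- exact: ge0_emeasurable_sum.
have vc : vol cube = ((2 * L) ^+ d.+1)%:E := lebesgue_rV_cube d.+1 L0.
rewrite integral_cst// mul1e [X in (X + _)%E]vc integral_nneseries//.
rewrite EFinD leeD2l//.
apply: lime_le; first by apply: is_cvg_nneseries => k _ _; exact: integral_ge0.
apply: nearW => n.
apply: (@le_trans _ _ (\sum_(0 <= k < n) (4 * (2 * L) ^+ d * 2^-1 ^+ k)%:E)%E).
  apply: lee_sum => k _.
  apply: (@le_trans _ _ (\int[vol]_y (2 ^+ k.+1 * \1_(slab x k) y : R)%:E)%E).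
    apply: ge0_subset_integral => //.
    by apply/measurable_EFinP; apply: measurable_funM => //; exact: measurable_indic.
  under eq_integral do rewrite EFinM.
  rewrite ge0_integralZl_EFin ?exprn_ge0//; last first.
    by apply/measurable_EFinP; exact: measurable_indic.
  rewrite integral_indic// setIT [X in (_ * X)%E]vol_slab -EFinM lee_fin.
  have -> : 4^-1 = 2^-1 * 2^-1 :> R by field.
  rewrite [(2^-1 * 2^-1) ^+ k]exprMn exprS.
  have -> : 2 * 2 ^+ k * (2^-1 ^+ k * 2^-1 ^+ k * 2 * (2 * L) ^+ d) =
    (2 * 2^-1) ^+ k * (4 * (2 * L) ^+ d * 2^-1 ^+ k) :> R.
    by rewrite [(2 * 2^-1) ^+ k]exprMn; ring.
  by rewrite divff// expr1n mul1r.
rewrite sumEFin lee_fin.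
have L1 : 0 <= (2 * L) ^+ d by rewrite exprn_ge0// mulr_ge0.
rewrite -mulr_sumr.
have -> : 8 * (2 * L) ^+ d = 4 * (2 * L) ^+ d * 2 by ring.
apply: ler_wpM2l; first by rewrite mulr_ge0.
have -> : \sum_(0 <= k < n) 2^-1 ^+ k = 2 - 2 * 2^-1 ^+ n :> R.
  elim: n => [|n IH]; first by rewrite big_geq// expr0; ring.
  by rewrite big_nat_recr//= IH exprS; field.
by rewrite lerBlDr lerDl mulr_ge0// exprn_ge0.
Qed.

End singular_kernel.

Section integrable_isqrt_dist.
Variables (d : nat) (Omega : set 'rV[R]_d.+1).
Hypotheses (mO : measurable Omega) (bO : bounded_set Omega).
Local Notation vol := (lebesgue_rV d.+1).

Lemma measurable_isqrt_dist (D : set ('rV[R]_d.+1 * 'rV[R]_d.+1)) :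
  measurable_fun D (fun z => isqrt_dist z.2 z.1).
Proof.
apply: measurable_funTS; apply: (measurableT_comp measurable_inv).
apply: (measurableT_comp (f := @Num.sqrt R)).
  by apply: continuous_measurable_fun; exact: sqrt_continuous.
apply: measurable_enorm; apply: coord_measurableB => i;
  by apply: (measurableT_comp (measurable_coord i)).
Qed.

Lemma integrable_isqrt_dist_fst x :
  vol.-integrable Omega (fun y => (isqrt_dist y x)%:E).
Proof.
have mx : measurable_fun [set: 'rV[R]_d.+1] (fun y => (isqrt_dist y x)%:E).
  apply/measurable_EFinP.
  by apply: (measurableT_comp (f := fun z => isqrt_dist z.2 z.1) (g := fun y => (x, y)));
    [exact: measurable_isqrt_dist|exact: measurable_pair1].
have [L L0 OL] := bounded_rV_box bO.
apply/integrableP; split; first exact: measurable_funTS.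
under eq_integral do rewrite gee0_abs ?lee_fin ?isqrt_dist_ge0//.
apply: le_lt_trans (ltry _); apply: le_trans (integral_isqrt_dist_le L0 x).
apply: ge0_subset_integral => //; first exact: (@measurable_rV_box _ (fun=> `[- L, L]%classic)).
  exact: measurable_funTS.
by move=> y _; rewrite lee_fin isqrt_dist_ge0.
Qed.

Lemma integrable_isqrt_dist :
  (vol \x vol)%E.-integrable (Omega `*` Omega) (fun z => (isqrt_dist z.2 z.1)%:E).
Proof.
have [L L0 OL] := bounded_rV_box bO.
apply: (integrable_setX mO mO (f := fun z => isqrt_dist z.2 z.1)).
  exact: measurable_isqrt_dist.
pose C := (2 * L) ^+ d.+1 + 8 * (2 * L) ^+ d.
apply: (@le_lt_trans _ _ (\int[vol]_(x in Omega) C%:E)%E).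
  apply: ge0_integral_le => [x _|x _]; first by apply: integral_ge0.
  apply: le_trans (integral_isqrt_dist_le L0 x).
  under eq_integral do rewrite ger0_norm ?isqrt_dist_ge0//=.
  apply: ge0_subset_integral => //; first exact: (@measurable_rV_box _ (fun=> `[- L, L]%classic)).
    apply: measurable_funTS; apply/measurable_EFinP.
    by apply: (measurableT_comp (f := fun z => isqrt_dist z.2 z.1) (g := fun y => (x, y)));
      [exact: measurable_isqrt_dist|exact: measurable_pair1].
  by move=> y _; rewrite lee_fin isqrt_dist_ge0.
rewrite integral_cst// lte_mul_pinfty//.
  by rewrite lee_fin addr_ge0// ?mulr_ge0// exprn_ge0// mulr_ge0.
exact: bounded_rV_lty.
Qed.

End integrable_isqrt_dist.
End volume.

(** * Running maxima and integrals of paths *)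

Section clamp.
Context {R : realType}.
Implicit Types (a b t s : R).

(** Composing with it turns a path continuous on [a, b] into one continuous on the whole line, so
    that difference quotients with a step beyond the end still make sense. *)
Definition clamp a b t := Num.max a (Num.min t b).

Lemma clamp_itv a b t : a <= b -> a <= clamp a b t <= b.
Proof. by move=> ab; rewrite /clamp le_max lexx ge_max ab ge_min lexx orbT. Qed.

Lemma clamp_id a b t : a <= t <= b -> clamp a b t = t.
Proof.
by move=> /andP[at_ tb]; rewrite /clamp (min_idPl tb) (max_idPr at_).
Qed.

Lemma le_clamp a b : {homo clamp a b : s t / s <= t}.
Proof.
move=> s t st; rewrite /clamp ge_max le_max lexx/= le_max.
have -> : Num.min s b <= Num.min t b; last by rewrite orbT.
by rewrite le_min !ge_min st lexx orbT.
Qed.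

Lemma continuous_clamp a b : continuous (clamp a b).
Proof.
move=> t; rewrite /clamp.
apply: (@continuous_max _ _ (fun=> a) (fun t => Num.min t b)); first exact: cvg_cst.
apply: (@continuous_min _ _ (fun t => t) (fun=> b)); first exact: cvg_id.
exact: cvg_cst.
Qed.

Lemma continuous_comp_clamp (V : topologicalType) (f : R -> V) a b : a <= b ->
  {within `[a, b], continuous f} -> continuous (fun t => f (clamp a b t)).
Proof.
move=> ab /subspace_continuousP cf t.
have ct : `[a, b]%classic (clamp a b t) by rewrite /= in_itv/= clamp_itv.
apply: cvg_trans (cf _ ct) => U; rewrite /= !nbhs_simpl/=.
move=> /(@continuous_clamp a b t); rewrite /= !nbhs_simpl/=.
apply: filterS => s; apply.
by rewrite /= in_itv/= clamp_itv.
Qed.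

End clamp.

Section path_functionals.
Context {R : realType}.
Implicit Types (f : R -> R) (T t s : R).
Local Notation mu := (@lebesgue_measure R).

Let integrable_itv f a b : continuous f -> mu.-integrable `[a, b] (EFin \o f).
Proof.
move=> cf; apply: continuous_compact_integrable; first exact: segment_compact.
exact: continuous_subspaceT.
Qed.

Lemma le_integral_itv f s t : continuous f -> (forall x, 0 <= f x) -> s <= t ->
  (\int[mu]_(x in `[0, s]) f x <= \int[mu]_(x in `[0, t]) f x)%R.
Proof.
move=> cf f0 st; rewrite /Rintegral fine_le//.
- by apply: integrable_fin_num => //; exact: integrable_itv.
- by apply: integrable_fin_num => //; exact: integrable_itv.
apply: ge0_subset_integral => //.
- by apply/measurable_EFinP/measurable_funTS; exact: continuous_measurable_fun.
- by move=> x _; rewrite lee_fin.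
- by apply: subset_itvl; rewrite bnd_simp.
Qed.

Lemma continuous_integral_itv f T : 0 <= T -> continuous f ->
  continuous (fun t => \int[mu]_(x in `[0, clamp 0 T t]) f x)%R.
Proof.
move=> T0 cf.
apply: (@continuous_comp_clamp R R (fun t => \int[mu]_(x in `[0, t]) f x)%R 0 T T0).
exact: (parameterized_integral_continuous T0 (integrable_itv 0 T cf)).
Qed.

Let grid t n (i : nat) : R := t / n.+1%:R * i%:R.

(** Serves for measurability in a parameter: a time integral is a limit of finite sums of its
    values. *)
Lemma cvg_riemann_sum f t : 0 <= t -> continuous f ->
  \sum_(0 <= i < n.+1) f (grid t n i) * (t / n.+1%:R) @[n --> \oo] -->
  (\int[mu]_(x in `[0, t]) f x)%R.
Proof.
move=> t0 cf; rewrite le_eqVlt in t0; move: t0 => /predU1P[<-|t0].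
  rewrite set_itv1 Rintegral_set1; apply: cvg_near_cst; apply: nearW => n.
  by rewrite big1// => i _; rewrite mul0r mulr0.
have [|P PF] := @continuous_antiderivative R f (- 1) (t + 1) _ cf; first lra.
have dP x : 0 <= x <= t -> is_derive x 1 P (f x).
  move=> xt; have [|dPx <-] := PF x; first lra.
  by rewrite derive1E; exact: derivableP.
have -> : (\int[mu]_(x in `[0, t]) f x)%R = P t - P 0.
  rewrite /Rintegral (@continuous_FTC2 _ f P 0 t t0) ?EFinB//.
  - exact: continuous_subspaceT.
  - split => [x||].
    + by rewrite in_itv/= => xt; apply: (@ex_derive _ _ _ _ _ _ _ (dP x _)); lra.
    + apply: cvg_at_right_filter; apply: differentiable_continuous.
      by apply/derivable1_diffP; apply: (@ex_derive _ _ _ _ _ _ _ (dP _ _)); lra.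
    + apply: cvg_at_left_filter; apply: differentiable_continuous.
      by apply/derivable1_diffP; apply: (@ex_derive _ _ _ _ _ _ _ (dP _ _)); lra.
  - move=> x; rewrite in_itv/= => xt; rewrite derive1E.
    by apply: (@derive_val _ _ _ _ _ _ _ (dP x _)); lra.
apply/cvgrPdist_le => e e0.
(* Uniform continuity at the scale of the mesh, obtained by compactness; an error e / t on each of
   the n + 1 cells of length t / (n + 1) adds up to e. *)
pose Q (n : nat) (x : R) := forall y, `|y - x| <= t / n.+1%:R -> `|f y - f x| <= e / t.
have et0 : 0 < e / t / 2 by rewrite !divr_gt0.
have : \forall n \near \oo, `[0, t]%classic `<=` Q n.
  apply: ((compact_near_coveringP _).1 (@segment_compact _ 0 t)) => x _.
  have /cvgrPdist_le/(_ _ et0)/nbhs_ballP[d /= d0 xd] := cf x.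
  near=> x' n => y yx'.
  have xx' : `|x - x'| < d / 2.
    by near: x'; apply/nbhs_ballP; exists (d / 2) => //=; rewrite divr_gt0.
  have tn : t / n.+1%:R < d / 2.
    rewrite ltr_pdivrMr// mulrC -ltr_pdivrMr ?divr_gt0//.
    apply: (@lt_trans _ _ n%:R); last by rewrite ltr_nat.
    by near: n; exact: nbhs_infty_gtr.
  have fx' : `|f x - f x'| <= e / t / 2.
    by apply: xd => /=; apply: lt_trans xx' _; rewrite gtr_pMr// invf_lt1// ltr1n.
  have fy : `|f x - f y| <= e / t / 2.
    apply: xd; rewrite /ball/= (le_lt_trans (ler_distD x' _ _))// [ltRHS]splitr.
    by rewrite ltrD// distrC (le_lt_trans yx').
  apply: (le_trans (ler_distD (f x) _ _)); rewrite [leRHS]splitr lerD//.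
  by rewrite distrC.
apply: filterS => n Qn.
have h0 : 0 < t / n.+1%:R by rewrite divr_gt0.
have gn : grid t n n.+1 = t by rewrite /grid divfK.
have g0 : grid t n 0 = 0 by rewrite /grid mulr0.
have gS i : grid t n i.+1 = grid t n i + t / n.+1%:R.
  by rewrite /grid -natr1; ring.
have gi i : (i <= n.+1)%N -> 0 <= grid t n i <= t.
  move=> ni; rewrite mulr_ge0 ?(ltW h0)//= -[leRHS]gn /grid.
  by rewrite ler_wpM2l ?(ltW h0)// ler_nat.
rewrite -[P t - P 0](_ : \sum_(0 <= i < n.+1) (P (grid t n i.+1) - P (grid t n i)) = _); last first.
  by rewrite telescope_sumr// gn g0.
rewrite -sumrB; apply: (le_trans (ler_norm_sum _ _ _)).
apply: (@le_trans _ _ (\sum_(0 <= i < n.+1) (e / t * (t / n.+1%:R)))); last first.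
  rewrite sumr_const_nat subn0 -mulr_natr le_eqVlt; apply/orP; left; apply/eqP.
  by field; rewrite !gt_eqF.
rewrite big_nat_cond [leRHS]big_nat_cond; apply: ler_sum => i /andP[/andP[_ ni] _].
have := gi _ ni; have := gi _ (ltnW ni); rewrite gS => /andP[gi0 git] /andP[_ giht].
have xt x : grid t n i <= x <= grid t n i + t / n.+1%:R -> 0 <= x <= t.
  by move=> /andP[gx xg]; rewrite (le_trans gi0 gx) (le_trans xg giht).
have [|||c cin ->] := @MVT_segment _ P f (grid t n i) (grid t n i + t / n.+1%:R).
- by rewrite lerDl ltW.
- by move=> x; rewrite in_itv/= => /andP[/ltW gx /ltW xg]; apply/dP/xt; rewrite gx.
- apply: derivable_within_continuous => x; rewrite in_itv/= => /xt/dP dPx.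
  exact: ex_derive.
rewrite addrAC subrr add0r -mulrBl normrM (gtr0_norm h0) ler_wpM2r ?(ltW h0)//.
apply: Qn; first by rewrite /= in_itv/= gi0.
move: cin; rewrite in_itv/= => /andP[gc cg].
by rewrite ger0_norm ?subr_ge0// lerBlDl.
Unshelve. all: by end_near. Qed.

Let running_max f t := sup [set f tau | tau in `[0, t]].

Lemma has_sup_running_max f t : 0 <= t -> continuous f ->
  has_sup [set f tau | tau in `[0, t]].
Proof.
move=> t0 cf; split.
  by exists (f 0); exists 0 => //=; rewrite in_itv/= lexx t0.
have [c _ fc] := EVT_max t0 (continuous_subspaceT (A := `[0, t]%classic) cf).
by exists (f c) => _ [tau /= tin <-]; exact: fc.
Qed.

Lemma running_max_ub f t tau : continuous f -> 0 <= tau <= t ->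
  f tau <= sup [set f tau | tau in `[0, t]].
Proof.
move=> cf /andP[tau0 taut].
have t0 : 0 <= t by exact: le_trans taut.
apply: ub_le_sup; first exact: (has_sup_running_max t0 cf).2.
by exists tau => //=; rewrite in_itv/= tau0.
Qed.

Lemma running_max_le f t c : 0 <= t -> (forall tau, 0 <= tau <= t -> f tau <= c) ->
  sup [set f tau | tau in `[0, t]] <= c.
Proof.
move=> t0 fc; apply: ge_sup; last first.
  by move=> _ [tau /= tin <-]; apply: fc; move: tin; rewrite in_itv.
by exists (f 0); exists 0 => //=; rewrite in_itv/= lexx t0.
Qed.

Lemma le_running_max f s t : continuous f -> 0 <= s <= t ->
  sup [set f tau | tau in `[0, s]] <= sup [set f tau | tau in `[0, t]].
Proof.
move=> cf /andP[s0 st]; apply: running_max_le => // tau /andP[tau0 taus].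
by apply: running_max_ub => //; rewrite tau0 (le_trans taus).
Qed.

Lemma continuous_running_max f T : 0 <= T -> continuous f ->
  continuous (fun t => sup [set f tau | tau in `[0, clamp 0 T t]]).
Proof.
move=> T0 cf t; rewrite -!/(running_max f _).
set c := clamp 0 T t; have /andP[c0 cT] : 0 <= c <= T by exact: clamp_itv.
apply/cvgrPdist_le => e e0; have e20 : 0 < e / 2 by rewrite divr_gt0.
have /cvgrPdist_le/(_ _ e20)/nbhs_ballP[d /= d0 cd] := cf c.
near=> t'.
have sc : `|c - clamp 0 T t'| < d.
  by near: t'; have /cvgrPdist_lt/(_ d d0) := @continuous_clamp R 0 T t.
set s := clamp 0 T t' in sc *.
have /andP[s0 sT] : 0 <= s <= T by exact: clamp_itv.
have fcs : `|f c - f s| <= e / 2 by exact: cd.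
have ub b x : 0 <= x <= b -> f x <= running_max f b by exact: running_max_ub.
have sc2 : running_max f s <= running_max f c + e.
  apply: running_max_le => // tau /andP[tau0 taus].
  have [tauc|ctau] := leP tau c.
    by rewrite (le_trans (ub c tau _)) ?tau0// lerDl ltW.
  have : `|f c - f tau| <= e / 2.
    by apply: cd; rewrite /ball/= (le_lt_trans _ sc)// !ltr0_norm ?subr_lt0//; lra.
  by move: (ub c c); rewrite c0 lexx ler_norml => /(_ isT) + /andP[]; lra.
have cs2 : running_max f c <= running_max f s + e.
  apply: running_max_le => // tau /andP[tau0 tauc].
  have [taus|stau] := leP tau s.
    by rewrite (le_trans (ub s tau _)) ?tau0// lerDl ltW.
  have : `|f c - f tau| <= e / 2.
    by apply: cd; rewrite /ball/= (le_lt_trans _ sc)// !ger0_norm ?subr_ge0//; lra.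
  move: (ub s s) fcs; rewrite s0 lexx !ler_norml => /(_ isT) + /andP[? ?] /andP[].
  by lra.
by rewrite ler_distl lerBlDr sc2 cs2.
Unshelve. all: by end_near. Qed.

Section measurability.
Context d (Z : measurableType d).
Variable f : R -> Z -> R.
Hypothesis mf : forall t, measurable_fun [set: Z] (f t).
Hypothesis cf : forall z, continuous (f^~ z).

Lemma measurable_integral_itv t : 0 <= t ->
  measurable_fun [set: Z] (fun z => \int[mu]_(x in `[0, t]) f x z)%R.
Proof.
move=> t0; apply: (@measurable_fun_cvg _ _ _ _ (fun n z =>
    \sum_(0 <= i < n.+1) f (grid t n i) z * (t / n.+1%:R))) => [n|z _].
  by apply: measurable_sum => i; exact: measurable_funM.
exact: (cvg_riemann_sum t0 (@cf z)).
Qed.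

(** By continuity in time the supremum may be taken over a countable dense set of times. *)
Lemma measurable_running_max t : 0 <= t ->
  measurable_fun [set: Z] (fun z => sup [set f tau z | tau in `[0, t]]).
Proof.
move=> t0.
(* The rationals, enumerated and clamped into [0, t]; an index that codes no rational gives the time
   0. *)
pose q (n : nat) : R := clamp 0 t (ratr (odflt 0 (unpickle n : option rat))).
have q0t n : 0 <= q n <= t by exact: clamp_itv.
rewrite (_ : (fun z => _) = (fun z => sups (fun n => f (q n) z) 0)); last first.
  apply/funext => z; apply/eqP; rewrite eq_le; apply/andP; split.
    apply/ler_addgt0Pr => e e0; apply: running_max_le => // tau taut.
    have := continuous_comp_clamp t0 (continuous_subspaceT (A := `[0, t]%classic) (@cf z)).
    move=> /(_ tau)/cvgrPdist_le/(_ e e0)/nbhs_ballP[d' /= d0 tau_d].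
    have [|r [rtau [p _ pr]]] := @dense_rat R (ball tau d') _ (ball_open _ _).
      by exists tau; exact: ballxx.
    have := tau_d _ rtau; rewrite (clamp_id taut) -pr => fp.
    have pq : clamp 0 t (ratr p) = q (pickle p) by rewrite /q pickleK.
    apply: (@le_trans _ _ (f (q (pickle p)) z + e)).
      by move: fp; rewrite pq ler_norml => /andP[_]; rewrite lerBlDl.
    rewrite lerD2r; apply: ub_le_sup; last by exists (pickle p).
    by exists (sup [set f tau z | tau in `[0, t]]) => _ [k _ <-]; exact: running_max_ub.
  apply: ge_sup; first by exists (f (q 0%N) z); exists 0%N.
  by move=> _ [k _ <-]; exact: running_max_ub.
apply: measurable_fun_sups => // z _.
by exists (sup [set f tau z | tau in `[0, t]]) => _ [k _ <-]; exact: running_max_ub.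
Qed.

End measurability.
End path_functionals.

(** * Degradation factors *)

Section degradation.
Context {R : realType} {d : nat}.
Local Notation E := 'rV[R]_d.
Implicit Types (Omega : set E) (u U : R -> E -> E) (x y : E) (T t rp : R).

(** Frozen in time outside [0, T] and constant in space outside [Omega], hence measurable on the
    whole space and continuous on the whole line when [u] is so on its own domain. *)
Definition extend_curve Omega T u t : E -> E := u (clamp 0 T t) \_ Omega.

Lemma extend_curveE Omega T u t x : Omega x -> 0 <= t <= T ->
  extend_curve Omega T u t x = u t x.
Proof. by move=> Ox tT; rewrite /extend_curve patchE mem_set// clamp_id. Qed.

Lemma measurable_extend_curve Omega T u : measurable Omega -> 0 <= T ->
  (forall t, 0 <= t <= T -> measurable_fun Omega (u t)) ->
  forall t, measurable_fun [set: E] (extend_curve Omega T u t).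
Proof.
move=> mO T0 mu t; apply/(measurable_restrictT _ _).1 => //.
by apply: mu; exact: clamp_itv.
Qed.

Lemma continuous_extend_curve Omega T u : 0 <= T ->
  (forall x, Omega x -> {within `[0, T], continuous (fun t => u t x)}) ->
  forall x, continuous (fun t => extend_curve Omega T u t x).
Proof.
move=> T0 cu x; have -> : (fun t => extend_curve Omega T u t x) =
    (fun t => if x \in Omega then u (clamp 0 T t) x else point).
  by apply/funext => t; rewrite /extend_curve patchE.
have [/set_mem Ox|_] := boolP (x \in Omega).
  exact: (continuous_comp_clamp T0 (cu x Ox)).
by move=> t; exact: cvg_cst.
Qed.

Lemma cvg_dotp (I : Type) (F : set_system I) (FF : Filter F) (f : I -> E) (a v : E) :
  f @ F --> a -> (fun i => dotp (f i) v) @ F --> dotp a v.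
Proof.
move=> fa; rewrite /dotp; apply: (@cvg_big R) => [|i _]; first exact: add_continuous.
apply: cvgMr_tmp.
apply: (@cvg_comp _ _ _ f (fun M : E => M ord0 i) _ (nbhs a)) => //.
exact: (@coord_continuous R 1 d ord0 i a).
Qed.

Lemma cvg_scaled_strain (I : Type) (F : set_system I) (FF : Filter F)
    (w : I -> E -> E) (a : E -> E) y x :
  w ^~ y @ F --> a y -> w ^~ x @ F --> a x ->
  (fun i => scaled_strain y x (w i)) @ F --> scaled_strain y x a.
Proof.
move=> wy wx; rewrite scaled_strainE.
under eq_cvg do rewrite scaled_strainE.
by apply: cvgMl_tmp; apply: cvgB; exact: cvg_dotp.
Qed.

Lemma continuous_scaled_strain U y x : (forall x, continuous (fun t => U t x)) ->
  continuous (fun t => scaled_strain y x (U t)).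
Proof. by move=> cU t; apply: cvg_scaled_strain; exact: cU. Qed.

Lemma continuous_strain U y x : (forall x, continuous (fun t => U t x)) ->
  continuous (fun t => strain y x (U t)).
Proof.
move=> cU; have -> : (fun t => strain y x (U t)) = (fun t =>
    (enorm (y - x))^-1 * (dotp (U t y) (direction y x) - dotp (U t x) (direction y x))).
  by apply/funext => t; rewrite /strain dotpZl dotpBl.
move=> t.
by apply: cvgMl_tmp; apply: cvgB; apply: cvg_dotp; exact: cU.
Qed.

Lemma coord_measurable_pair (w : E -> E) : measurable_fun [set: E] w ->
  coord_measurable [set: E * E] (fun z => w z.1) /\
  coord_measurable [set: E * E] (fun z => w z.2).
Proof.
by move=> mw; split; apply: measurable_fun_coord; exact: (measurableT_comp mw).
Qed.

Lemma coord_measurable_fst_snd :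
  coord_measurable [set: E * E] (fun z => z.1) /\
  coord_measurable [set: E * E] (fun z => z.2).
Proof. exact: (@coord_measurable_pair id). Qed.

Lemma measurable_enorm_dist :
  measurable_fun [set: E * E] (fun z => enorm (z.2 - z.1)).
Proof.
by have [? ?] := coord_measurable_fst_snd; apply: measurable_enorm; exact: coord_measurableB.
Qed.

Lemma measurable_sqrt_dist :
  measurable_fun [set: E * E] (fun z => Num.sqrt (enorm (z.2 - z.1))).
Proof.
apply: (measurableT_comp (f := @Num.sqrt R)); last exact: measurable_enorm_dist.
by apply: continuous_measurable_fun; exact: sqrt_continuous.
Qed.

Lemma coord_measurable_direction :
  coord_measurable [set: E * E] (fun z => direction z.2 z.1).
Proof.
have [? ?] := coord_measurable_fst_snd.
apply: coord_measurableZ; last exact: coord_measurableB.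
by apply: (measurableT_comp measurable_inv); exact: measurable_enorm_dist.
Qed.

Lemma measurable_strain (w : E -> E) : measurable_fun [set: E] w ->
  measurable_fun [set: E * E] (fun z => strain z.2 z.1 w).
Proof.
move=> /coord_measurable_pair[? ?]; apply: measurable_dotp.
  apply: coord_measurableZ; last exact: coord_measurableB.
  by apply: (measurableT_comp measurable_inv); exact: measurable_enorm_dist.
exact: coord_measurable_direction.
Qed.

Lemma measurable_scaled_strain (w : E -> E) : measurable_fun [set: E] w ->
  measurable_fun [set: E * E] (fun z => scaled_strain z.2 z.1 w).
Proof.
move=> mw; apply: measurable_funM; first exact: measurable_sqrt_dist.
exact: measurable_strain.
Qed.

(** Monotonicity on [a, b] only bounds [h] there by h(a); that h(a) = 1 comes from continuity, [h]
    being 1 below [a]. *)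
Lemma degradation_profileP (h : R -> R) (a b : R) : degradation_profile h a b ->
  a < b -> (forall s, s < a -> h s = 1) ->
  [/\ continuous h, {homo h : s t /~ s <= t} & forall s, 0 <= h s <= 1].
Proof.
move=> [sh h0 hab hb] ab h1.
have ch : continuous h.
  by move=> s; apply: differentiable_continuous; apply/derivable1_diffP; exact: (sh 0%N).
have ha : h a = 1.
  have : h s @[s --> a^'-] --> h a by apply: cvg_at_left_filter; exact: ch.
  move=> /cvg_lim <-//; apply: lim_near_cst => //.
  by near=> s; apply: h1; near: s; exact: nbhs_left_lt.
have hle1 s : a <= s -> h s <= 1.
  move=> as_; have [sb|bs] := leP s b; first by rewrite -ha; exact: hab.
  by rewrite hb ?ler01// ltW.
have hle s : h s <= 1 by have [/hle1//|/h1 ->] := leP a s.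
split => // [t s st|s]; last by rewrite h0 hle.
have [at_|/h1 ->//] := leP a s.
have [tb|bt] := leP t b; first exact: hab.
by rewrite hb ?h0// ltW.
Unshelve. all: by end_near. Qed.

(** At time 0 the integral of the first case is over a point, and the maximum of the second is the
    initial strain. The initial energy can thus be computed from a constant curve. *)
Lemma degradation_factor_at0 rp gam u v x y : degradation_factor rp gam ->
  u 0 y = v 0 y -> u 0 x = v 0 x -> gam u y x 0 = gam v y x 0.
Proof.
move=> [[h [xD [_ _ _ ->]]]|[h [rD [_ _ _ ->]]]] uy ux.
  by rewrite /degradation_integral set_itv1 !Rintegral_set1.
rewrite /degradation_max /max_strain set_itv1 !image_set1.
by rewrite (eq_strain uy ux).
Qed.

(* [Gam] extends [gam u], which is only meaningful for times in [[0, T]] and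
   points in [Omega]. *)
Lemma degradation_extension rp gam Omega T u :
  degradation_factor rp gam -> 0 <= T -> measurable Omega ->
  (forall t, 0 <= t <= T -> measurable_fun Omega (u t)) ->
  (forall x, Omega x -> {within `[0, T], continuous (fun t => u t x)}) ->
  exists Gam : R -> E -> E -> R,
  [/\ forall t y x, 0 <= Gam t y x <= 1,
      forall y x, {homo (fun t => Gam t y x) : s t /~ s <= t},
      forall y x, continuous (fun t => Gam t y x),
      forall t y x, Gam t y x = Gam t x y &
      forall t, measurable_fun [set: E * E] (fun z => Gam t z.2 z.1)] /\
  forall t y x, 0 <= t <= T -> Omega y -> Omega x -> gam u y x t = Gam t y x.
Proof.
move=> dgam T0 mO mu cu.
set U := extend_curve Omega T u.
have mU := measurable_extend_curve mO T0 mu.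
have cU := continuous_extend_curve T0 cu.
(* Evaluating [gam] itself on the extended curve, at clamped times, keeps its explicit formula
   available. *)
exists (fun t y x => gam U y x (clamp 0 T t)).
have cl0 t : 0 <= clamp 0 T t by case/andP : (clamp_itv t T0).
case: dgam => [[h [xD [xD0 ph h1 ->]]]|[h [rD [rprD ph h1 ->]]]].
- have [ch hh h01] := degradation_profileP ph xD0 h1.
  pose f y x tau := Num.max (scaled_strain y x (U tau) - rp) 0.
  have cf y x : continuous (f y x).
    move=> t; apply: (@continuous_max _ _ (fun tau => scaled_strain y x (U tau) - rp) (fun=> 0)).
      by apply: cvgB; [exact: continuous_scaled_strain|exact: cvg_cst].
    exact: cvg_cst.
  have f0 y x tau : 0 <= f y x tau by rewrite /f le_max lexx orbT.
  split; first split.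
  + by move=> t y x; exact: h01.
  + move=> y x t s st; apply: hh; apply: (le_integral_itv (cf y x) (f0 y x)).
    exact: le_clamp.
  + move=> y x t; apply: (cvg_comp _ _ (@continuous_integral_itv _ _ _ T0 (cf y x) t)).
    exact: ch.
  + move=> t y x; rewrite /degradation_integral; congr h.
    by apply: eq_Rintegral => tau _; rewrite scaled_strainC.
  + move=> t; apply: measurableT_comp; first exact: continuous_measurable_fun.
    apply: (@measurable_integral_itv R _ _ (fun tau z => f z.2 z.1 tau)) => //.
    move=> tau; apply: measurable_maxr => //.
    by apply: measurable_funB => //; exact: measurable_scaled_strain.
  + move=> t y x tT Oy Ox; rewrite (clamp_id tT); congr h.
    apply: eq_Rintegral => tau; rewrite inE/= in_itv/= => /andP[tau0 taut].
    have tauT : 0 <= tau <= T.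
      by rewrite tau0 (le_trans taut)//; case/andP : tT.
    by rewrite (@eq_scaled_strain _ _ y x (U tau) (u tau))// /U extend_curveE.
- have [|ch hh h01] := degradation_profileP ph rprD.
    by move=> s /ltW; exact: h1.
  have cf y x : continuous (fun tau => strain y x (U tau)) by exact: continuous_strain.
  split; first split.
  + by move=> t y x; exact: h01.
  + move=> y x t s st; apply: hh; apply: ler_wpM2l; first exact: sqrtr_ge0.
    apply: (le_running_max (cf y x)); rewrite cl0 /=; exact: le_clamp.
  + move=> y x t; have cM := @continuous_running_max _ _ _ T0 (cf y x).
    have cS : continuous (fun t => Num.sqrt (enorm (y - x)) *
        sup [set strain y x (U tau) | tau in `[0, clamp 0 T t]]).
      by move=> s; apply: cvgMl_tmp; exact: cM.
    apply: (cvg_comp _ _ (cS t)).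
    exact: ch.
  + move=> t y x; rewrite /degradation_max /max_strain enormB; congr (h (_ * sup _)).
    by under eq_imagel => tau _ do rewrite strainC.
  + move=> t; apply: measurableT_comp; first exact: continuous_measurable_fun.
    apply: measurable_funM; first exact: measurable_sqrt_dist.
    apply: (@measurable_running_max R _ _ (fun tau z => strain z.2 z.1 (U tau))) => //.
    by move=> tau; exact: measurable_strain.
  + move=> t y x tT Oy Ox; rewrite clamp_id//; congr (h (_ * sup _)).
    apply: eq_imagel => tau; rewrite /= in_itv/= => /andP[tau0 taut].
    have tauT : 0 <= tau <= T.
      by rewrite tau0 (le_trans taut)//; case/andP : tT.
    by apply: eq_strain; rewrite /U extend_curveE.
Qed.

End degradation.

(** * Curves in [L^infty] *)

Section Linfty.
Context {R : realType} {d : nat}.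
Local Notation E := 'rV[R]_d.
Local Notation vol := (@lebesgue_rV R d).
Implicit Types (Omega : set E) (w : E -> E) (u v : R -> E -> E) (T t M : R).

Lemma enormD_le (x y : E) : enorm (x + y) <= d%:R * (enorm x + enorm y).
Proof.
apply: (le_trans (enorm_le_sum _)).
have -> : d%:R * (enorm x + enorm y) = \sum_(i < d) (enorm x + enorm y).
  by rewrite sumr_const card_ord mulr_natl.
apply: ler_sum => i _; rewrite mxE; apply: (le_trans (ler_normD _ _)).
by rewrite lerD// le_coord_enorm.
Qed.

Lemma mx_norm_le_enorm (x : E) : `|x| <= enorm x.
Proof.
rewrite [leLHS]mx_normrE; apply: bigmax_le; first exact: enorm_ge0.
by move=> [i j] _ /=; rewrite [i]ord1 le_coord_enorm.
Qed.

Lemma cvg_enorm (f : nat -> E) (a : E) :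
  enorm (f n - a) @[n --> \oo] --> 0 -> f n @[n --> \oo] --> a.
Proof.
move=> fa; apply/cvgrPdist_le => e e0.
have /cvgrPdist_le/(_ e e0) := fa; apply: filterS => n.
rewrite sub0r normrN (ger0_norm (enorm_ge0 _)).
by apply: le_trans; rewrite distrC mx_norm_le_enorm.
Qed.

Lemma Linfty_norm_le Omega w M : (Linfty_norm Omega w <= M%:E)%E ->
  {ae vol, forall x, Omega x -> enorm (w x) <= M}.
Proof.
rewrite /Linfty_norm unlock /=; case: ifPn => [_ /ess_supP|].
  apply: filterS => x /= + Ox; rewrite indicE mem_set// mul1r lee_fin.
  by rewrite ger0_norm// enorm_ge0.
rewrite -leNgt => vol0 _; exists setT; split => //.
by apply/eqP; rewrite eq_le vol0 measure_ge0.
Qed.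

Lemma eq_Linfty_norm Omega w w' : (forall x, Omega x -> w x = w' x) ->
  Linfty_norm Omega w = Linfty_norm Omega w'.
Proof.
move=> ww'; apply: eq_Lnorm => x; congr EFin; rewrite indicE.
by have [/set_mem/ww' ->//|_] := boolP (x \in Omega); rewrite !mul0r.
Qed.

Lemma Linfty_norm_lty Omega w : (Linfty_norm Omega w < +oo)%E ->
  exists2 M, 0 <= M & {ae vol, forall x, Omega x -> enorm (w x) <= M}.
Proof.
move=> woo; have w0 : (0 <= Linfty_norm Omega w)%E by exact: Lnorm_ge0.
exists (fine (Linfty_norm Omega w)); first exact: fine_ge0.
by apply: Linfty_norm_le; rewrite fineK// ge0_fin_numE.
Qed.

(** One null set serves all the indices, since they are countably many. The bound by 1 keeps the
    norms finite, so that the limit can be read in the reals. *)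
Lemma Linfty_norm_cvg0 Omega (w_ : nat -> E -> E) :
  (forall n, Linfty_norm Omega (w_ n) <= 1)%E ->
  Linfty_norm Omega (w_ n) @[n --> \oo] --> (0 : \bar R) ->
  {ae vol, forall x, Omega x -> enorm (w_ n x) @[n --> \oo] --> 0}.
Proof.
move=> w1 w0.
have wfin n : Linfty_norm Omega (w_ n) \is a fin_num.
  by rewrite ge0_fin_numE ?(le_lt_trans (w1 n)) ?ltry//; exact: Lnorm_ge0.
have w0' : fine (Linfty_norm Omega (w_ n)) @[n --> \oo] --> 0 by exact: fine_cvg.
have : {ae vol, forall x n, Omega x -> enorm (w_ n x) <= fine (Linfty_norm Omega (w_ n))}.
  apply/ae_foralln => n.
  have := @Linfty_norm_le Omega (w_ n) (fine (Linfty_norm Omega (w_ n))).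
  by rewrite fineK// => /(_ (lexx _)).
apply: filterS => x wx Ox; apply: (@squeeze_cvgr _ _ _ _ (cst 0) _ _ _ _ (cvg_cst 0) w0').
by apply: nearW => n; rewrite enorm_ge0 wx.
Qed.

Lemma cvg_within_dnbhs (A : set R) t (s_ : nat -> R) :
  (forall n, A (s_ n) /\ s_ n != t) -> s_ n @[n --> \oo] --> t ->
  s_ n @[n --> \oo] --> within A t^'.
Proof.
move=> sA st U; rewrite /within/= => U1.
have : \forall n \near \oo, s_ n != t -> A (s_ n) -> U (s_ n).
  exact: (st (fun s => s != t -> A s -> U s) U1).
by apply: filterS => n; apply; case: (sA n).
Qed.

(** Near [t] the quotient is within 1 of u'(t) in norm, hence bounded. The two facts are returned
    together: they form the a priori property under which limits in [s] are taken. *)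
Lemma Linfty_derivative_lipschitz Omega T u u' t : Linfty_derivative Omega T u u' ->
  t \in `[0, T] -> (Linfty_norm Omega (u' t) < +oo)%E ->
  exists2 M, 0 <= M & \forall s \near within `[0, T] t^',
    (Linfty_norm Omega (fun x => ((s - t)^-1 *: (u s x - u t x) - u' t x)%R) <= 1)%E /\
    {ae vol, forall x, Omega x -> enorm (u s x - u t x) <= M * `|s - t|}.
Proof.
move=> duu tT /Linfty_norm_lty[M0 M00 u'M].
exists (d%:R * (1 + M0)); first by rewrite mulr_ge0// addr_ge0.
have u1 : \forall s \near within `[0, T] t^',
    (Linfty_norm Omega (fun x => ((s - t)^-1 *: (u s x - u t x) - u' t x)%R) <= 1)%E.
  have /fine_cvgP[fin0 c0] := duu t tT.
  have /cvgr_le/(_ 1 ltr01) := c0.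
  apply: filterS2 fin0 => s sfin /=; rewrite -lee_fin.
  by move=> /(le_trans _); apply; rewrite fineK.
have nt : \forall s \near within `[0, T] t^', s != t.
  by apply: cvg_within; exact: withinT.
apply: filterS2 nt u1 => s st s1; split => //.
have := Linfty_norm_le s1; apply: filterS2 u'M => x u'x + Ox => /(_ Ox) qx.
have -> : u s x - u t x = (s - t) *:
    ((s - t)^-1 *: (u s x - u t x) - u' t x + u' t x).
  by rewrite subrK scalerA divff ?scale1r// subr_eq0.
rewrite enormZ mulrC ler_wpM2r//; apply: (le_trans (enormD_le _ _)).
by rewrite ler_wpM2l// lerD//; exact: u'x.
Qed.

Lemma Linfty_derivative_seq Omega T u u' t (s_ : nat -> R) :
  Linfty_derivative Omega T u u' -> t \in `[0, T] ->
  (forall n, [/\ `[0, T]%classic (s_ n), s_ n != t &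
    (Linfty_norm Omega (fun x => ((s_ n - t)^-1 *: (u (s_ n) x - u t x) - u' t x)%R) <= 1)%E]) ->
  s_ n @[n --> \oo] --> t ->
  {ae vol, forall x, Omega x ->
    (s_ n - t)^-1 *: (u (s_ n) x - u t x) @[n --> \oo] --> u' t x}.
Proof.
move=> duu tT sP st.
have st' : s_ n @[n --> \oo] --> within `[0, T] t^'.
  by apply: cvg_within_dnbhs => // n; have [] := sP n.
have := Linfty_norm_cvg0 (fun n => let: And3 _ _ h := sP n in h)
  (cvg_comp _ _ st' (duu t tT)).
by apply: filterS => x qx Ox; apply: cvg_enorm; exact: qx.
Qed.

(** Each time has a neighbourhood with a common bound, and [0, T] is compact. The null set still
    depends on the time. *)
Lemma Linfty_curve_bounded Omega T u :
  (forall t, t \in `[0, T] -> (Linfty_norm Omega (u t) < +oo)%E) ->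
  (forall t, t \in `[0, T] ->
    Linfty_norm Omega (fun x => u s x - u t x)
      @[s --> within `[0, T] (nbhs t)] --> (0 : \bar R)) ->
  exists M, forall t, t \in `[0, T] -> {ae vol, forall x, Omega x -> enorm (u t x) <= M}.
Proof.
move=> ufin cu.
pose P (M t : R) := t \in `[0, T] -> {ae vol, forall x, Omega x -> enorm (u t x) <= M}.
have : \forall M \near +oo, `[0, T]%classic `<=` P M.
  apply: ((compact_near_coveringP _).1 (@segment_compact _ 0 T)) => t tT.
  have [M0 M00 uM] := Linfty_norm_lty (ufin t tT).
  have /fine_cvgP[fin0 c0] := cu t tT.
  have u1 : \forall s \near within `[0, T] (nbhs t),
      (Linfty_norm Omega (fun x => (u s x - u t x)%R) <= 1)%E.
    have /cvgr_le/(_ 1 ltr01) := c0.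
    apply: filterS2 fin0 => s sfin /=; rewrite -lee_fin.
    by move=> /(le_trans _); apply; rewrite fineK.
  near=> s M.
  have s1 : `[0, T]%classic s -> (Linfty_norm Omega (fun x => (u s x - u t x)%R) <= 1)%E.
    by near: s.
  have M1 : d%:R * (1 + M0) <= M by near: M; apply: nbhs_pinfty_ge; exact: num_real.
  move=> sT; have := Linfty_norm_le (s1 sT); apply: filterS2 uM => x ux + Ox => /(_ Ox) usx.
  rewrite -(subrK (u t x) (u s x)); apply: (le_trans (enormD_le _ _)).
  apply: le_trans M1.
  by rewrite ler_wpM2l// lerD//; exact: ux.
by move=> /filter_ex[M HM]; exists M => t tT; exact: HM.
Unshelve. all: by end_near. Qed.

End Linfty.

(** * The damage increment *)

Lemma measurable_fun_limn_einf d (T : measurableType d) (R : realType) (D : set T)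
    (f : (T -> \bar R)^nat) : (forall n, measurable_fun D (f n)) ->
  measurable_fun D (fun x => limn_einf (f ^~ x)).
Proof.
move=> mf; rewrite /limn_einf; apply: measurableT_comp => //.
apply: (@measurable_fun_limn_esup _ _ _ D (fun n x => (- f n x)%E)) => n.
exact: measurableT_comp.
Qed.

(** Only right quotients of the monotone extension [G] enter; as tau < T they are eventually
    quotients of [f]. Where [f] is derivable they converge to -f'; elsewhere [ae_derive] is 0 and
    the terms of the lower limit are nonnegative. *)
Lemma ae_derive_le_quotient {R : realType} (f G : R -> R) (T tau c : R) :
  0 <= tau < T -> (forall t, 0 <= t <= T -> f t = G t) ->
  {homo G : s t /~ s <= t} -> 0 <= c ->
  0 <= - ae_derive f tau /\
  ((c * - ae_derive f tau)%:E <=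
    limn_einf (fun n => (c * (n.+1%:R * (G tau - G (tau + n.+1%:R^-1))))%:E))%E.
Proof.
move=> /andP[tau0 tauT] fG hG c0.
have h0 n : 0 < n.+1%:R^-1 :> R by rewrite invr_gt0.
have q0 n : 0 <= n.+1%:R * (G tau - G (tau + n.+1%:R^-1)).
  by rewrite mulr_ge0// subr_ge0 hG// lerDl ltW.
rewrite /ae_derive; case: asboolP => [df|_]; last first.
  rewrite oppr0 mulr0; split => //.
  by apply: limn_einf_ge0 => n; rewrite lee_fin mulr_ge0.
have [q [qE cq <-]] := derive1_caratheodory df.
have th : tau + n.+1%:R^-1 @[n --> \oo] --> tau.
  rewrite -[X in _ --> X]addr0; apply: cvgD; first exact: cvg_cst.
  exact: cvg_harmonic.
have qh : - q (tau + n.+1%:R^-1) @[n --> \oo] --> - q tau.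
  by apply: cvgN; apply: (cvg_comp _ _ th); exact: cq.
have cG : n.+1%:R * (G tau - G (tau + n.+1%:R^-1)) @[n --> \oo] --> - q tau.
  apply: cvg_trans qh; apply: near_eq_cvg; near=> n.
  have hT : tau + n.+1%:R^-1 < T.
    by near: n; move/cvgr_lt : th => /(_ T tauT).
  have tauh : tau <= tau + n.+1%:R^-1 by rewrite lerDl ltW.
  rewrite -fG ?tau0 ?(ltW tauT)// -fG ?(le_trans tau0 tauh) ?(ltW hT)//.
  rewrite -[f tau - _]opprB qE addrAC subrr add0r.
  by rewrite mulrN mulrCA divff ?mulr1// pnatr_eq0.
split; first by apply: (cvgr_to_ge cG); exact: nearW.
rewrite (_ : limn_einf _ = (c * - q tau)%:E)//.
apply: (cvg_limn_einf_sup _).1; apply: cvg_EFin; first exact: nearW.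
exact: cvgMl_tmp.
Unshelve. all: by end_near. Qed.

Section damage_increment.
Context d1 d2 (T1 : measurableType d1) (T2 : measurableType d2) (R : realType).
Variable m1 : {sigma_finite_measure set T1 -> \bar R}.
Variable m2 : {sigma_finite_measure set T2 -> \bar R}.
Variables (A : set T1) (B : set T2).
Hypotheses (mA : measurable A) (mB : measurable B).
Local Notation m12 := (m1 \x m2)%E.

Variables (ker W : T1 * T2 -> R) (kM T : R).
Variables (Gam : R -> T1 * T2 -> R) (f : T1 * T2 -> R -> R) (psi : R -> T1 * T2 -> R).
Hypothesis mker : measurable_fun (A `*` B) ker.
Hypothesis ker0 : forall z, 0 <= ker z <= kM.
Hypothesis Gam01 : forall t z, 0 <= Gam t z <= 1.
Hypothesis dGam : forall z, {homo Gam^~ z : s t /~ s <= t}.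
Hypothesis cGam : forall z, continuous (Gam^~ z).
Hypothesis mGam : forall t, measurable_fun (A `*` B) (Gam t).
Hypothesis fGam : forall z t, (A `*` B) z -> 0 <= t <= T -> f z t = Gam t z.
Hypothesis W0 : forall z, 0 <= W z.
Hypothesis iW : m12.-integrable (A `*` B) (EFin \o W).

Let mAB : measurable (A `*` B). Proof. exact: measurableX. Qed.

Let mW : measurable_fun (A `*` B) W.
Proof. by apply/measurable_EFinP; exact: measurable_int iW. Qed.

Let kM0 : 0 <= kM.
Proof. by have /andP[] := ker0 (point, point); exact: le_trans. Qed.

Let ikMW : m12.-integrable (A `*` B) (EFin \o (fun z => kM * W z)).
Proof.
rewrite (_ : _ \o _ = (fun z => kM%:E * (EFin \o W) z)%E); first exact: integrableZl.
by apply/funext => z /=; rewrite EFinM.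
Qed.

Let kerGamW (c : R) (z : T1 * T2) : `|c| <= 1 -> `|ker z * c * W z| <= kM * W z.
Proof.
move=> c1; have /andP[k0 kk] := ker0 z.
rewrite !normrM (ger0_norm k0) (ger0_norm (W0 z)) ler_wpM2r//.
by rewrite -[leRHS]mulr1 ler_pM.
Qed.

Let Gam1 t z : `|Gam t z| <= 1.
Proof. by have /andP[G0 G1] := Gam01 t z; rewrite ger0_norm. Qed.

Let mkerGamW t : measurable_fun (A `*` B) (fun z => ker z * Gam t z * W z).
Proof. by apply: measurable_funM => //; exact: measurable_funM. Qed.

Lemma integrable_kernel_weight t :
  m12.-integrable (A `*` B) (EFin \o (fun z => ker z * Gam t z * W z)).
Proof.
apply: (ae_le_integrable mAB (mkerGamW t) ikMW).
by apply: aeW => z _; exact: kerGamW.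
Qed.

Lemma continuous_kernel_weight :
  continuous (fun t => \int[m12]_(z in A `*` B) (ker z * Gam t z * W z))%R.
Proof.
move=> t; apply/(@cvg_nbhsP _ R^o) => t_ t_t.
apply: (dominated_cvg_Rintegral mAB (fun n => mkerGamW (t_ n)) (mkerGamW t) _ ikMW).
  apply: aeW => z _; apply: cvgMr_tmp; apply: cvgMl_tmp.
  exact: (@cvg_comp _ _ _ t_ (Gam^~ z) _ (nbhs t) _ t_t (@cGam z t)).
by apply: aeW => z _ n; exact: kerGamW.
Qed.

Let homo_kernel_weight :
  {homo (fun t => \int[m12]_(z in A `*` B) (ker z * Gam t z * W z))%R : s t /~ s <= t}.
Proof.
move=> t s st; apply: le_Rintegral => //; try exact: integrable_kernel_weight.
move=> z _; rewrite ler_wpM2r// ler_wpM2l//; last exact: dGam.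
by case/andP : (ker0 z).
Qed.

(** The majorant [W] does not depend on time, so the integral of ker Gam W is a monotone function of
    time. Fatou's lemma in space bounds the density by the lower limit of the quotients of this
    function, and Fatou's lemma in time bounds the integral of that lower limit by its decrease. *)
Lemma damage_increment_le t s : 0 <= t -> t <= s -> s < T ->
  (forall tau, t <= tau <= s -> measurable_fun (A `*` B) (psi tau)) ->
  (forall tau z, 0 <= psi tau z) ->
  (forall tau, t <= tau <= s ->
    {ae m12, forall z, (A `*` B) z -> psi tau z <= W z}) ->
  (\int[lebesgue_measure]_(tau in `[t, s]) \int[m1]_(x in A) \int[m2]_(y in B)
     (ker (x, y) * - ae_derive (f (x, y)) tau * psi tau (x, y))%:E <=
   (\int[m12]_(z in A `*` B) (ker z * (Gam t z - Gam s z) * W z))%R%:E)%E.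
Proof.
move=> t0 ts sT mpsi psi0 psiW.
pose F t := (\int[m12]_(z in A `*` B) (ker z * Gam t z * W z))%R.
have -> : (\int[m12]_(z in A `*` B) (ker z * (Gam t z - Gam s z) * W z))%R = F t - F s.
  rewrite -RintegralB//; try exact: integrable_kernel_weight.
  by apply: eq_Rintegral => z _; ring.
apply: le_trans (integral_limn_einf_quotient_le ts continuous_kernel_weight homo_kernel_weight).
pose q n tau z := n.+1%:R * (Gam tau z - Gam (tau + n.+1%:R^-1) z).
have q0 n tau z : 0 <= q n tau z.
  by rewrite mulr_ge0// subr_ge0 dGam// lerDl invr_ge0.
have k0 z : 0 <= ker z by case/andP : (ker0 z).
have kqpsi0 n tau z : 0 <= ker z * q n tau z * psi tau z.
  by apply: mulr_ge0; [apply: mulr_ge0|].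
have kqW0 n tau z : 0 <= ker z * q n tau z * W z.
  by apply: mulr_ge0; [apply: mulr_ge0|].
have taus tau : t <= tau <= s -> 0 <= tau < T.
  by move=> /andP[ttau taus]; rewrite (le_trans t0 ttau) (le_lt_trans taus sT).
have quot tau z : t <= tau <= s -> (A `*` B) z -> 0 <= - ae_derive (f z) tau /\
    ((ker z * - ae_derive (f z) tau * psi tau z)%:E <=
     limn_einf (fun n => (ker z * q n tau z * psi tau z)%:E))%E.
  move=> tauts ABz; have [n0 le] := ae_derive_le_quotient (taus _ tauts)
    (fun t => @fGam z t ABz) (@dGam z) (mulr_ge0 (k0 z) (psi0 tau z)).
  split => //; rewrite mulrAC; apply: (le_trans le).
  by apply: le_limn_einf => n; rewrite lee_fin /q [leRHS]mulrAC.
have pos tau z : t <= tau <= s -> (A `*` B) z ->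
    (0 <= (ker z * - ae_derive (f z) tau * psi tau z)%:E)%E.
  by move=> tauts ABz; rewrite lee_fin !mulr_ge0//; exact: (quot _ _ tauts ABz).1.
apply: ge0_integral_le => tau; rewrite /= in_itv/= => tauts.
  by apply: integral_ge0 => x Ax; apply: integral_ge0 => y By; exact: pos.
have mq n : measurable_fun (A `*` B) (fun z => ker z * q n tau z * psi tau z).
  apply: measurable_funM; last exact: mpsi.
  apply: measurable_funM => //; apply: measurable_funM => //.
  exact: measurable_funB.
(* The derivative gives way to a lower limit of measurable quotients before Tonelli's theorem is
   applied, so its own measurability is not at issue. *)
apply: (@le_trans _ _ (\int[m1]_(x in A) \int[m2]_(y in B)
    limn_einf (fun n => (ker (x, y) * q n tau (x, y) * psi tau (x, y))%:E))%E).
  apply: ge0_integral_le => x Ax.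
    by apply: integral_ge0 => y By; exact: pos.
  by apply: ge0_integral_le => y By; [exact: pos|exact: (quot _ _ tauts _).2].
rewrite (@ge0_iterated_integral _ _ _ _ _ m1 m2 A B mA mB (fun z =>
    limn_einf (fun n => (ker z * q n tau z * psi tau z)%:E))); last 2 first.
- apply: (@measurable_fun_limn_einf _ _ _ _
    (fun n z => (ker z * q n tau z * psi tau z)%:E)) => n.
  exact/measurable_EFinP.
- by move=> z _; apply: limn_einf_ge0 => n; rewrite lee_fin.
apply: le_trans (fatou _ _ _ _) _ => //.
- by move=> n; exact/measurable_EFinP.
- by move=> n z _; rewrite lee_fin.
apply: le_limn_einf => n.
pose t' := tau + n.+1%:R^-1.
have ikW r := integrable_kernel_weight r.
have iB : m12.-integrable (A `*` B) (EFin \o (fun z =>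
    ker z * Gam tau z * W z - ker z * Gam t' z * W z)).
  have := integrableB mAB (ikW tau) (ikW t').
  by apply: eq_integrable => // z _ /=; rewrite EFinB.
have iq : m12.-integrable (A `*` B) (EFin \o (fun z =>
    n.+1%:R * (ker z * Gam tau z * W z - ker z * Gam t' z * W z))).
  have := integrableZl mAB n.+1%:R iB.
  by apply: eq_integrable => // z _ /=; rewrite EFinM.
apply: (@le_trans _ _ (\int[m12]_(z in A `*` B) (ker z * q n tau z * W z)%:E)%E).
  apply: ae_ge0_le_integral => //.
  - by move=> z _; rewrite lee_fin.
  - exact/measurable_EFinP.
  - by move=> z _; rewrite lee_fin.
  - apply/measurable_EFinP; apply: measurable_funM => //.
    apply: measurable_funM => //; apply: measurable_funM => //.
    exact: measurable_funB.
  - have := psiW _ tauts; apply: filterS => z /= psiWz ABz.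
    by rewrite lee_fin; apply: ler_wpM2l; [exact: mulr_ge0|exact: psiWz].
rewrite le_eqVlt; apply/orP; left; apply/eqP.
have -> : n.+1%:R * (F tau - F t') =
    (\int[m12]_(z in A `*` B) (n.+1%:R * (ker z * Gam tau z * W z - ker z * Gam t' z * W z)))%R.
  rewrite RintegralZl//.
  by rewrite RintegralB//; exact: integrable_kernel_weight.
rewrite /Rintegral fineK; last exact: integrable_fin_num.
by apply: eq_integral => z _; congr EFin; rewrite /q; ring.
Qed.

End damage_increment.

Section ge0_integral_setU.
Local Open Scope ereal_scope.
Context d (T : measurableType d) (R : realType).
Variable mu : {measure set T -> \bar R}.
Import HBNNSimple.

(* As in [ge0_integral_le], [f] need not be measurable. *)
Lemma ge0_integral_setU_le (A B : set T) (f : T -> \bar R) :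
  measurable A -> measurable B -> [disjoint A & B] -> (forall x, (A `|` B) x -> 0 <= f x) ->
  \int[mu]_(x in A `|` B) f x <= \int[mu]_(x in A) f x + \int[mu]_(x in B) f x.
Proof.
move=> mA mB AB f0; rewrite ge0_integralE//.
apply: ge_ereal_sup => _ [h hf <-]; rewrite -integralT_nnsfun.
have h0 x : (0 <= (h x)%:E) by rewrite lee_fin.
have hAB : \int[mu]_x (h x)%:E = \int[mu]_(x in A `|` B) (h x)%:E.
  rewrite [RHS]integral_mkcond; apply: eq_integral => x _; rewrite patchE.
  case: ifPn => // xAB; have := hf x; rewrite patchE (negbTE xAB) => hx.
  by apply/eqP; rewrite eq_le hx h0.
rewrite hAB ge0_integral_setU//; last 1 first.
- by apply/measurable_EFinP/measurable_funTS.
apply: leeD; apply: ge0_integral_le => // x ABx; have := hf x; rewrite patchE.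
  by rewrite mem_set//; left.
by rewrite mem_set//; right.
Qed.

End ge0_integral_setU.

(** * The energy balance *)

(** The exceptional set of the domination may depend on [s]; along a sequence the union of these
    sets is still null, and dominated convergence applies. *)
Lemma cvg_within_Rintegral d (Z : measurableType d) (R : realType)
    (mu : {measure set Z -> \bar R}) (D : set Z) (A : set R) (t : R)
    (F : R -> Z -> R) (f G : Z -> R) (P : R -> Prop) :
  measurable D -> (\forall s \near within A t^', P s) ->
  (forall s, measurable_fun D (F s)) -> measurable_fun D f ->
  mu.-integrable D (EFin \o G) ->
  (forall s, A s -> s != t -> P s -> {ae mu, forall z, D z -> `|F s z| <= G z}) ->
  (forall s_ : nat -> R, (forall n, [/\ A (s_ n), s_ n != t & P (s_ n)]) ->
     s_ n @[n --> \oo] --> t ->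
     {ae mu, forall z, D z -> F (s_ n) z @[n --> \oo] --> f z}) ->
  (\int[mu]_(z in D) F s z)%R @[s --> within A t^'] --> (\int[mu]_(z in D) f z)%R.
Proof.
move=> mD nP mF mf iG FG cF; apply: (cvg_within_seqP nP) => s_ sP st.
apply: (dominated_cvg_Rintegral mD (fun n => mF (s_ n)) mf (cF _ sP st) iG).
have : {ae mu, forall z n, D z -> `|F (s_ n) z| <= G z}.
  by apply/ae_foralln => n; have [As nt Ps] := sP n; exact: FG.
by apply: filterS => z FGz Dz n; exact: FGz.
Qed.

Section energies.
Context {R : realType} {d : nat}.
Local Notation E := 'rV[R]_d.+1.
Local Notation vol := (@lebesgue_rV R d.+1).
Local Notation vol2 := (vol \x vol)%E.
Variables (Omega : set E) (T rho : R).
Hypotheses (mO : measurable Omega) (bO : bounded_set Omega).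
Hypothesis rho0 : 0 < rho.
Local Notation OO := (Omega `*` Omega).

Variables (w v a b : R -> E -> E).
Hypothesis mw : forall t, measurable_fun [set: E] (w t).
Hypothesis cw : forall x, continuous (w^~ x).
Hypothesis mv : forall t, measurable_fun [set: E] (v t).
Hypothesis ma : forall t, measurable_fun [set: E] (a t).
Hypothesis mb : forall t, measurable_fun [set: E] (b t).
Hypothesis dw : Linfty_derivative Omega T w v.
Hypothesis dv : Linfty_derivative Omega T v a.
Hypothesis v_fin : forall t, t \in `[0, T] -> (Linfty_norm Omega (v t) < +oo)%E.
Hypothesis a_fin : forall t, t \in `[0, T] -> (Linfty_norm Omega (a t) < +oo)%E.
Variable B : R.
Hypothesis b_le : forall t, t \in `[0, T] ->
  {ae vol, forall x, Omega x -> enorm (b t x) <= B}.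

Variables (ker : E * E -> R) (kM : R).
Hypothesis mker : measurable_fun [set: E * E] ker.
Hypothesis ker0 : forall z, 0 <= ker z <= kM.
Hypothesis kerC : forall z, ker (z.2, z.1) = ker z.

Variables (g : R -> R) (K G : R).
Hypothesis g0 : forall r, 0 <= g r.
Hypothesis gG : forall r, g r <= G.
Hypothesis dg : forall r, derivable g r 1.
Hypothesis cg' : continuous (derive1 g).
Hypothesis K0 : 0 <= K.
Hypothesis g'K : forall r, `|derive1 g r| <= K.
Hypothesis lipg : forall r s, `|g r - g s| <= K * `|r - s|.

Variables (Gam : R -> E -> E -> R) (gam : E -> E -> R -> R).
Hypothesis Gam01 : forall t y x, 0 <= Gam t y x <= 1.
Hypothesis dGam : forall y x, {homo (fun t => Gam t y x) : s t /~ s <= t}.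
Hypothesis cGam : forall y x, continuous (fun t => Gam t y x).
Hypothesis GamC : forall t y x, Gam t y x = Gam t x y.
Hypothesis mGam : forall t, measurable_fun [set: E * E] (fun z => Gam t z.2 z.1).
Hypothesis gamE : forall t y x, 0 <= t <= T -> Omega y -> Omega x -> gam y x t = Gam t y x.

Local Notation r t z := (scaled_strain z.2 z.1 (w t)).
Local Notation isq z := (isqrt_dist z.2 z.1).

Let mOO : measurable OO. Proof. exact: measurableX. Qed.

Let volO : (vol Omega < +oo)%E. Proof. exact: bounded_rV_lty. Qed.

Let cg : continuous g.
Proof. by move=> x; apply/differentiable_continuous/derivable1_diffP. Qed.

Let kM0 : 0 <= kM.
Proof. by have /andP[] := ker0 (0, 0); exact: le_trans. Qed.

Let integrable_cst c : vol.-integrable Omega (EFin \o cst c).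
Proof.
apply: measurable_bounded_integrable => //.
exact: bounded_cst.
Qed.

Let integrable_cst2 c : vol2.-integrable OO (EFin \o cst c).
Proof.
apply: measurable_bounded_integrable => //; last exact: bounded_cst.
rewrite [ltLHS](_ : _ = (vol Omega * vol Omega)%E); last exact: product_measure1E.
by rewrite lte_mul_pinfty// ge0_fin_numE.
Qed.

Let integrable_isq c : vol2.-integrable OO (EFin \o (fun z => c * isq z)).
Proof.
have := integrableZl mOO c (integrable_isqrt_dist mO bO).
by apply: eq_integrable => // z _ /=; rewrite EFinM.
Qed.

Let mrt t : measurable_fun OO (fun z => r t z).
Proof. by apply: measurable_funTS; exact: measurable_scaled_strain. Qed.

Let mgr t : measurable_fun OO (fun z => g (r t z)).
Proof. by apply: measurableT_comp (mrt t); exact: continuous_measurable_fun. Qed.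

Let mkOO : measurable_fun OO ker. Proof. exact: measurable_funTS. Qed.

Let mGOO t : measurable_fun OO (fun z => Gam t z.2 z.1).
Proof. exact: measurable_funTS. Qed.

Let misq : measurable_fun OO (fun z => isq z).
Proof. exact: measurable_isqrt_dist. Qed.

Let cvg_r (s_ : nat -> R) t z : s_ n @[n --> \oo] --> t ->
  r (s_ n) z @[n --> \oo] --> r t z.
Proof.
move=> st; apply: (@cvg_comp _ _ _ s_ (fun s => r s z) _ (nbhs t) _ st).
exact: (@continuous_scaled_strain R d.+1 w z.2 z.1 cw t).
Qed.

Let cvg_Gam (s_ : nat -> R) t z : s_ n @[n --> \oo] --> t ->
  Gam (s_ n) z.2 z.1 @[n --> \oo] --> Gam t z.2 z.1.
Proof.
move=> st; exact: (@cvg_comp _ _ _ s_ (fun s => Gam s z.2 z.1) _ (nbhs t) _ st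
  (@cGam z.2 z.1 t)).
Qed.

Let cvg_g (x_ : nat -> R) x : x_ n @[n --> \oo] --> x -> g (x_ n) @[n --> \oo] --> g x.
Proof. by move=> xx; exact: (@cvg_comp _ _ _ x_ g _ (nbhs x) _ xx (@cg x)). Qed.

Definition kinetic_real t : R :=
  (\int[vol]_(x in Omega) (rho * (enorm (v t x) ^+ 2 / 2)))%R.

Definition elastic_real t : R :=
  (\int[vol2]_(z in OO) (ker z * Gam t z.2 z.1 * g (r t z)))%R.

Lemma integrable_ess_bounded (f : E -> R) M : measurable_fun [set: E] f ->
  {ae vol, forall x, Omega x -> `|f x| <= M} -> vol.-integrable Omega (EFin \o f).
Proof.
move=> mf fM; apply: (ae_le_integrable mO _ (integrable_cst M) fM).
exact: measurable_funTS.
Qed.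

Lemma integrable_kinetic t : t \in `[0, T] ->
  vol.-integrable Omega (EFin \o (fun x => rho * (enorm (v t x) ^+ 2 / 2))).
Proof.
move=> tT; have [M M0 vM] := Linfty_norm_lty (v_fin tT).
apply: (@integrable_ess_bounded _ (rho * (M ^+ 2 / 2))).
  apply: measurable_funM => //; apply: measurable_funM => //.
  apply: measurable_funX; apply: measurable_enorm.
  exact: (@measurable_fun_coord R d.+1 _ E setT).
apply: filterS vM => x vM Ox; rewrite ger0_norm; last first.
  by rewrite mulr_ge0 ?divr_ge0 ?sqr_ge0// ltW.
apply: ler_wpM2l; first exact: ltW.
by rewrite ler_wpM2r// ler_pXn2r ?nnegrE ?enorm_ge0//; exact: vM.
Qed.

Lemma cvg_dotp2 (f h : nat -> E) (c e : E) :
  f n @[n --> \oo] --> c -> h n @[n --> \oo] --> e ->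
  dotp (f n) (h n) @[n --> \oo] --> dotp c e.
Proof.
move=> fc he; rewrite /dotp; apply: (@cvg_big R) => [|i _]; first exact: add_continuous.
apply: cvgM.
- exact: (@cvg_comp _ _ _ f (fun M : E => M ord0 i) _ (nbhs c) _ fc
    (@coord_continuous R 1 d.+1 ord0 i c)).
- exact: (@cvg_comp _ _ _ h (fun M : E => M ord0 i) _ (nbhs e) _ he
    (@coord_continuous R 1 d.+1 ord0 i e)).
Qed.

Lemma cvg_kinetic_quotient t : t \in `[0, T] ->
  (s - t)^-1 * (kinetic_real s - kinetic_real t) @[s --> within `[0, T] t^'] -->
  (\int[vol]_(x in Omega) (rho * dotp (a t x) (v t x)))%R.
Proof.
move=> tT; have [Mv Mv0 vM] := Linfty_norm_lty (v_fin tT).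
have [M M0 nM] := Linfty_derivative_lipschitz dv tT (a_fin tT).
pose q s x := (s - t)^-1 *: (v s x - v t x).
(* The quotient of the kinetic density, expanded in the quotient [q] of the velocity; the second
   term vanishes in the limit because [q] stays bounded. *)
pose F s x := rho * dotp (q s x) (v t x) + rho / 2 * (s - t) * dotp (q s x) (q s x).
have nA : \forall s \near within `[0, T] t^', s \in `[0, T] by exact: withinT.
have nt : \forall s \near within `[0, T] t^', s != t.
  by apply: cvg_within; exact: withinT.
have cmv s : coord_measurable [set: E] (v s) by exact: (@measurable_fun_coord R d.+1 _ E setT).
have cma s : coord_measurable [set: E] (a s) by exact: (@measurable_fun_coord R d.+1 _ E setT).
have cmq s : coord_measurable [set: E] (q s).
  by apply: coord_measurableZ => //; exact: coord_measurableB.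
have mF s : measurable_fun [set: E] (F s).
  apply: measurable_funD; apply: measurable_funM => //; exact: measurable_dotp.
have FE s x : s != t -> F s x = (s - t)^-1 *
    (rho * (enorm (v s x) ^+ 2 / 2) - rho * (enorm (v t x) ^+ 2 / 2)).
  move=> st; have st0 : s - t != 0 by rewrite subr_eq0.
  have -> : v s x = v t x + (s - t) *: q s x.
    by rewrite /q scalerA divff// scale1r addrC subrK.
  rewrite /F; move: (q s x) => y.
  rewrite !enorm_sqr !dotpDl !(dotpC _ (_ + _)) !dotpDl !dotpZl !dotpZr.
  by rewrite (dotpC (v t x) y); field.
suff cF : (\int[vol]_(x in Omega) F s x)%R @[s --> within `[0, T] t^'] -->
    (\int[vol]_(x in Omega) (rho * dotp (a t x) (v t x)))%R.
  apply: cvg_trans cF; apply: near_eq_cvg; near=> s; have sT : s \in `[0, T] by near: s.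
  have st : s != t by near: s.
  rewrite -RintegralB//; [|exact: integrable_kinetic..].
  rewrite -RintegralZl//; last first.
    have := integrableB mO (integrable_kinetic sT) (integrable_kinetic tT).
    by apply: eq_integrable => // x _ /=; rewrite EFinB.
  by apply: eq_Rintegral => x _; rewrite FE.
(* From |q| <= M, |v(t)| <= Mv and |s - t| <= T, with the factor of [normr_dotp_le]. *)
pose C := rho * (d.+1%:R * (M * Mv)) + rho / 2 * T * (d.+1%:R * (M * M)).
apply: (@cvg_within_Rintegral _ _ _ _ _ _ _ _ _ (cst C) _ mO nM) => //.
- by move=> s; exact: measurable_funTS.
- by apply: measurable_funTS; apply: measurable_funM => //; exact: measurable_dotp.
- move=> s sT st [_ sM]; apply: filterS2 vM sM => x vx sx Ox.
  have qM : enorm (q s x) <= M.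
    rewrite enormZ normrV ?unitfE ?subr_eq0// mulrC ler_pdivrMr ?normr_gt0 ?subr_eq0//.
    exact: sx.
  apply: (le_trans (ler_normD _ _)); apply: lerD.
    rewrite normrM gtr0_norm// ler_wpM2l ?(ltW rho0)//.
    apply: (le_trans (normr_dotp_le _ _)); rewrite ler_wpM2l//.
    by rewrite ler_pM ?enorm_ge0//; exact: vx.
  have r2 : 0 < rho / 2 by rewrite divr_gt0.
  rewrite 2!normrM (gtr0_norm r2); apply: ler_pM => //.
  + by rewrite mulr_ge0// ltW.
  + rewrite ler_wpM2l ?(ltW r2)//.
    move: sT tT; rewrite /= !in_itv/= => /andP[s0 sT] /andP[t0 tT].
    by rewrite ler_norml; apply/andP; split; lra.
  + apply: (le_trans (normr_dotp_le _ _)); rewrite ler_wpM2l//.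
    by rewrite ler_pM ?enorm_ge0.
- move=> s_ sP st.
  have := @Linfty_derivative_seq R d.+1 Omega T v a t s_ dv tT _ st.
  have sP' n : [/\ `[0, T]%classic (s_ n), s_ n != t & (Linfty_norm Omega
      (fun x => ((s_ n - t)^-1 *: (v (s_ n) x - v t x) - a t x)%R) <= 1)%E].
    by have [? ? []] := sP n.
  move=> /(_ sP'); apply: filterS => x qx Ox; rewrite /F -[X in _ --> X]addr0.
  apply: cvgD.
    by apply: cvgMl_tmp; apply: cvg_dotp2; [exact: qx|exact: cvg_cst].
  rewrite -(mul0r (dotp (a t x) (a t x))); apply: cvgM.
    rewrite -(mulr0 (rho / 2)); apply: cvgMl_tmp.
    by rewrite -(subrr t); apply: cvgB => //; exact: cvg_cst.
  by apply: cvg_dotp2; exact: qx.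
Unshelve. all: by end_near. Qed.

Lemma ae_pair_le (f : E -> R) M : {ae vol, forall x, Omega x -> f x <= M} ->
  {ae vol2, forall z, OO z -> f z.1 <= M /\ f z.2 <= M}.
Proof.
move=> fM; have f1 := @ae_setX_fst _ _ _ _ _ vol vol Omega Omega _ fM.
have f2 := @ae_setX_snd _ _ _ _ _ vol vol Omega Omega _ fM.
by apply: filterS2 f1 f2 => z f1 f2 OOz; split; [exact: f1|exact: f2].
Qed.

(* [r t] is Lipschitz in time with a constant of order [|y - x|^(-1/2)]. *)
Lemma scaled_strain_increment_le t : t \in `[0, T] ->
  exists2 L, 0 <= L & \forall s \near within `[0, T] t^',
    (Linfty_norm Omega (fun x => ((s - t)^-1 *: (w s x - w t x) - v t x)%R) <= 1)%E /\
    {ae vol2, forall z, OO z -> `|r s z - r t z| <= L * `|s - t| * isq z}.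
Proof.
move=> tT; have [M M0 nM] := Linfty_derivative_lipschitz dw tT (v_fin tT).
exists (d.+1%:R * (M + M)); first by rewrite mulr_ge0// addr_ge0.
apply: filterS nM => s [s1 sM]; split => //.
apply: filterS (ae_pair_le sM) => z sz OOz; have [z1 z2] := sz OOz.
rewrite scaled_strainB; apply: (le_trans (normr_scaled_strain_le _ _ _)).
rewrite ler_wpM2r ?isqrt_dist_ge0// -mulrA ler_wpM2l// mulrDl.
exact: lerD.
Qed.

(** The degradation factor is frozen at [t]. With K the Lipschitz constant of [g] and L that of the
    strain, the quotients are dominated by kM K L |y - x|^(-1/2), which is integrable. *)
Lemma cvg_elastic_quotient t : t \in `[0, T] ->
  (s - t)^-1 * (\int[vol2]_(z in OO)
      (ker z * Gam t z.2 z.1 * (g (r s z) - g (r t z))))%R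
    @[s --> within `[0, T] t^'] -->
  (\int[vol2]_(z in OO) (ker z * Gam t z.2 z.1 *
     (derive1 g (r t z) * scaled_strain z.2 z.1 (v t))))%R.
Proof.
move=> tT; have [L L0 nL] := scaled_strain_increment_le tT.
pose F s z := ker z * Gam t z.2 z.1 * ((g (r s z) - g (r t z)) / (s - t)).
have mF s : measurable_fun OO (F s).
  apply: measurable_funM; first exact: measurable_funM.
  by apply: measurable_funM => //; exact: measurable_funB.
have FE s z : F s z = (s - t)^-1 * (ker z * Gam t z.2 z.1 * (g (r s z) - g (r t z))).
  by rewrite /F; ring.
have ikG s : vol2.-integrable OO
    (EFin \o (fun z => ker z * Gam t z.2 z.1 * (g (r s z) - g (r t z)))).
  apply: (ae_le_integrable mOO _ (integrable_cst2 (kM * G))).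
    apply: measurable_funM; first exact: measurable_funM.
    exact: measurable_funB.
  apply: aeW => z _; rewrite !normrM /=; have /andP[k0 kk] := ker0 z.
  have /andP[G0 G1] := Gam01 t z.2 z.1.
  rewrite (ger0_norm k0) (ger0_norm G0); apply: ler_pM => //.
  + exact: mulr_ge0.
  + by rewrite -[leRHS]mulr1; exact: ler_pM.
  + have := g0 (r s z); have := g0 (r t z); have := gG (r s z); have := gG (r t z).
    by rewrite ler_norml => ? ? ? ?; apply/andP; split; lra.
under eq_cvg do rewrite -RintegralZl//.
suff cF : (\int[vol2]_(z in OO) F s z)%R @[s --> within `[0, T] t^'] -->
    (\int[vol2]_(z in OO) (ker z * Gam t z.2 z.1 *
     (derive1 g (r t z) * scaled_strain z.2 z.1 (v t))))%R.
  apply: cvg_trans cF; apply: near_eq_cvg.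
  by apply: nearW => s; apply: eq_Rintegral => z _; rewrite FE.
apply: (@cvg_within_Rintegral _ _ _ _ _ _ _ _ _ (fun z => kM * K * L * isq z) _ mOO nL) => //.
- apply: measurable_funM; first exact: measurable_funM.
  apply: measurable_funM; last by apply: measurable_funTS; exact: measurable_scaled_strain.
  by apply: measurableT_comp (mrt t); exact: continuous_measurable_fun.
- move=> s sT st [_ sL]; apply: filterS sL => z sL OOz; have := sL OOz => {}sL.
  rewrite /F !normrM; have /andP[k0 kk] := ker0 z.
  have /andP[G0 G1] := Gam01 t z.2 z.1.
  rewrite (ger0_norm k0) (ger0_norm G0) -!mulrA; apply: ler_pM => //.
    by rewrite !mulr_ge0.
  rewrite -[leRHS]mul1r; apply: ler_pM => //.
  have st0 : 0 < `|s - t| by rewrite normr_gt0 subr_eq0.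
  rewrite normrV ?unitfE ?subr_eq0// ler_pdivrMr//.
  apply: (le_trans (lipg _ _)); rewrite -!mulrA ler_wpM2l//.
  by rewrite [isq z * _]mulrC mulrA.
- move=> s_ sP st.
  have sP' n : [/\ `[0, T]%classic (s_ n), s_ n != t & (Linfty_norm Omega
      (fun x => ((s_ n - t)^-1 *: (w (s_ n) x - w t x) - v t x)%R) <= 1)%E].
    by have [? ? []] := sP n.
  have qc := Linfty_derivative_seq dw tT sP' st.
  have q1 := @ae_setX_fst _ _ _ _ _ vol vol Omega Omega _ qc.
  have q2 := @ae_setX_snd _ _ _ _ _ vol vol Omega Omega _ qc.
  apply: filterS2 q1 q2 => z q1 q2 OOz; apply: cvgMl_tmp.
  apply: cvg_comp_quotient => //; first exact: cvg_r.
  have -> : (fun n => (r (s_ n) z - r t z) / (s_ n - t)) =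
      (fun n => scaled_strain z.2 z.1 (fun x => (s_ n - t)^-1 *: (w (s_ n) x - w t x))).
    by apply/funext => n; rewrite scaled_strainB scaled_strainZ mulrC.
  by apply: cvg_scaled_strain; [exact: q2|exact: q1].
Qed.

(** No rate is obtained; in the damage increment the singular weight comes with a prefactor s - t,
    and the vanishing alone makes that term of smaller order. *)
Lemma cvg_weight_increment (W : E * E -> R) t : (forall z, 0 <= W z) ->
  vol2.-integrable OO (EFin \o W) ->
  (\int[vol2]_(z in OO) (ker z * (Gam t z.2 z.1 - Gam s z.2 z.1) * W z))%R
    @[s --> within `[0, T] t^'] --> 0.
Proof.
move=> W0 iW; have -> : 0 = (\int[vol2]_(z in OO) (0 : R))%R :> R.
  by rewrite /Rintegral integral0.
have mW : measurable_fun OO W by apply/measurable_EFinP; exact: measurable_int iW.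
apply: (@cvg_within_Rintegral _ _ _ _ _ _ _ _ _ (fun z => kM * W z) (fun=> True) mOO) => //.
- exact: nearW.
- move=> s; apply: measurable_funM => //; apply: measurable_funM => //.
  exact: measurable_funB.
- have := integrableZl mOO kM iW.
  by apply: eq_integrable => // z _ /=; rewrite EFinM.
- move=> s _ _ _; apply: aeW => z _; have /andP[k0 kk] := ker0 z.
  rewrite !normrM (ger0_norm k0) (ger0_norm (W0 z)) ler_wpM2r//.
  rewrite -[leRHS]mulr1; apply: ler_pM => //.
  have /andP[? ?] := Gam01 t z.2 z.1; have /andP[? ?] := Gam01 s z.2 z.1.
  by rewrite ler_norml; apply/andP; split; lra.
- move=> s_ _ st; apply: aeW => z _.
  have -> : 0 = ker z * (Gam t z.2 z.1 - Gam t z.2 z.1) * W z by rewrite subrr mulr0 mul0r.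
  apply: cvgMr_tmp; apply: cvgMl_tmp; apply: cvgB; first exact: cvg_cst.
  exact: cvg_Gam.
Qed.

Lemma integrable_elastic t :
  vol2.-integrable OO (EFin \o (fun z => ker z * Gam t z.2 z.1 * g (r t z))).
Proof.
apply: (ae_le_integrable mOO _ (integrable_cst2 (kM * G))).
  by apply: measurable_funM => //; exact: measurable_funM.
apply: aeW => z _; rewrite !normrM /=; have /andP[k0 kk] := ker0 z.
have /andP[G0 G1] := Gam01 t z.2 z.1.
rewrite (ger0_norm k0) (ger0_norm G0) (ger0_norm (g0 _)); apply: ler_pM => //.
- exact: mulr_ge0.
- by rewrite -[leRHS]mulr1; exact: ler_pM.
Qed.

Lemma cvg_elastic t : elastic_real s @[s --> within `[0, T] t^'] --> elastic_real t.
Proof.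
apply: (@cvg_within_Rintegral _ _ _ _ _ _ _ _ _ (cst (kM * G)) (fun=> True) mOO) => //.
- exact: nearW.
- by move=> s; apply: measurable_funM => //; exact: measurable_funM.
- by apply: measurable_funM => //; exact: measurable_funM.
- move=> s _ _ _; apply: aeW => z _; rewrite !normrM /=; have /andP[k0 kk] := ker0 z.
  have /andP[G0 G1] := Gam01 s z.2 z.1.
  rewrite (ger0_norm k0) (ger0_norm G0) (ger0_norm (g0 _)); apply: ler_pM => //.
  + exact: mulr_ge0.
  + by rewrite -[leRHS]mulr1; exact: ler_pM.
- move=> s_ _ st; apply: aeW => z _; apply: cvgM; last exact/cvg_g/cvg_r.
  by apply: cvgMl_tmp; exact: cvg_Gam.
Qed.

(** * The power of the force *)

Definition force_real t (x : E) : E :=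
  \row_i (- \int[vol]_(y in Omega) (2 * ker (x, y) * isqrt_dist y x * Gam t y x *
      derive1 g (scaled_strain y x (w t)) * direction y x ord0 i))%R.

Let kap t z := ker z * isq z * Gam t z.2 z.1 * derive1 g (r t z).

Let mkap t : measurable_fun [set: E * E] (kap t).
Proof.
apply: measurable_funM; last first.
  apply: (measurableT_comp (f := derive1 g)); first exact: continuous_measurable_fun.
  exact: measurable_scaled_strain.
by apply: measurable_funM => //; apply: measurable_funM => //; exact: measurable_isqrt_dist.
Qed.

Let kap_le t z : `|kap t z| <= kM * K * isq z.
Proof.
rewrite /kap !normrM; have /andP[k0 kk] := ker0 z.
have /andP[G0 G1] := Gam01 t z.2 z.1.
rewrite (ger0_norm k0) (ger0_norm G0) (ger0_norm (isqrt_dist_ge0 _ _)).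
have -> : kM * K * isq z = kM * isq z * 1 * K by ring.
have i0 := isqrt_dist_ge0 z.2 z.1.
have ki0 : 0 <= ker z * isq z by exact: mulr_ge0.
have kiG0 : 0 <= ker z * isq z * Gam t z.2 z.1 by exact: mulr_ge0.
by apply: ler_pM => //; apply: ler_pM => //; rewrite ler_wpM2r.
Qed.

Let kapC t z : kap t (z.2, z.1) = kap t z.
Proof. by rewrite /kap /= isqrt_distC GamC scaled_strainC kerC. Qed.

(** The force between two points paired with the velocity at the first. [kap] is symmetric in the
    points, so exchanging them affects only the direction and the velocity. *)
Let h t (z : E * E) := - (2 * kap t z * dotp (direction z.2 z.1) (v t z.1)).

Let mh t : measurable_fun [set: E * E] (h t).
Proof.
apply: measurableT_comp => //; apply: measurable_funM; first exact: measurable_funM.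
apply: measurable_dotp; first exact: coord_measurable_direction.
exact: (coord_measurable_pair (mv t)).1.
Qed.

Let normr_dotp_direction_le (y x e : E) : `|dotp (direction y x) e| <= d.+1%:R * enorm e.
Proof.
apply: (le_trans (normr_dotp_le _ _)); rewrite ler_wpM2l//.
by rewrite ler_piMl ?enorm_ge0// enorm_direction_le.
Qed.

Let h_le t z : `|h t z| <= 2 * (kM * K) * (d.+1%:R * enorm (v t z.1)) * isq z.
Proof.
rewrite /h normrN normrM [`|2 * _|]normrM (ger0_norm (ler0n _ 2)).
have -> : 2 * (kM * K) * (d.+1%:R * enorm (v t z.1)) * isq z =
  2 * (kM * K * isq z) * (d.+1%:R * enorm (v t z.1)) by ring.
by apply: ler_pM => //; rewrite ler_wpM2l.
Qed.

Let integrable_isq_fst c x : vol.-integrable Omega (EFin \o (fun y => c * isqrt_dist y x)).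
Proof.
have := integrableZl mO c (integrable_isqrt_dist_fst mO bO x).
by apply: eq_integrable => // y _ /=; rewrite EFinM.
Qed.

Let measurable_fst_section (f : E * E -> R) x : measurable_fun [set: E * E] f ->
  measurable_fun Omega (fun y => f (x, y)).
Proof.
move=> mf; apply: measurable_funTS.
by apply: (measurableT_comp mf); exact: measurable_pair1.
Qed.

Let ih_fst t x : vol.-integrable Omega (fun y => (h t (x, y))%:E).
Proof.
apply: (@ae_le_integrable _ _ _ _ Omega (fun y => h t (x, y)) _ mO _
  (integrable_isq_fst (2 * (kM * K) * (d.+1%:R * enorm (v t x))) x)).
  exact: measurable_fst_section.
by apply: aeW => y _; exact: (h_le t (x, y)).
Qed.

Let ih t : t \in `[0, T] -> vol2.-integrable OO (EFin \o h t).
Proof.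
move=> tT; have [M M0 vM] := Linfty_norm_lty (v_fin tT).
apply: (ae_le_integrable mOO _ (integrable_isq (2 * (kM * K) * (d.+1%:R * M)))).
  exact: measurable_funTS.
apply: filterS (ae_pair_le vM) => z vz OOz; have [v1 _] := vz OOz.
apply: (le_trans (h_le _ _)); rewrite ler_wpM2r ?isqrt_dist_ge0//.
by rewrite ler_wpM2l ?mulr_ge0// ler_wpM2l.
Qed.

Let dotp_forceE t x : dotp (force_real t x) (v t x) = (\int[vol]_(y in Omega) h t (x, y))%R.
Proof.
pose f i y := - (2 * kap t (x, y)) * direction y x ord0 i * v t x ord0 i.
have ikd i : vol.-integrable Omega (EFin \o (fun y => 2 * ker (x, y) * isqrt_dist y x *
    Gam t y x * derive1 g (scaled_strain y x (w t)) * direction y x ord0 i)).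
  have kE y : 2 * ker (x, y) * isqrt_dist y x *
    Gam t y x * derive1 g (scaled_strain y x (w t)) * direction y x ord0 i =
    2 * kap t (x, y) * direction y x ord0 i by rewrite /kap; ring.
  apply: (ae_le_integrable mO _ (integrable_isq_fst (2 * (kM * K)) x)).
    under eq_fun do rewrite kE.
    apply: (measurable_fst_section (f := fun z => 2 * kap t z * direction z.2 z.1 ord0 i)).
    by apply: measurable_funM; [exact: measurable_funM|exact: coord_measurable_direction].
  apply: aeW => y _; rewrite kE normrM [`|2 * _|]normrM (ger0_norm (ler0n _ 2)).
  rewrite -[leRHS]mulr1 -[leRHS]mulrA mulrA; apply: ler_pM => //.
    by rewrite -mulrA ler_wpM2l//; exact: (kap_le t (x, y)).
  exact: (le_trans (le_coord_enorm _ _) (enorm_direction_le _ _)).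
have fE i : force_real t x ord0 i * v t x ord0 i = (\int[vol]_(y in Omega) f i y)%R.
  rewrite mxE mulNr -mulrN -RintegralZr//.
  by apply: eq_Rintegral => y _; rewrite /f /kap /=; ring.
have if_ i : vol.-integrable Omega (EFin \o f i).
  have := integrableZr mO (- v t x ord0 i) (ikd i).
  by apply: eq_integrable => // y _ /=; rewrite -EFinM; congr EFin; rewrite /f /kap /=; ring.
rewrite /dotp (eq_bigr _ (fun i _ => fE i)) -Rintegral_sum//.
apply: eq_Rintegral => y _; rewrite /h /dotp /= mulr_sumr -sumrN.
by apply: eq_bigr => i _; rewrite /f; ring.
Qed.

(* By the antisymmetry of [direction], the integrand of the power of the force
   may be symmetrized under the exchange of [x] and [y]. *)
Let Rintegral_h t : t \in `[0, T] -> (\int[vol2]_(z in OO) h t z)%R =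
  (\int[vol2]_(z in OO) (ker z * Gam t z.2 z.1 *
     (derive1 g (r t z) * scaled_strain z.2 z.1 (v t))))%R.
Proof.
move=> tT; have [ihs sE] := Rintegral_swap mO (ih tT).
have : (\int[vol2]_(z in OO) h t z + \int[vol2]_(z in OO) h t (z.2, z.1) =
    2 * \int[vol2]_(z in OO) (ker z * Gam t z.2 z.1 *
     (derive1 g (r t z) * scaled_strain z.2 z.1 (v t))))%R; last first.
  rewrite sE => hE; apply: (@mulfI _ (2 : R)); first by rewrite pnatr_eq0.
  by rewrite -hE; ring.
rewrite -RintegralD//; last exact: ih.
have hE z : h t z + h t (z.2, z.1) = 2 * (ker z * Gam t z.2 z.1 *
     (derive1 g (r t z) * scaled_strain z.2 z.1 (v t))).
  rewrite /h kapC /= (direction_opp z.1) dotpNl (scaled_strainE _ _ (v t)).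
  by rewrite (dotpC (v t z.2)) (dotpC (v t z.1)) /kap; ring.
rewrite -RintegralZl//; last first.
  have := integrableZl mOO (2^-1) (integrableD mOO (ih tT) ihs).
  apply: eq_integrable => // z _ /=; rewrite -EFinD hE -EFinM; congr EFin.
  by rewrite mulKf ?pnatr_eq0.
by apply: eq_Rintegral => z _; rewrite hE.
Qed.

Lemma integrable_dotp (f k : E -> E) (M N : R) : measurable_fun [set: E] f ->
  measurable_fun [set: E] k ->
  {ae vol, forall x, Omega x -> enorm (f x) <= M} ->
  {ae vol, forall x, Omega x -> enorm (k x) <= N} ->
  vol.-integrable Omega (EFin \o (fun x => dotp (f x) (k x))).
Proof.
move=> mf mk fM kN; apply: (@integrable_ess_bounded _ (d.+1%:R * (M * N))).
  by apply: measurable_dotp; exact: (@measurable_fun_coord R d.+1 _ E setT).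
apply: filterS2 fM kN => x fx kx Ox; apply: (le_trans (normr_dotp_le _ _)).
by rewrite ler_wpM2l// ler_pM ?enorm_ge0//; [exact: fx|exact: kx].
Qed.

(** The equation, tested with the velocity, holds at almost every x; Fubini's theorem turns the
    force term into a double integral, which [Rintegral_h] symmetrizes. *)
Lemma power_balance t : t \in `[0, T] ->
  {ae vol, forall x, Omega x -> rho *: a t x + force_real t x = b t x} ->
  (\int[vol]_(x in Omega) (rho * dotp (a t x) (v t x)) +
   \int[vol2]_(z in OO) (ker z * Gam t z.2 z.1 *
     (derive1 g (r t z) * scaled_strain z.2 z.1 (v t))) =
   \int[vol]_(x in Omega) dotp (b t x) (v t x))%R.
Proof.
move=> tT eqm.
have [Mv Mv0 vM] := Linfty_norm_lty (v_fin tT).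
have [Ma Ma0 aM] := Linfty_norm_lty (a_fin tT).
have iav : vol.-integrable Omega (EFin \o (fun x => rho * dotp (a t x) (v t x))).
  have := integrableZl mO rho (integrable_dotp (ma t) (mv t) aM vM).
  by apply: eq_integrable => // x _ /=; rewrite EFinM.
have ibv := integrable_dotp (mb t) (mv t) (b_le tT) vM.
rewrite -Rintegral_h// -(iterated_Rintegral mO mO (ih tT))//.
rewrite addrC -[RHS](subrK (\int[vol]_(x in Omega) (rho * dotp (a t x) (v t x)))%R).
congr (_ + _); rewrite -RintegralB// /Rintegral; congr fine.
have mOh : measurable_fun Omega (fun x => \int[vol]_(y in Omega) h t (x, y))%R.
  by apply: (measurable_iterated_Rintegral mO mO (ih tT)) => x _; exact: ih_fst.
apply: ae_eq_integral => //.
- exact/measurable_EFinP.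
- apply/measurable_EFinP; apply: measurable_funB.
  + by apply/measurable_EFinP; exact: (measurable_int vol ibv).
  + by apply/measurable_EFinP; exact: (measurable_int vol iav).
apply: filterS eqm => x + Ox => /(_ Ox) xE; congr EFin.
transitivity (dotp (force_real t x) (v t x)); first exact/esym/dotp_forceE.
by rewrite -xE dotpDl dotpZl addrC addKr.
Qed.

(** * Increments of the damage energy *)

Let GG0 : 0 <= G. Proof. exact: le_trans (g0 0) (gG 0). Qed.

(** The minus sign of the damage energy is placed on the derivative, where it makes the integrand
    nonnegative and integrals comparable without measurability. *)
Definition damage_density tau : \bar R :=
  (\int[vol]_(x in Omega) \int[vol]_(y in Omega)
    (ker (x, y) * - ae_derive (gam y x) tau * g (scaled_strain y x (w tau)))%:E)%E.

Definition damage_ereal t : \bar R :=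
  (\int[lebesgue_measure]_(tau in `[0%R, t]) damage_density tau)%E.

Let weight (W : E * E -> R) t s : R :=
  (\int[vol2]_(z in OO) (ker z * (Gam t z.2 z.1 - Gam s z.2 z.1) * W z))%R.

Lemma damage_density_ge0 tau : 0 <= tau < T -> (0 <= damage_density tau)%E.
Proof.
move=> tauT; apply: integral_ge0 => x Ox; apply: integral_ge0 => y Oy.
rewrite lee_fin; have /andP[k0 _] := ker0 (x, y).
rewrite mulr_ge0// mulr_ge0//.
(* The factor 0 is chosen because only the sign of the derivative is wanted. *)
apply: (@ae_derive_le_quotient _ (gam y x) (fun t => Gam t y x) T tau 0 tauT _ _ _).1 => //.
by move=> t tT; exact: gamE.
Qed.

Lemma damage_density_increment_le (W : E * E -> R) t s : 0 <= t -> t <= s -> s < T ->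
  (forall z, 0 <= W z) -> vol2.-integrable OO (EFin \o W) ->
  (forall tau, t <= tau <= s -> {ae vol2, forall z, OO z -> g (r tau z) <= W z}) ->
  (\int[lebesgue_measure]_(tau in `[t, s]) damage_density tau <= (weight W t s)%:E)%E.
Proof.
move=> t0 ts sT W0 iW gW.
apply: (@damage_increment_le _ _ _ _ _ vol vol Omega Omega mO mO ker W kM T
  (fun t z => Gam t z.2 z.1) (fun z => gam z.2 z.1) (fun tau z => g (r tau z))) => //.
by move=> z u [x1 x2] uT; exact: gamE.
Qed.

(** The crude majorant, a bound of [g]: enough for the finiteness of the damage and for its
    behaviour as t increases to s. Right increments need a sharper one. *)
Let weight_cst t s : 0 <= t -> t <= s -> s < T ->
  (\int[lebesgue_measure]_(tau in `[t, s]) damage_density tau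
    <= (weight (fun=> G) t s)%:E)%E.
Proof.
move=> t0 ts sT; apply: damage_density_increment_le => //.
- exact: (integrable_cst2 G).
- by move=> tau _; apply: aeW.
Qed.

Lemma damage_ereal_ge0 t : 0 <= t < T -> (0 <= damage_ereal t)%E.
Proof.
move=> /andP[t0 tT]; apply: integral_ge0 => tau; rewrite /= in_itv/= => /andP[tau0 taut].
by apply: damage_density_ge0; rewrite tau0 (le_lt_trans taut).
Qed.

Lemma damage_ereal_fin_num t : 0 <= t < T -> damage_ereal t \is a fin_num.
Proof.
move=> /[dup] t0T /andP[t0 tT]; rewrite ge0_fin_numE ?damage_ereal_ge0//.
by apply: le_lt_trans (ltry _); exact: weight_cst.
Qed.

Definition damage_real t : R := fine (damage_ereal t).

Lemma damage_real_ge0 t : 0 <= t < T -> 0 <= damage_real t.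
Proof. by move=> t0T; apply: fine_ge0; exact: damage_ereal_ge0. Qed.

Lemma damage_real0 : damage_real 0 = 0.
Proof. by rewrite /damage_real /damage_ereal set_itv1 integral_set1. Qed.

(** The density not being known to be measurable, the splitting of the time integral at [t] is used
    as an inequality; passing from [0, t[ to [0, t] is monotonicity. *)
Lemma damage_real_increment_le t s c : 0 <= t -> t <= s -> s < T ->
  (\int[lebesgue_measure]_(tau in `[t, s]) damage_density tau <= c%:E)%E ->
  damage_real s <= damage_real t + c.
Proof.
move=> t0 ts sT ic.
have tT : 0 <= t < T by rewrite t0 (le_lt_trans ts).
have s0T : 0 <= s < T by rewrite (le_trans t0 ts).
have d0 tau : 0 <= tau <= s -> (0 <= damage_density tau)%E.
  by move=> /andP[tau0 taus]; apply: damage_density_ge0; rewrite tau0 (le_lt_trans taus).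
rewrite -lee_fin EFinD !fineK ?damage_ereal_fin_num//.
rewrite /damage_ereal (@itv_bndbnd_setU _ _ _ (BLeft t)) ?bnd_simp//.
apply: (@le_trans _ _ (\int[lebesgue_measure]_(tau in `[0%R, t[) damage_density tau +
    \int[lebesgue_measure]_(tau in `[t, s]) damage_density tau)%E).
  apply: ge0_integral_setU_le => //.
    apply/disj_setPS => tau [/=]; rewrite !in_itv/= => /andP[_ taut] /andP[ttau _].
    by move: taut; rewrite ltNge ttau.
  move=> tau [|]; rewrite /= in_itv/= => /andP[tau0 taus]; apply: d0.
    by rewrite tau0 (le_trans (ltW taus)).
  by rewrite (le_trans t0 tau0).
apply: leeD => //; rewrite [leLHS]integral_mkcond [leRHS]integral_mkcond.
have sub tau : tau \in `[0, t[%classic -> tau \in `[0, t]%classic.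
  by rewrite !inE /= !in_itv/= => /andP[-> /ltW].
apply: ge0_integral_le => tau _; rewrite !patchE.
  case: ifPn => //; rewrite inE/= in_itv/= => /andP[tau0 taut]; apply: d0.
  by rewrite tau0 (le_trans (ltW taut)).
case: ifPn => [/sub ->//|_]; case: ifPn => //.
rewrite inE/= in_itv/= => /andP[tau0 taut]; apply: d0.
by rewrite tau0 (le_trans taut).
Qed.

Lemma kinetic_real_ge0 t : 0 <= kinetic_real t.
Proof.
apply: Rintegral_ge0 => x _.
by rewrite mulr_ge0 ?divr_ge0 ?sqr_ge0// ltW.
Qed.

Lemma elastic_real_ge0 t : 0 <= elastic_real t.
Proof.
apply: Rintegral_ge0 => z _; have /andP[k0 _] := ker0 z.
by have /andP[G0 _] := Gam01 t z.2 z.1; rewrite mulr_ge0// mulr_ge0.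
Qed.

Lemma near_right_within t (P : R -> Prop) : 0 <= t < T ->
  (\forall s \near within `[0, T] t^', P s) -> \forall s \near t^'+, P s.
Proof.
move=> /andP[t0 tT] [e e0 eP].
have nP : \forall s \near t^'+, s != t -> `[0, T]%classic s -> P s.
  by exists e => // s se _; exact: eP.
near=> s.
have ts : t < s by near: s; exact: nbhs_right_gt.
have sT : s < T by near: s; exact: nbhs_right_lt.
have : s != t -> `[0, T]%classic s -> P s by near: s.
by apply; rewrite ?gt_eqF//= in_itv/= (le_trans t0 (ltW ts)) ltW.
Unshelve. all: by end_near. Qed.

Lemma near_left_within t (P : R -> Prop) : 0 < t < T ->
  (\forall s \near within `[0, T] t^', P s) -> \forall s \near t^'-, P s.
Proof.
move=> /andP[t0 tT] [e e0 eP].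
have nP : \forall s \near t^'-, s != t -> `[0, T]%classic s -> P s.
  by exists e => // s se _; exact: eP.
near=> s.
have st : s < t by near: s; exact: nbhs_left_lt.
have s0 : 0 < s by near: s; exact: nbhs_left_gt.
have : s != t -> `[0, T]%classic s -> P s by near: s.
by apply; rewrite ?lt_eqF//= in_itv/= (ltW s0) (le_trans (ltW st) (ltW tT)).
Unshelve. all: by end_near. Qed.

(** What Young's inequality leaves of the power of the load besides the kinetic energy: B^2 / (2
    rho) integrated over [Omega]. *)
Definition load_bound : R := rho^-1 / 2 * B ^+ 2 * fine (vol Omega).

Lemma power_le t : t \in `[0, T] ->
  (\int[vol]_(x in Omega) dotp (b t x) (v t x))%R <= load_bound + kinetic_real t.
Proof.
move=> tT; have [Mv Mv0 vM] := Linfty_norm_lty (v_fin tT).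
have c0 : 0 <= rho^-1 / 2 by rewrite divr_ge0// invr_ge0 ltW.
have mb2 : measurable_fun [set: E] (fun x => rho^-1 / 2 * enorm (b t x) ^+ 2).
  apply: measurable_funM => //; apply: measurable_funX; apply: measurable_enorm.
  exact: (@measurable_fun_coord R d.+1 _ E setT).
have b2 : {ae vol, forall x, Omega x ->
    `|rho^-1 / 2 * enorm (b t x) ^+ 2| <= rho^-1 / 2 * B ^+ 2}.
  apply: filterS (b_le tT) => x bx Ox; have {}bx := bx Ox.
  rewrite ger0_norm; last by rewrite mulr_ge0 ?sqr_ge0.
  apply: ler_wpM2l => //.
  by rewrite ler_pXn2r ?nnegrE ?enorm_ge0// (le_trans (enorm_ge0 _) bx).
have ib2 := integrable_ess_bounded mb2 b2.
apply: (@le_trans _ _ (\int[vol]_(x in Omega) (rho^-1 / 2 * enorm (b t x) ^+ 2 +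
    rho * (enorm (v t x) ^+ 2 / 2)))%R).
  apply: le_Rintegral => //.
  - exact: (integrable_dotp (mb t) (mv t) (b_le tT) vM).
  - have := integrableD mO ib2 (integrable_kinetic tT).
    by apply: eq_integrable => // x _ /=; rewrite EFinD.
  - move=> x _; apply: (le_trans (dotp_le_half _ _ rho0)).
    by rewrite lerD2l mulrAC -mulrA.
rewrite RintegralD//; last exact: integrable_kinetic.
rewrite lerD2r /load_bound -Rintegral_cst// /Rintegral fine_le//.
- exact: integrable_fin_num.
- exact: (integrable_fin_num mO (integrable_cst (rho^-1 / 2 * B ^+ 2))).
apply: ae_ge0_le_integral => //.
- by move=> x _; rewrite lee_fin mulr_ge0 ?sqr_ge0.
- by apply/measurable_EFinP; exact: measurable_funTS.
- by move=> x _; rewrite lee_fin mulr_ge0 ?sqr_ge0.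
by apply: filterS b2 => x bx Ox; rewrite lee_fin (le_trans (ler_norm _) (bx Ox)).
Qed.

(** * The energy inequality *)

Hypothesis motion : forall t, t \in `[0, T] ->
  {ae vol, forall x, Omega x -> rho *: a t x + force_real t x = b t x}.

Definition energy_real t : R := kinetic_real t + elastic_real t + damage_real t.

Let integrable_weight W t s : (forall z, 0 <= W z) -> vol2.-integrable OO (EFin \o W) ->
  vol2.-integrable OO (EFin \o (fun z => ker z * (Gam t z.2 z.1 - Gam s z.2 z.1) * W z)).
Proof.
move=> W0 iW.
have mW : measurable_fun OO W by apply/measurable_EFinP; exact: measurable_int iW.
have ikW : vol2.-integrable OO (EFin \o (fun z => kM * W z)).
  have := integrableZl mOO kM iW.
  by apply: eq_integrable => // z _ /=; rewrite EFinM.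
apply: (ae_le_integrable mOO _ ikW).
  by apply: measurable_funM => //; apply: measurable_funM => //; exact: measurable_funB.
apply: aeW => z _; have /andP[k0 kk] := ker0 z.
rewrite !normrM (ger0_norm k0) (ger0_norm (W0 z)) ler_wpM2r//.
rewrite -[leRHS]mulr1; apply: ler_pM => //.
have /andP[? ?] := Gam01 t z.2 z.1; have /andP[? ?] := Gam01 s z.2 z.1.
by rewrite ler_norml; apply/andP; split; lra.
Qed.

Let integrable_gr t : vol2.-integrable OO (EFin \o (fun z => g (r t z))).
Proof.
apply: (ae_le_integrable mOO (mgr t) (integrable_cst2 G)).
by apply: aeW => z _; rewrite ger0_norm.
Qed.

(** The decrease of [Gam] takes from the elastic energy its weight against g(r(s)), and adds to the
    damage at most its weight against W. The difference is the term in |y - x|^(-1/2); the rest of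
    the elastic increment has [Gam] frozen at t. *)
Lemma energy_increment_le t s L : 0 <= t -> t < s -> s < T -> 0 <= L ->
  (forall tau, t <= tau <= s ->
    {ae vol2, forall z, OO z -> `|r tau z - r t z| <= L * `|tau - t| * isq z}) ->
  energy_real s <= energy_real t + (s - t) * (
    (s - t)^-1 * (kinetic_real s - kinetic_real t) +
    2 * K * L * weight (fun z => isq z) t s +
    (s - t)^-1 * \int[vol2]_(z in OO)
      (ker z * Gam t z.2 z.1 * (g (r s z) - g (r t z))))%R.
Proof.
move=> t0 ts sT L0 rL; have ts0 : 0 < s - t by rewrite subr_gt0.
(* Comparing r(tau) and r(s) through r(t) costs 2 L (s - t)|y - x|^(-1/2), and [g] is Lipschitz with
   constant K. *)
pose W z := g (r s z) + 2 * K * L * (s - t) * isq z.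
have c0 : 0 <= 2 * K * L * (s - t) by rewrite !mulr_ge0// ltW.
have W0 z : 0 <= W z by rewrite addr_ge0// mulr_ge0 ?isqrt_dist_ge0.
have iW : vol2.-integrable OO (EFin \o W).
  have := integrableD mOO (integrable_gr s) (integrable_isq (2 * K * L * (s - t))).
  by apply: eq_integrable => // z _ /=; rewrite EFinD.
have gW tau : t <= tau <= s -> {ae vol2, forall z, OO z -> g (r tau z) <= W z}.
  move=> /[dup] tauts /andP[ttau taus].
  have ts' : t <= s <= s by rewrite lexx ltW.
  apply: filterS2 (rL tau tauts) (rL s ts') => z r1 r2 OOz.
  have {}r1 := r1 OOz; have {}r2 := r2 OOz.
  have r12 : `|r tau z - r s z| <= 2 * L * (s - t) * isq z.
    apply: (le_trans (ler_distD (r t z) _ _)).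
    rewrite (distrC (r t z)) (le_trans (lerD r1 r2))// -mulrDl.
    rewrite ler_wpM2r ?isqrt_dist_ge0// -mulrDr [2 * L]mulrC -mulrA ler_wpM2l//.
    by rewrite !ger0_norm ?subr_ge0// ?(ltW ts)//; lra.
  have := le_trans (ler_norm _) (lipg (r tau z) (r s z)); rewrite lerBlDl => /le_trans; apply.
  rewrite /W lerD2l (le_trans (ler_wpM2l K0 r12))// le_eqVlt; apply/orP; left.
  by apply/eqP; ring.
have dD := damage_real_increment_le t0 (ltW ts) sT
  (damage_density_increment_le t0 (ltW ts) sT W0 iW gW).
have isq0 (z : E * E) : 0 <= isq z by exact: isqrt_dist_ge0.
have iisq : vol2.-integrable OO (EFin \o (fun z => isq z)) by exact: integrable_isqrt_dist.
have iwi := integrable_weight t s isq0 iisq.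
have iwg := @integrable_weight (fun z => g (r s z)) t s (fun z => g0 _) (integrable_gr s).
have ikg : vol2.-integrable OO
    (EFin \o (fun z => ker z * Gam t z.2 z.1 * (g (r s z) - g (r t z)))).
  have := integrableB mOO (integrableD mOO (integrable_elastic s) iwg) (integrable_elastic t).
  by apply: eq_integrable => // z _ /=; rewrite -?EFinD -?EFinB -?EFinD; congr EFin; ring.
have WE : weight W t s = weight (fun z => g (r s z)) t s +
    2 * K * L * (s - t) * weight (fun z => isq z) t s.
  rewrite /weight -RintegralZl// -RintegralD//.
    by apply: eq_Rintegral => z _; rewrite /W; ring.
  have := integrableZl mOO (2 * K * L * (s - t)) iwi.
  by apply: eq_integrable => // z _ /=; rewrite EFinM.
have EE : elastic_real s = elastic_real t - weight (fun z => g (r s z)) t s +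
    (\int[vol2]_(z in OO) (ker z * Gam t z.2 z.1 * (g (r s z) - g (r t z))))%R.
  apply/eqP; rewrite addrAC eq_sym subr_eq /elastic_real /weight.
  rewrite -RintegralD//; last exact: integrable_elastic.
  rewrite -RintegralD//; last exact: integrable_elastic.
  by apply/eqP; apply: eq_Rintegral => z _; ring.
rewrite /energy_real EE; set I := Rintegral _ _ _ in dD EE *.
rewrite !mulrDr !mulrA mulfV ?gt_eqF// !mul1r.
move: dD; rewrite WE; clear EE WE.
move: (weight _ t s) (weight _ t s) (kinetic_real s) (kinetic_real t) (elastic_real t)
  (damage_real s) (damage_real t) @I => wg wi ks kt et ds dt I.
lra.
Qed.

(** The bracket of the increment bound tends to the power of the load, which is at most [load_bound]
    plus K(t), hence plus the whole energy since E and D are nonnegative; [eta] leaves room for the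
    limit. *)
Lemma energy_right t eta : 0 <= t < T -> 0 < eta ->
  \forall s \near t^'+, energy_real s <=
    energy_real t + (s - t) * (energy_real t + load_bound + eta).
Proof.
move=> /[dup] t0T /andP[t0 tT] eta0.
have tin : t \in `[0, T] by rewrite in_itv/= t0 ltW.
have [L L0 nL] := scaled_strain_increment_le tin.
pose Q s := (s - t)^-1 * (kinetic_real s - kinetic_real t) +
    2 * K * L * weight (fun z => isq z) t s +
    (s - t)^-1 * (\int[vol2]_(z in OO)
      (ker z * Gam t z.2 z.1 * (g (r s z) - g (r t z))))%R.
have cQ : Q s @[s --> within `[0, T] t^'] -->
    (\int[vol]_(x in Omega) dotp (b t x) (v t x))%R.
  rewrite -(power_balance tin (motion tin)) -[X in X + _]addr0; apply: cvgD.
    apply: cvgD; first exact: cvg_kinetic_quotient.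
    rewrite -[X in _ --> X](mulr0 (2 * K * L)); apply: cvgMl_tmp.
    exact: (@cvg_weight_increment (fun z : E * E => isq z) t
      (fun z => isqrt_dist_ge0 _ _) (integrable_isqrt_dist mO bO)).
  exact: cvg_elastic_quotient.
have PQ : (\int[vol]_(x in Omega) dotp (b t x) (v t x))%R <
    energy_real t + load_bound + eta.
  apply: (le_lt_trans (power_le tin)); rewrite /energy_real.
  have := elastic_real_ge0 t; have := damage_real_ge0 t0T; lra.
have /(near_right_within t0T) nQ : \forall s \near within `[0, T] t^',
    Q s <= energy_real t + load_bound + eta by move/cvgr_le : cQ => /(_ _ PQ).
(* The increment bound needs the strain estimate at every time of [t, s], so the neighbourhood is
   made explicit. *)
have [e /= e0 eL] : exists2 e, 0 < e & forall tau, t < tau -> tau < t + e -> tau < T ->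
    {ae vol2, forall z, OO z -> `|r tau z - r t z| <= L * `|tau - t| * isq z}.
  have [e /= e0 eL] := nL; exists e => // tau ttau taue tauT.
  apply: (eL tau _ _ _).2.
  - by rewrite /= ltr0_norm ?subr_lt0//; lra.
  - by rewrite gt_eqF.
  - by rewrite /= in_itv/= (le_trans t0 (ltW ttau)) ltW.
near=> s.
have ts : t < s by near: s; exact: nbhs_right_gt.
have sT : s < T by near: s; exact: nbhs_right_lt.
have se : s < t + e by near: s; apply: nbhs_right_lt; rewrite ltrDl.
have Qs : Q s <= energy_real t + load_bound + eta by near: s.
apply: (le_trans (energy_increment_le t0 ts sT L0 _)).
  move=> tau /andP[]; rewrite le_eqVlt => /predU1P[<- _|ttau taus].
    by apply: aeW => z _; rewrite !subrr normr0 mulr0 mul0r.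
  by apply: eL => //; [exact: le_lt_trans se|exact: le_lt_trans sT].
by rewrite lerD2l ler_wpM2l// subr_ge0 ltW.
Unshelve. all: by end_near. Qed.

(** The kinetic and elastic parts are continuous, and the damage cannot jump upwards at [t]: its
    increment is at most a weighted decrease of [Gam], which tends to zero. *)
Lemma energy_left t eta : 0 < t < T -> 0 < eta ->
  \forall s \near t^'-, energy_real t <= energy_real s + eta.
Proof.
move=> /[dup] t0T /andP[t0 tT] eta0.
have tin : t \in `[0, T] by rewrite in_itv/= !ltW.
have cK : kinetic_real s - kinetic_real t @[s --> within `[0, T] t^'] --> 0.
  have nt : \forall s \near within `[0, T] t^', s != t.
    by apply: cvg_within; exact: withinT.
  have ct : s - t @[s --> within `[0, T] t^'] --> 0.
    rewrite -[X in _ --> X](subrr t); apply: cvgB; last exact: cvg_cst.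
    by apply: cvg_within_filter; apply: cvg_within_filter; exact: cvg_id.
  have cM : (s - t) * ((s - t)^-1 * (kinetic_real s - kinetic_real t))
      @[s --> within `[0, T] t^'] --> 0.
    rewrite -[X in _ --> X](mul0r
      (\int[vol]_(x in Omega) (rho * dotp (a t x) (v t x)))%R).
    by apply: cvgM; [exact: ct|exact: cvg_kinetic_quotient].
  apply: cvg_trans cM; apply: near_eq_cvg; near=> s.
  have st : s != t by near: s.
  by rewrite mulrA mulfV ?mul1r// subr_eq0.
have cE : elastic_real s @[s --> within `[0, T] t^'] --> elastic_real t by exact: cvg_elastic.
have cD : weight (fun=> G) t s @[s --> within `[0, T] t^'] --> 0.
  exact: (@cvg_weight_increment (fun=> G) t (fun=> GG0) (integrable_cst2 G)).
have eta3 : 0 < eta / 3 by rewrite divr_gt0.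
have /(near_left_within t0T) nK : \forall s \near within `[0, T] t^',
    `|0 - (kinetic_real s - kinetic_real t)| <= eta / 3.
  by move/cvgrPdist_le : cK; exact.
have /(near_left_within t0T) nE : \forall s \near within `[0, T] t^',
    `|elastic_real t - elastic_real s| <= eta / 3.
  by move/cvgrPdist_le : cE; exact.
have /(near_left_within t0T) nD : \forall s \near within `[0, T] t^',
    `|0 - weight (fun=> G) t s| <= eta / 3.
  by move/cvgrPdist_le : cD; exact.
near=> s.
have st : s < t by near: s; exact: nbhs_left_lt.
have s0 : 0 <= s by near: s; exact: nbhs_left_ge.
have hK : `|0 - (kinetic_real s - kinetic_real t)| <= eta / 3 by near: s.
have hE : `|elastic_real t - elastic_real s| <= eta / 3 by near: s.
have hD : `|0 - weight (fun=> G) t s| <= eta / 3 by near: s.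
have dD := damage_real_increment_le s0 (ltW st) tT (weight_cst s0 (ltW st) tT).
(* The limit [cD] has the fixed time first, the damage increment has it last. *)
have wN : weight (fun=> G) s t = - weight (fun=> G) t s.
  rewrite /weight -mulN1r -RintegralZl//; last first.
    exact: (integrable_weight _ _ (fun=> GG0) (integrable_cst2 G)).
  by apply: eq_Rintegral => z _; ring.
rewrite wN in dD; rewrite /energy_real.
move: dD hK hE hD; rewrite !ler_norml.
move: (weight _ t s) (kinetic_real s) (kinetic_real t) (elastic_real s) (elastic_real t)
  (damage_real s) (damage_real t) => c ks kt es et ds dt.
by move=> ? /andP[? ?] /andP[? ?] /andP[? ?]; lra.
Unshelve. all: by end_near. Qed.

Lemma energy_real_le t : 0 <= t < T ->
  energy_real t + load_bound <= (kinetic_real 0 + elastic_real 0 + load_bound) * expR t.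
Proof.
move=> /[dup] t0T /andP[t0 tT].
have lb0 : 0 <= load_bound.
  rewrite /load_bound mulr_ge0 ?fine_ge0// mulr_ge0 ?sqr_ge0//.
  by rewrite divr_ge0// invr_ge0 ltW.
have e0 : energy_real 0 = kinetic_real 0 + elastic_real 0.
  by rewrite /energy_real damage_real0 addr0.
(* Applied on [0, t], since the damage estimates stop short of T. *)
rewrite -e0; apply: (@gronwall_right _ _ t); last by rewrite t0 lexx.
- move=> s /andP[s0 st]; rewrite addr_ge0// /energy_real !addr_ge0//.
  + exact: kinetic_real_ge0.
  + exact: elastic_real_ge0.
  + by apply: damage_real_ge0; rewrite s0 (le_lt_trans st).
- move=> s eta /andP[s0 st] eta0; apply: energy_right => //.
  by rewrite s0 (lt_trans st).
- move=> s eta /andP[s0 st] eta0; apply: energy_left => //.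
  by rewrite s0 (le_lt_trans st).
Qed.

End energies.

(** * Identification of the peridynamic energies *)

Section identification.
Context {R : realType} {d : nat}.
Local Notation E := 'rV[R]_d.+1.
Local Notation vol := (@lebesgue_rV R d.+1).
Local Notation vol2 := (vol \x vol)%E.
Implicit Types (Omega : set E) (J g : R -> R) (eps T rho : R).

(** Without the characteristic function of [Omega] the kernel is symmetric in its two points, as the
    exchange of x and y requires. *)
Definition bond_weight J eps (z : E * E) : R :=
  J (enorm (z.2 - z.1) / eps) / (eps * @ball_volume R d.+1 eps).

Lemma peridynamic_kernelE Omega J eps y x : Omega y ->
  peridynamic_kernel Omega J eps y x = bond_weight J eps (x, y).
Proof. by move=> Oy; rewrite /peridynamic_kernel indicE mem_set// mul1r. Qed.

Lemma bond_weightC J eps z : bond_weight J eps (z.2, z.1) = bond_weight J eps z.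
Proof. by rewrite /bond_weight /= enormB. Qed.

Lemma bond_weight_bounds J eps z : influence_function J -> 0 < eps ->
  0 <= bond_weight J eps z <= J 0 / (eps * @ball_volume R d.+1 eps).
Proof.
move=> [J0 Jh _ _] eps0.
have r0 : 0 <= enorm (z.2 - z.1) / eps by rewrite divr_ge0 ?enorm_ge0// ltW.
have c0 : 0 <= (eps * @ball_volume R d.+1 eps)^-1.
  by rewrite invr_ge0 mulr_ge0 ?(ltW eps0)// mulr_ge0 ?fine_ge0// exprn_ge0// ltW.
by rewrite mulr_ge0 ?J0//= ler_wpM2r// Jh.
Qed.

Lemma measurable_bond_weight J eps : influence_function J -> 0 < eps ->
  measurable_fun [set: E * E] (bond_weight J eps).
Proof.
move=> [J0 Jh _ _] eps0; apply: measurable_funM => //.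
(* J is monotone on the half-line only; its constant extension to the left is monotone on the line,
   hence measurable. *)
pose J' s := J (Num.max 0 s).
have mJ' : measurable_fun [set: R] J'.
  apply: nonincreasing_measurable => // s t st; apply: Jh; first by rewrite le_max lexx.
  by rewrite ge_max le_max lexx/= le_max st orbT.
rewrite (_ : (fun z => _) = J' \o (fun z : E * E => enorm (z.2 - z.1) / eps)).
  apply: measurableT_comp => //; apply: measurable_funM => //.
  exact: measurable_enorm_dist.
apply/funext => z /=; rewrite /J' (max_idPr _)//.
by rewrite divr_ge0 ?enorm_ge0// ltW.
Qed.

Lemma measurable_elastic_integrand (k : E * E -> R) g (Gam : E -> E -> R) (w : E -> E) D :
  measurable D -> measurable_fun [set: E * E] k -> continuous g ->
  measurable_fun D (fun z => Gam z.2 z.1) -> measurable_fun [set: E] w ->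
  measurable_fun D (fun z => k z * Gam z.2 z.1 * g (scaled_strain z.2 z.1 w)).
Proof.
move=> mD mk cg mG mw; apply: measurable_funM.
  by apply: measurable_funM => //; exact: measurable_funTS.
apply: measurable_funTS; apply: measurableT_comp; first exact: continuous_measurable_fun.
exact: measurable_scaled_strain.
Qed.

Lemma elastic_energyE Omega J g eps gam u (Gam : E -> E -> R) (w : E -> E) t :
  measurable Omega -> influence_function J -> 0 < eps ->
  continuous g -> (forall r, 0 <= g r) ->
  (forall y x, Omega y -> Omega x -> gam u y x t = Gam y x) ->
  (forall y x, 0 <= Gam y x) ->
  measurable_fun (Omega `*` Omega) (fun z => Gam z.2 z.1) ->
  measurable_fun [set: E] w -> (forall x, Omega x -> u t x = w x) ->
  elastic_energy Omega J g eps gam u t =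
  (\int[vol2]_(z in Omega `*` Omega)
    (bond_weight J eps z * Gam z.2 z.1 * g (scaled_strain z.2 z.1 w))%:E)%E.
Proof.
move=> mO iJ eps0 cg g0 gamE G0 mG mw uw.
rewrite -(@ge0_iterated_integral _ _ _ _ _ vol vol Omega Omega mO mO (fun z =>
  (bond_weight J eps z * Gam z.2 z.1 * g (scaled_strain z.2 z.1 w))%:E)).
- apply: eq_integral => x /set_mem Ox; apply: eq_integral => y /set_mem Oy.
  congr EFin; rewrite peridynamic_kernelE// gamE//.
  by rewrite (@eq_scaled_strain _ _ y x (u t) w)// uw.
- apply/measurable_EFinP; apply: measurable_elastic_integrand => //.
    exact: measurableX.
  exact: measurable_bond_weight.
- move=> z _; have /andP[k0 _] := bond_weight_bounds z iJ eps0.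
  by rewrite lee_fin mulr_ge0// mulr_ge0.
Qed.

(** The outer minus sign is carried through three integrals onto the derivative; the constant sign
    of the integrand allows this without integrability. *)
Lemma damage_energyE Omega J g eps gam u (w : R -> E -> E) (Gam : R -> E -> E -> R) T t :
  influence_function J -> 0 < eps -> (forall r, 0 <= g r) -> 0 <= t < T ->
  (forall t y x, 0 <= t <= T -> Omega y -> Omega x -> gam u y x t = Gam t y x) ->
  (forall y x, {homo (fun t => Gam t y x) : s t /~ s <= t}) ->
  (forall t x, 0 <= t <= T -> Omega x -> u t x = w t x) ->
  damage_energy Omega J g eps gam u t =
  damage_ereal Omega w (bond_weight J eps) g (gam u) t.
Proof.
move=> iJ eps0 g0 /andP[t0 tT] gamE dGam uw.
pose f tau x y := bond_weight J eps (x, y) * - ae_derive (gam u y x) tau *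
  g (scaled_strain y x (w tau)).
have f0 tau x y : `[0, t]%classic tau -> Omega x -> Omega y -> (0 <= (f tau x y)%:E)%E.
  rewrite /= in_itv/= => /andP[tau0 taut] Ox Oy.
  have /andP[k0 _] := bond_weight_bounds (x, y) iJ eps0.
  rewrite lee_fin mulr_ge0// mulr_ge0//.
  have tauT : 0 <= tau < T by rewrite tau0 (le_lt_trans taut).
  apply: (@ae_derive_le_quotient _ (gam u y x) (fun t => Gam t y x) T tau 0 tauT _ _ _).1 => //.
  by move=> s sT; exact: gamE.
rewrite /damage_energy /damage_ereal /damage_density -/(f _ _ _).
transitivity (- \int[lebesgue_measure]_(tau in `[0%R, t])
    - \int[vol]_(x in Omega) \int[vol]_(y in Omega) (f tau x y)%:E)%E; last first.
  rewrite integral_ge0N ?oppeK// => tau taut.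
  by apply: integral_ge0 => x Ox; apply: integral_ge0 => y Oy; exact: f0.
congr (- _)%E; apply: eq_integral => tau /set_mem taut.
transitivity (\int[vol]_(x in Omega) - \int[vol]_(y in Omega) (f tau x y)%:E)%E; last first.
  rewrite integral_ge0N// => x Ox.
  by apply: integral_ge0 => y Oy; exact: f0.
apply: eq_integral => x /set_mem Ox; rewrite -integral_ge0N => [|y Oy]; last exact: f0.
apply: eq_integral => y /set_mem Oy; rewrite -EFinN; congr EFin.
rewrite peridynamic_kernelE// /f.
have tau0T : 0 <= tau <= T.
  by move: taut; rewrite /= in_itv/= => /andP[-> /le_trans ->//]; exact: ltW.
rewrite (@eq_scaled_strain _ _ y x (u tau) (w tau)) ?uw//.
by ring.
Qed.

Lemma Linfty_derivative_extend Omega T (u u' : R -> E -> E) :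
  Linfty_derivative Omega T u u' ->
  Linfty_derivative Omega T (extend_curve Omega T u) (extend_curve Omega T u').
Proof.
move=> du t tT; apply: cvg_trans (du t tT); apply: near_eq_cvg; near=> s.
have sT : s \in `[0, T] by near: s; exact: withinT.
have t0T : 0 <= t <= T by move: tT; rewrite in_itv.
have s0T : 0 <= s <= T by move: sT; rewrite in_itv.
by apply: eq_Linfty_norm => x Ox; rewrite !extend_curveE.
Unshelve. all: by end_near. Qed.

Lemma spaceX_measurable Omega w : spaceX Omega w -> measurable_fun Omega w.
Proof. by case. Qed.

Lemma spaceX_lty Omega w : spaceX Omega w -> (Linfty_norm Omega w < +oo)%E.
Proof. by case. Qed.

Lemma force_realE Omega J g eps gam u (w : R -> E -> E) (Gam : R -> E -> E -> R) t x :
  Omega x -> (forall y, Omega y -> u t y = w t y) ->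
  (forall y, Omega y -> gam u y x t = Gam t y x) ->
  force Omega J g eps gam u t x =
  force_real Omega w (bond_weight J eps) g Gam t x.
Proof.
move=> Ox uw gamE; apply: eq_mx => _ i.
apply: (congr1 (@GRing.opp R)).
apply: eq_Rintegral => y /set_mem Oy.
rewrite (peridynamic_kernelE _ _ _ Oy).
rewrite (gamE _ Oy).
by rewrite (eq_scaled_strain (uw _ Oy) (uw _ Ox)).
Qed.

Lemma peridynamic_energy_le Omega T rho J g (rm re rc rp Cm Cp : R) gam eps
    (b : R -> E -> E) (u0 v0 : E -> E) (u u' u'' : R -> E -> E) (B : R) :
  bounded_domain Omega -> 0 < T -> 0 < rho ->
  (forall t, t \in `[0, T] -> {ae vol, forall x, Omega x -> enorm (b t x) <= B}) ->
  influence_function J -> potential g rm re rc rp Cm Cp ->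
  degradation_factor rp gam -> 0 < eps ->
  spaceX Omega u0 -> spaceX Omega v0 -> C0_curve Omega T b ->
  solution Omega J g eps gam T rho b u0 v0 u u' u'' ->
  forall t, 0 < t < T ->
  (kinetic_energy Omega rho (u' t) + elastic_energy Omega J g eps gam u t +
   damage_energy Omega J g eps gam u t <=
   ((fine (initial_energy Omega J g eps gam rho u0 v0) + load_bound Omega rho B) *
     expR T)%:E)%E.
Proof.
move=> [_ /open_rV_measurable mO _ bO] T0 rho0 bB iJ pg dgam eps0 Xu0 Xv0 [Xb _] sol.
have [[Xu _] [Xu' _] [Xu'' _] [du du'] cu] := solution_C2 sol.
have g0 r := potential_ge0 r pg.
have cg := potential_continuous pg.
have [G gG] := potential_ubound pg.
have [K [K0 g'K lipg]] := potential_lipschitz pg.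
have T0' := ltW T0.
have itvT t : 0 <= t <= T -> t \in `[0, T] by rewrite in_itv.
have muX (c : R -> E -> E) : (forall t, t \in `[0, T] -> spaceX Omega (c t)) ->
    forall t, 0 <= t <= T -> measurable_fun Omega (c t).
  by move=> Xc t /itvT/Xc/spaceX_measurable.
have [Gam [[Gam01 dGam cGam GamC mGam] gamE]] :=
  degradation_extension dgam T0' mO (muX _ Xu) cu.
pose w := extend_curve Omega T u; pose v := extend_curve Omega T u'.
pose a := extend_curve Omega T u''; pose bb := extend_curve Omega T b.
have mw : forall t, measurable_fun [set: E] (w t).
  exact: (measurable_extend_curve mO T0' (muX _ Xu)).
have mv : forall t, measurable_fun [set: E] (v t).
  exact: (measurable_extend_curve mO T0' (muX _ Xu')).
have ma : forall t, measurable_fun [set: E] (a t).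
  exact: (measurable_extend_curve mO T0' (muX _ Xu'')).
have mb : forall t, measurable_fun [set: E] (bb t).
  exact: (measurable_extend_curve mO T0' (muX _ Xb)).
have cw := continuous_extend_curve T0' cu.
have ext_lty (c : R -> E -> E) : (forall t, t \in `[0, T] -> spaceX Omega (c t)) ->
    forall t, t \in `[0, T] -> (Linfty_norm Omega (extend_curve Omega T c t) < +oo)%E.
  move=> Xc t /[dup] tT; rewrite in_itv/= => t0T.
  rewrite (@eq_Linfty_norm _ _ Omega _ (c t)); first exact: spaceX_lty (Xc t tT).
  by move=> x Ox; rewrite extend_curveE.
have bbB t : t \in `[0, T] -> {ae vol, forall x, Omega x -> enorm (bb t x) <= B}.
  move=> /[dup] tT; rewrite in_itv/= => t0T; apply: filterS (bB t tT) => x bx Ox.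
  by rewrite /bb extend_curveE//; exact: bx.
pose ker := bond_weight J eps.
have mker := measurable_bond_weight iJ eps0.
have ker0 z := bond_weight_bounds z iJ eps0.
have motion t : t \in `[0, T] -> {ae vol, forall x, Omega x ->
    rho *: a t x + force_real Omega w ker g Gam t x = bb t x}.
  move=> /[dup] tT; rewrite in_itv/= => t0T.
  apply: filterS (solution_eq sol tT) => x eqx Ox.
  have aE : a t x = u'' t x := extend_curveE u'' Ox t0T.
  have bE : bb t x = b t x := extend_curveE b Ox t0T.
  have fE : force Omega J g eps gam u t x = force_real Omega w ker g Gam t x.
    apply: force_realE => // y Oy; first exact: esym (extend_curveE u Oy t0T).
    exact: gamE.
  rewrite aE bE -fE; exact: eqx.
have main := energy_real_le mO bO rho0 mw cw mv ma mb
  (Linfty_derivative_extend du) (Linfty_derivative_extend du')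
  (ext_lty _ Xu') (ext_lty _ Xu'') bbB mker ker0 (@bond_weightC J eps) g0 gG
  (potential_derivable pg) (potential_derive_continuous pg) K0 g'K lipg
  Gam01 dGam cGam GamC mGam gamE motion.
have kinE t : 0 <= t <= T ->
    kinetic_energy Omega rho (u' t) = (kinetic_real Omega rho v t)%:E.
  move=> t0T; rewrite /kinetic_real /Rintegral fineK; last first.
    exact: (integrable_fin_num mO (integrable_kinetic mO bO rho0 mv (ext_lty _ Xu') (itvT _ t0T))).
  by apply: eq_integral => x /set_mem Ox; rewrite /v extend_curveE.
have iel t := integrable_elastic mO bO mw mker ker0 g0 gG (potential_derivable pg) Gam01 mGam t.
have G0 t y x : 0 <= Gam t y x by have /andP[] := Gam01 t y x.
have mOO : measurable (Omega `*` Omega) by exact: measurableX.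
have elE t : 0 <= t <= T ->
    elastic_energy Omega J g eps gam u t = (elastic_real Omega w ker g Gam t)%:E.
  move=> t0T; rewrite (@elastic_energyE Omega J g eps gam u (Gam t) (w t))//.
  - by rewrite /elastic_real /Rintegral fineK//; exact: (integrable_fin_num mOO (iel t)).
  - by move=> y x Oy Ox; exact: gamE.
  - exact: measurable_funTS.
  - by move=> x Ox; rewrite /w extend_curveE.
have zT : (0 : R) <= 0 <= T by apply/andP; split; [exact: lexx|exact: T0'].
(* The solution takes its initial values only almost everywhere, so the two initial energies are
   compared through their integrands. *)
have init : fine (initial_energy Omega J g eps gam rho u0 v0) =
    kinetic_real Omega rho v 0 + elastic_real Omega w ker g Gam 0.
  suff [k0 e0] : kinetic_energy Omega rho v0 = kinetic_energy Omega rho (u' 0) /\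
      elastic_energy Omega J g eps gam (fun=> u0) 0 = elastic_energy Omega J g eps gam u 0.
    rewrite /initial_energy k0 e0 (kinE 0 zT) (elE 0 zT).
    by rewrite -EFinD.
  have mkin (c : E -> E) : measurable_fun Omega c ->
      measurable_fun Omega (fun x => (rho * (enorm (c x) ^+ 2 / 2))%:E).
    move=> mc; apply/measurable_EFinP; apply: measurable_funM => //.
    apply: measurable_funM => //; apply: measurable_funX; apply: measurable_enorm.
    exact: measurable_fun_coord.
  have pkin (c : E -> E) x : Omega x -> (0 <= (rho * (enorm (c x) ^+ 2 / 2))%:E)%E.
    by rewrite lee_fin mulr_ge0 ?divr_ge0 ?sqr_ge0// ltW.
  split.
    apply: ge0_ae_eq_integral => //.
    - exact: (mkin _ (spaceX_measurable Xv0)).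
    - exact: (mkin _ (spaceX_measurable (Xu' _ (itvT _ zT)))).
    - exact: pkin.
    - exact: pkin.
    by apply: filterS (solution_v0 sol) => x vx Ox; rewrite vx.
  pose w0 := u0 \_ Omega.
  have mw0 : measurable_fun [set: E] w0.
    by apply/(measurable_restrictT _ _).1 => //; exact: (spaceX_measurable Xu0).
  have mu0 : forall t, 0 <= t <= T -> measurable_fun Omega u0.
    by move=> t _; exact: (spaceX_measurable Xu0).
  have cu0 x : Omega x -> {within `[0, T], continuous (fun t : R => u0 x)}.
    by move=> _; apply: continuous_subspaceT => t; exact: cvg_cst.
  (* The constant curve [u0] gets an extension of its own, which makes its elastic integrand
     measurable. *)
  have [Gam0 [[Gam001 _ _ _ mGam0] gamE0]] :=
    degradation_extension (u := fun=> u0) dgam T0' mO mu0 cu0.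
  have G00 y x : 0 <= Gam0 0 y x by have /andP[] := Gam001 0 y x.
  have uw0 x : Omega x -> u0 x = w0 x by move=> Ox; rewrite /w0 patchE mem_set.
  have uw x : Omega x -> u 0 x = w 0 x by move=> Ox; rewrite /w extend_curveE.
  rewrite (elastic_energyE (Gam := Gam0 0) mO iJ eps0 cg g0
    (fun y x => gamE0 0 y x zT) G00 (measurable_funTS (mGam0 0)) mw0 uw0).
  rewrite (elastic_energyE (Gam := Gam 0) mO iJ eps0 cg g0
    (fun y x => gamE 0 y x zT) (G0 0) (measurable_funTS (mGam 0)) (mw 0) uw).
  have pel (G' : E -> E -> R) c z : (forall y x, 0 <= G' y x) ->
      (0 <= (ker z * G' z.2 z.1 * g (scaled_strain z.2 z.1 c))%:E)%E.
    move=> G'0; have /andP[k0 _] := ker0 z.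
    by rewrite lee_fin mulr_ge0// mulr_ge0.
  apply: ge0_ae_eq_integral => //.
  - apply/measurable_EFinP; apply: measurable_elastic_integrand => //.
    exact: measurable_funTS.
  - apply/measurable_EFinP; apply: measurable_elastic_integrand => //.
    exact: measurable_funTS.
  - by move=> z _; exact: pel.
  - by move=> z _; exact: pel.
  have u1 := @ae_setX_fst _ _ _ _ _ vol vol Omega Omega _ (solution_u0 sol).
  have u2 := @ae_setX_snd _ _ _ _ _ vol vol Omega Omega _ (solution_u0 sol).
  apply: filterS2 u1 u2 => z u1 u2 [/= O1 O2].
  have {}u1 := u1 (conj O1 O2); have {}u2 := u2 (conj O1 O2).
  rewrite -gamE0// -gamE// (degradation_factor_at0 (v := u) dgam)//.
  rewrite (@eq_scaled_strain _ _ z.2 z.1 w0 (w 0))//.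
    by rewrite /w0 patchE mem_set// /w extend_curveE.
  by rewrite /w0 patchE mem_set// /w extend_curveE.
move=> t /andP[t0 tT].
have t0T : 0 <= t <= T by rewrite !ltW.
have t0T' : 0 <= t < T by rewrite ltW.
have damE : damage_energy Omega J g eps gam u t =
    (damage_real Omega w ker g (gam u) t)%:E.
  rewrite (@damage_energyE Omega J g eps gam u w Gam T)//; last first.
    by move=> s x s0T Ox; rewrite /w extend_curveE.
  rewrite /damage_real fineK//.
  exact: (damage_ereal_fin_num mO bO mw mker ker0 g0 gG (potential_derivable pg)
    Gam01 dGam cGam mGam gamE t0T').
rewrite kinE// elE// damE -!EFinD lee_fin init.
have lb0 : 0 <= load_bound Omega rho B.
  rewrite /load_bound mulr_ge0 ?fine_ge0// mulr_ge0 ?sqr_ge0//.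
  by rewrite divr_ge0// invr_ge0 ltW.
apply: (@le_trans _ _ (energy_real Omega rho w v ker g Gam (gam u) t + load_bound Omega rho B)).
  by rewrite lerDl.
apply: (le_trans (main t t0T')); apply: ler_wpM2l; last by rewrite ler_expR ltW.
rewrite !addr_ge0//; first exact: kinetic_real_ge0.
exact: elastic_real_ge0.
Qed.

End identification.

(* [C] depends on the initial conditions through their energy and on the load
   history; it is fixed before [eps], the influence function, the potential
   and the degradation factor. *)
Theorem theorem4p1 (R : realType) (d : nat) (Omega : set 'rV[R]_d) (T rho : R) :
  d = 2%N \/ d = 3%N -> bounded_domain Omega -> 0 < T -> 0 < rho ->
  exists C : R -> (R -> 'rV[R]_d -> 'rV[R]_d) -> R,
    (forall b, {homo C^~ b : A A' / A <= A'}) /\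
    forall (J g : R -> R) (rm re rc rp Cm Cp : R)
      (gam : (R -> 'rV[R]_d -> 'rV[R]_d) -> 'rV[R]_d -> 'rV[R]_d -> R -> R)
      (eps : R) (b : R -> 'rV[R]_d -> 'rV[R]_d) (u0 v0 : 'rV[R]_d -> 'rV[R]_d)
      (u u' u'' : R -> 'rV[R]_d -> 'rV[R]_d),
    influence_function J -> potential g rm re rc rp Cm Cp ->
    degradation_factor rp gam -> 0 < eps ->
    spaceX Omega u0 -> spaceX Omega v0 -> C0_curve Omega T b ->
    solution Omega J g eps gam T rho b u0 v0 u u' u'' ->
    (ereal_sup [set kinetic_energy Omega rho (u' t)
                    + elastic_energy Omega J g eps gam u t
                    + damage_energy Omega J g eps gam u t
               | t in `]0%R, T[]
     < (C (fine (initial_energy Omega J g eps gam rho u0 v0)) b)%:E)%E.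
Proof.
move=> d23 dom T0 rho0.
(* Dimension 0 is excluded; the integrability of the singular factor uses a first coordinate. *)
case: d Omega d23 dom => [? []//|d Omega _ dom].
pose bnd (b : R -> 'rV[R]_d.+1 -> 'rV[R]_d.+1) (M : R) := forall t, t \in `[0, T] ->
  {ae lebesgue_rV d.+1, forall x, Omega x -> enorm (b t x) <= M}.
(* [xget] selects a bound of the load from [b] alone; one exists by compactness of [0, T], so the
   default 0 is not an issue. The final 1 makes the inequality strict. *)
exists (fun A b => (A + load_bound Omega rho (xget 0 (bnd b))) * expR T + 1); split.
  by move=> b A A' AA'; rewrite lerD2r ler_wpM2r ?expR_ge0// lerD2r.
move=> J g rm re rc rp Cm Cp gam eps b u0 v0 u u' u'' iJ pg dgam eps0 Xu0 Xv0 cb sol.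
have [M bM] : exists M, bnd b M.
  by apply: Linfty_curve_bounded cb.2 => t /cb.1/spaceX_lty.
have bB : bnd b (xget 0 (bnd b)) by exact: (xgetI 0 bM).
apply: (@le_lt_trans _ _ (((fine (initial_energy Omega J g eps gam rho u0 v0) +
  load_bound Omega rho (xget 0 (bnd b))) * expR T)%:E)).
  apply: ge_ereal_sup => _ [t /= tT <-].
  apply: (peridynamic_energy_le dom T0 rho0 bB iJ pg dgam eps0 Xu0 Xv0 cb sol).
  by move: tT; rewrite in_itv.
by rewrite lte_fin ltrDl.
Qed.
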